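(* Let $R$ be a commutative noetherian ring, let $M \in \mathsf{D}_{\mathsf{b}}(R)$, and let $\mathsf{C}$ be one of the following four classes of $R$-modules: the flat modules, the Gorenstein projective modules, the Gorenstein injective modules, or the Gorenstein flat modules. Then $$\operatorname{level}_R^{\mathsf{C}}(M) \le \max\{2,\ \operatorname{\mathsf{C}-dim}(\mathrm{H}(M)^{\oplus}) + 1\},$$ where $\operatorname{\mathsf{C}-dim}$ denotes the flat dimension, Gorenstein projective dimension, Gorenstein injective dimension, or Gorenstein flat dimension, respectively.
   Context: $\mathsf{D}(R)$ is the derived category of $R$; $\mathsf{D}_{\mathsf{b}}(R)$ is the full subcategory of complexes $M$ with bounded homology ($\mathrm{H}_i(M)=0$ for all $|i|\gg 0$). Complexes are graded homologically. $\mathrm{H}(M)^{\oplus} = \bigoplus_{i\in\mathbb{Z}} \mathrm{H}_i(M)$, an $R$-module. Level: for a nonempty collection $\mathsf{C}$ of objects of $\mathsf{D}(R)$ (modules are viewed as complexes concentrated in degree $0$), set $\operatorname{thick}_R^0(\mathsf{C}) = \{0\}$; $\operatorname{thick}_R^1(\mathsf{C})$ is the smallest collection of objects containing $\mathsf{C}$ and closed under isomorphism, shifts, finite direct sums and direct summands; for $n\ge 2$, $\operatorname{thick}_R^n(\mathsf{C})$ consists of all $M\in \mathsf{D}(R)$ for which there is a distinguished triangle $K \to L\oplus M \to N \to$ (for some object $L$) with $K\in \operatorname{thick}_R^1(\mathsf{C})$ and $N \in \operatorname{thick}_R^{n-1}(\mathsf{C})$. Then $\operatorname{level}_R^{\mathsf{C}}(M)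 = \inf\{n \mid M\in \operatorname{thick}_R^n(\mathsf{C})\}$ (equal to $\infty$ if no such $n$ exists). Gorenstein modules: a module $G$ is Gorenstein projective if it is a cokernel of a differential in an acyclic complex $P$ of projective modules such that $\operatorname{Hom}_R(P,Q)$ is acyclic for every projective module $Q$; Gorenstein injective if it is a kernel of a differential in an acyclic complex $I$ of injective modules such that $\operatorname{Hom}_R(E,I)$ is acyclic for every injective module $E$; Gorenstein flat if it is a cokernel of a differential in an acyclic complex $F$ of flat modules such that $E\otimes_R F$ is acyclic for every injective module $E$. The flat (resp. Gorenstein projective, Gorenstein flat) dimension of a module $N$ is the least $n\ge 0$ such that there is an exact sequence $0\to C_n\to\cdots\to C_0\to N\to 0$ with all $C_i$ in the respective class; the Gorenstein injective dimension is the least $n \geq 0$ such that there is an exact sequence $0\to N\to C_0\to\cdots\to C_{-n}\to 0$ with all $C_i$ Gorenstein injective. Dimensions are $\infty$ if no such $n$ exists. *)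

(* Defs.v *)
From HB Require Import structures.
From mathcomp Require Import all_boot all_order all_algebra.
From mathcomp Require Import boolp classical_sets constructive_ereal.

Set Implicit Arguments.
Unset Strict Implicit.
Unset Printing Implicit Defensive.

Import Order.TTheory GRing.Theory Num.Theory.
Local Open Scope ring_scope.
Local Open Scope quotient_scope.

(* [comPzRingType] rather than [comNzRingType]: the zero ring is allowed. *)
Definition is_ideal (R : comPzRingType) (I : set R) : Prop :=
  [/\ I 0, forall x y, I x -> I y -> I (x + y) & forall a x, I x -> I (a * x)].

Definition noetherian (R : comPzRingType) : Prop :=
  forall I : set R, is_ideal I ->
  exists (n : nat) (a : 'I_n -> R),
    forall x, I x <-> exists c : 'I_n -> R, x = \sum_(i < n) c i * a i.

Definition exact_at (U V W : Type) (z : W) (f : U -> V) (g : V -> W) : Prop :=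
  forall y, g y = z <-> exists x, f x = y.

Definition surj (U V : Type) (f : U -> V) : Prop := forall y, exists x, f x = y.

Section Modules.
Variable R : comPzRingType.
Implicit Types U V W : lmodType R.

Definition mk_linear U V (f : U -> V) (fl : linear f) : {linear U -> V} :=
  HB.pack f (GRing.isLinear.Build R U V *:%R f fl).

Definition zero_module : lmodType R := 'rV[R]_0.

Definition is_zero_module U : Prop := forall x : U, x = 0.

Fact zero_map_linear U V : linear (fun _ : U => 0 : V).
Proof. by move=> a x y; rewrite scaler0 addr0. Qed.
Definition zero_map U V : {linear U -> V} := mk_linear (@zero_map_linear U V).

Fact id_map_linear U : linear (fun x : U => x).
Proof. by []. Qed.
Definition id_map U : {linear U -> U} := mk_linear (@id_map_linear U).

Fact comp_map_linear U V W (g : {linear V -> W}) (f : {linear U -> V}) :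
  linear (fun x => g (f x)).
Proof. by move=> a x y; rewrite !linearP. Qed.
Definition comp_map U V W (g : {linear V -> W}) (f : {linear U -> V}) :
  {linear U -> W} := mk_linear (comp_map_linear g f).

(* The tensor product [U (x)_R V]: a list [:: (u1, v1); ...; (un, vn)] stands
   for [u1 (x) v1 + ... + un (x) vn], and lists are taken modulo the least
   additive congruence making [(x)] R-balanced and biadditive. *)
Section Tensor.
Variables U V : lmodType R.

Inductive tensor_eq : seq (U * V) -> seq (U * V) -> Prop :=
| tensor_refl s : tensor_eq s s
| tensor_sym s t : tensor_eq s t -> tensor_eq t s
| tensor_trans s t r : tensor_eq s t -> tensor_eq t r -> tensor_eq s r
| tensor_cat s s' t t' :
    tensor_eq s s' -> tensor_eq t t' -> tensor_eq (s ++ t) (s' ++ t')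
| tensor_comm s t : tensor_eq (s ++ t) (t ++ s)
| tensor_0l v : tensor_eq [:: (0, v)] [::]
| tensor_Dl u u' v : tensor_eq [:: (u + u', v)] [:: (u, v); (u', v)]
| tensor_Dr u v v' : tensor_eq [:: (u, v + v')] [:: (u, v); (u, v')]
| tensor_bal a u v : tensor_eq [:: (a *: u, v)] [:: (u, a *: v)].

Definition tensor_eqb : rel (seq (U * V)) := fun s t => `[< tensor_eq s t >].

Fact tensor_eqb_equiv : equiv_class_of tensor_eqb.
Proof.
split=> [s|s t|t s r].
- exact/asboolP/tensor_refl.
- by apply/asboolP/asboolP; apply: tensor_sym.
- by move=> /asboolP st /asboolP tr; apply/asboolP; apply: tensor_trans tr.
Qed.
Canonical tensor_equiv := EquivRelPack tensor_eqb_equiv.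
Canonical tensor_encModRel := defaultEncModRel tensor_eqb.

Definition tensor := {eq_quot tensor_eqb}.
HB.instance Definition _ : EqQuotient _ tensor_eqb tensor :=
  EqQuotient.on tensor.
HB.instance Definition _ := Choice.on tensor.

Definition tclass (s : seq (U * V)) : tensor := \pi s.

Fact tclassP s t : tclass s = tclass t <-> tensor_eq s t.
Proof. by split=> [/eqmodP/asboolP|?] //; apply/eqmodP/asboolP. Qed.

Fact tensor_repr s : tensor_eq (repr (tclass s)) s.
Proof. by apply/tclassP; rewrite /tclass reprK. Qed.

Fact tclassK x : tclass (repr x) = x.
Proof. by rewrite /tclass reprK. Qed.

Definition tscale_seq (a : R) (s : seq (U * V)) := [seq (a *: p.1, p.2) | p <- s].

Fact tscale_seq_eq a s t :
  tensor_eq s t -> tensor_eq (tscale_seq a s) (tscale_seq a t).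
Proof.
elim=> {s t}.
- by move=> s; apply: tensor_refl.
- by move=> s t _; apply: tensor_sym.
- by move=> s t r _ IH1 _; apply: tensor_trans.
- by move=> s s' t t' _ ? _ ?; rewrite /tscale_seq !map_cat; apply: tensor_cat.
- by move=> s t; rewrite /tscale_seq !map_cat; apply: tensor_comm.
- by move=> v /=; rewrite scaler0; apply: tensor_0l.
- by move=> u u' v /=; rewrite scalerDr; apply: tensor_Dl.
- by move=> u v v' /=; apply: tensor_Dr.
- move=> b u v /=; rewrite scalerA mulrC -scalerA; exact: tensor_bal.
Qed.

Definition tadd (x y : tensor) := tclass (repr x ++ repr y).
Definition tscale a (x : tensor) := tclass (tscale_seq a (repr x)).
Definition topp (x : tensor) := tscale (-1) x.

Fact taddE s t : tadd (tclass s) (tclass t) = tclass (s ++ t).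
Proof. by apply/tclassP; apply: tensor_cat; apply: tensor_repr. Qed.
Fact tscaleE a s : tscale a (tclass s) = tclass (tscale_seq a s).
Proof. by apply/tclassP/tscale_seq_eq/tensor_repr. Qed.

Fact taddA : associative tadd.
Proof.
by move=> x y z; rewrite -[x]tclassK -[y]tclassK -[z]tclassK !taddE catA.
Qed.
Fact taddC : commutative tadd.
Proof. by move=> x y; apply/tclassP/tensor_comm. Qed.
Fact tadd0 : left_id (tclass [::]) tadd.
Proof. by move=> x; rewrite -[x]tclassK taddE. Qed.

Fact tclass0r u : tclass [:: (u, 0)] = tclass [::].
Proof.
apply/tclassP/(tensor_trans _ (tensor_0l 0)); apply: tensor_sym.
by rewrite -{1}(scale0r u) -{2}(scale0r (0 : V)); apply: tensor_bal.
Qed.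

Fact tscale_cons a p s :
  tclass (tscale_seq a (p :: s)) =
  tadd (tclass [:: (a *: p.1, p.2)]) (tclass (tscale_seq a s)).
Proof. by rewrite taddE. Qed.

Fact tscaleDl x a b : tscale (a + b) x = tadd (tscale a x) (tscale b x).
Proof.
rewrite -[x]tclassK !tscaleE; elim: (repr x) => [|[u v] s IH]; first by rewrite tadd0.
rewrite !tscale_cons IH /= scalerDl.
have -> : tclass [:: (a *: u + b *: u, v)] =
          tadd (tclass [:: (a *: u, v)]) (tclass [:: (b *: u, v)]).
  by rewrite taddE; apply/tclassP/tensor_Dl.
rewrite -!taddA; congr (tadd _ _); rewrite !taddA; congr (tadd _ _).
exact: taddC.
Qed.

Fact tscale0 x : tscale 0 x = tclass [::].
Proof.
rewrite -[x]tclassK tscaleE; elim: (repr x) => [//|[u v] s IH].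
rewrite tscale_cons IH /= scale0r taddE cats0; exact/tclassP/tensor_0l.
Qed.

Fact tscale1 : left_id 1 tscale.
Proof.
move=> x; rewrite -[x]tclassK tscaleE; congr tclass.
by rewrite /tscale_seq -[RHS]map_id; apply: eq_map => -[u v] /=; rewrite scale1r.
Qed.

Fact tscaleA a b x : tscale a (tscale b x) = tscale (a * b) x.
Proof.
rewrite -[x]tclassK !tscaleE; congr tclass; rewrite /tscale_seq -map_comp.
by apply: eq_map => -[u v] /=; rewrite scalerA.
Qed.

Fact tscaleDr : right_distributive tscale tadd.
Proof.
move=> a x y; rewrite -[x]tclassK -[y]tclassK taddE !tscaleE taddE.
by rewrite /tscale_seq map_cat.
Qed.

Fact taddN : left_inverse (tclass [::]) topp tadd.
Proof. by move=> x; rewrite -{2}[x]tscale1 /topp -tscaleDl addNr tscale0. Qed.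

HB.instance Definition _ := GRing.isZmodule.Build tensor taddA taddC tadd0 taddN.
HB.instance Definition _ :=
  GRing.Zmodule_isLmodule.Build R tensor tscaleA tscale1 tscaleDr tscaleDl.

End Tensor.

Section TensorMap.
Variables (U V W : lmodType R) (f : {linear V -> W}).

Definition tmap_seq (s : seq (U * V)) : seq (U * W) := [seq (p.1, f p.2) | p <- s].

Fact tmap_seq_eq s t : tensor_eq s t -> tensor_eq (tmap_seq s) (tmap_seq t).
Proof.
elim=> {s t}.
- by move=> s; apply: tensor_refl.
- by move=> s t _; apply: tensor_sym.
- by move=> s t r _ IH1 _; apply: tensor_trans.
- by move=> s s' t t' _ ? _ ?; rewrite /tmap_seq !map_cat; apply: tensor_cat.
- by move=> s t; rewrite /tmap_seq !map_cat; apply: tensor_comm.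
- by move=> v /=; apply: tensor_0l.
- by move=> u u' v /=; apply: tensor_Dl.
- by move=> u v v' /=; rewrite linearD; apply: tensor_Dr.
- by move=> b u v /=; rewrite linearZ; apply: tensor_bal.
Qed.

Definition tmap_fun (x : tensor U V) : tensor U W := tclass (tmap_seq (repr x)).

Fact tmapE s : tmap_fun (tclass s) = tclass (tmap_seq s).
Proof. by apply/tclassP/tmap_seq_eq/tensor_repr. Qed.

Fact tmap_linear : linear tmap_fun.
Proof.
move=> a x y; rewrite -[x]tclassK -[y]tclassK.
rewrite [a *: _]tscaleE [_ + _]taddE !tmapE [a *: _]tscaleE [RHS]taddE.
congr tclass; rewrite /tmap_seq map_cat; congr (_ ++ _).
by rewrite /tscale_seq -!map_comp.
Qed.

(* [id_U (x) f] *)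
Definition tensor_map : {linear tensor U V -> tensor U W} := mk_linear tmap_linear.
End TensorMap.

Definition projective_module (P : lmodType R) : Prop :=
  forall (U V : lmodType R) (g : {linear U -> V}) (f : {linear P -> V}),
    surj g -> exists h : {linear P -> U}, forall x, g (h x) = f x.

Definition injective_module (E : lmodType R) : Prop :=
  forall (U V : lmodType R) (g : {linear U -> V}) (f : {linear U -> E}),
    injective g -> exists h : {linear V -> E}, forall x, h (g x) = f x.

Definition flat_module (F : lmodType R) : Prop :=
  forall (U V : lmodType R) (g : {linear U -> V}),
    injective g -> injective (tensor_map F g).

End Modules.

Section DirectSum.
Variables (R : comPzRingType) (M : int -> lmodType R).

Definition finite_support (f : forall i, M i) : bool :=
  `[< exists s : seq int, forall i, i \notin s -> f i = 0 >].

(* [\bigoplus_(i in Z) M i] *)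
Record dsum := DSum { dsum_fun :> forall i, M i; _ : finite_support dsum_fun }.

HB.instance Definition _ := [isSub for dsum_fun].
HB.instance Definition _ := [Choice of dsum by <:].

Fact dsumP (f g : dsum) : (forall i, f i = g i) -> f = g.
Proof. by move=> fg; apply: val_inj; apply: functional_extensionality_dep. Qed.

Fact dsum0_subproof : finite_support (fun i => 0 : M i).
Proof. by apply/asboolP; exists [::]. Qed.
Fact dsumD_subproof (f g : dsum) : finite_support (fun i => f i + g i).
Proof.
have /asboolP[s fs] : finite_support f by case: f.
have /asboolP[t gt] : finite_support g by case: g.
apply/asboolP; exists (s ++ t) => i; rewrite mem_cat negb_or => /andP[js jt].
by rewrite fs // gt // addr0.
Qed.
Fact dsumZ_subproof a (f : dsum) : finite_support (fun i => a *: f i).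
Proof.
have /asboolP[s fs] : finite_support f by case: f.
by apply/asboolP; exists s => i /fs ->; rewrite scaler0.
Qed.

Definition dsum0 := DSum dsum0_subproof.
Definition dsumD f g := DSum (dsumD_subproof f g).
Definition dsumZ a f := DSum (dsumZ_subproof a f).
Definition dsumN f := dsumZ (-1) f.

Fact dsumDA : associative dsumD.
Proof. by move=> f g h; apply: dsumP => i; apply: addrA. Qed.
Fact dsumDC : commutative dsumD.
Proof. by move=> f g; apply: dsumP => i; apply: addrC. Qed.
Fact dsum0D : left_id dsum0 dsumD.
Proof. by move=> f; apply: dsumP => i; apply: add0r. Qed.
Fact dsumND : left_inverse dsum0 dsumN dsumD.
Proof. by move=> f; apply: dsumP => i /=; rewrite scaleN1r addNr. Qed.
HB.instance Definition _ := GRing.isZmodule.Build dsum dsumDA dsumDC dsum0D dsumND.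

Fact dsumZA a b f : dsumZ a (dsumZ b f) = dsumZ (a * b) f.
Proof. by apply: dsumP => i; apply: scalerA. Qed.
Fact dsum1Z : left_id 1 dsumZ.
Proof. by move=> f; apply: dsumP => i; apply: scale1r. Qed.
Fact dsumZDr : right_distributive dsumZ +%R.
Proof. by move=> a f g; apply: dsumP => i; apply: scalerDr. Qed.
Fact dsumZDl f : {morph dsumZ^~ f : a b / a + b}.
Proof. by move=> a b; apply: dsumP => i; apply: scalerDl. Qed.
HB.instance Definition _ :=
  GRing.Zmodule_isLmodule.Build R dsum dsumZA dsum1Z dsumZDr dsumZDl.
End DirectSum.

Record complex (R : comPzRingType) := Complex {
  cobj :> int -> lmodType R;
  cdiff : forall i, {linear cobj i -> cobj (i - 1)};
  cdiffK : forall i x, cdiff (i - 1) (cdiff i x) = 0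
}.

(* The image of the differential ending in degree [i]; an inductive family,
   since [i + 1 - 1] and [i] are not convertible. *)
Inductive boundary (R : comPzRingType) (X : complex R) : forall i, X i -> Prop :=
  Boundary i (y : X i) : boundary (cdiff X i y).

Section Homology.
Variables (R : comPzRingType) (X : complex R).

Fact boundary_pred i (x : X (i - 1)) : boundary x <-> exists y, cdiff X i y = x.
Proof.
split=> [|[y <-]]; last exact: Boundary.
have h : forall j (z : X j), boundary z ->
    forall e : j = i - 1, exists y, cdiff X i y = ecast k (X k) e z.
  move=> j z [k y] e; have ek : k = i by apply: (addIr (-1)).
  by subst k; exists y; rewrite eq_axiomK.
by move=> bx; apply: (h _ _ bx erefl).
Qed.

Variable i : int.

Fact boundary_index : i = i + 1 - 1. Proof. by rewrite addrK. Qed.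

Fact boundaryP (x : X i) :
  boundary x <-> exists y, cdiff X (i + 1) y = ecast k (X k) boundary_index x.
Proof. by rewrite -boundary_pred; case: _ / boundary_index. Qed.

Fact boundary0 : boundary (0 : X i).
Proof. by apply/boundaryP; exists 0; rewrite linear0; case: _ / boundary_index. Qed.

Fact boundaryD (x y : X i) : boundary x -> boundary y -> boundary (x + y).
Proof.
move=> /boundaryP[u ux] /boundaryP[v vy]; apply/boundaryP; exists (u + v).
by rewrite linearD ux vy; case: _ / boundary_index.
Qed.

Fact boundaryZ a (x : X i) : boundary x -> boundary (a *: x).
Proof.
move=> /boundaryP[u ux]; apply/boundaryP; exists (a *: u).
by rewrite linearZ /= ux; case: _ / boundary_index.
Qed.

Definition cycle_pred : {pred X i} := [pred x | cdiff X i x == 0].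

Fact cycle_closed : submod_closed cycle_pred.
Proof.
split=> [|a x y]; rewrite !inE ?linear0 // linearP => /eqP-> /eqP->.
by rewrite scaler0 addr0.
Qed.
HB.instance Definition _ := GRing.isSubmodClosed.Build R (X i) cycle_pred cycle_closed.

Record cycle := Cycle { cycle_val :> X i; _ : cycle_val \in cycle_pred }.
HB.instance Definition _ := [isSub for cycle_val].
HB.instance Definition _ := [Choice of cycle by <:].
HB.instance Definition _ := [SubChoice_isSubLmodule of cycle by <:].

Fact cycleP (z : cycle) : cdiff X i (val z) = 0.
Proof. by apply/eqP; case: z. Qed.

Definition bound_pred : {pred cycle} := fun z => `[< boundary (val z) >].

Fact bound_closed : zmod_closed bound_pred.
Proof.
split=> [|x y]; first by apply/asboolP; rewrite raddf0; apply: boundary0.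
move=> /asboolP bx /asboolP yb; apply/asboolP; rewrite raddfB.
by apply: boundaryD => //; rewrite -scaleN1r; apply: boundaryZ.
Qed.
HB.instance Definition _ := GRing.isZmodClosed.Build cycle bound_pred bound_closed.

Definition homology := Quotient.quot bound_pred.
HB.instance Definition _ := GRing.Zmodule.on homology.

Definition hclass (z : cycle) : homology := \pi z.

Fact hclassP z w : hclass z = hclass w <-> boundary (val z - val w).
Proof.
split.
  by move/eqP; rewrite /hclass -Quotient.idealrBE /bound_pred /in_mem /= => /asboolP.
by move=> b; apply/eqP; rewrite /hclass -Quotient.idealrBE; apply/asboolP.
Qed.

Fact hclassK x : hclass (repr x) = x. Proof. exact: reprK. Qed.
Fact hclassD z w : hclass (z + w) = hclass z + hclass w.
Proof. exact: raddfD. Qed.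

Definition hscale (a : R) (x : homology) : homology := hclass (a *: repr x).

Fact hscaleE a z : hscale a (hclass z) = hclass (a *: z).
Proof.
apply/hclassP; set w := repr _.
have -> : val (a *: w) - val (a *: z) = a *: (val w - val z).
  by rewrite scalerBr; congr (_ - _); apply: linearZ.
apply: boundaryZ.
by apply/(hclassP w z); rewrite hclassK.
Qed.

Fact hscaleA a b x : hscale a (hscale b x) = hscale (a * b) x.
Proof. by rewrite -[x]hclassK !hscaleE scalerA. Qed.
Fact hscale1 : left_id 1 hscale.
Proof. by move=> x; rewrite -[x]hclassK hscaleE scale1r. Qed.
Fact hscaleDr : right_distributive hscale +%R.
Proof.
by move=> a x y; rewrite -[x]hclassK -[y]hclassK -hclassD !hscaleE scalerDr hclassD.
Qed.
Fact hscaleDl x : {morph hscale^~ x : a b / a + b}.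
Proof. by move=> a b; rewrite -[x]hclassK !hscaleE scalerDl hclassD. Qed.
HB.instance Definition _ :=
  GRing.Zmodule_isLmodule.Build R homology hscaleA hscale1 hscaleDr hscaleDl.
End Homology.
Arguments cycle_pred {R} X i _.

Definition total_homology (R : comPzRingType) (X : complex R) : lmodType R :=
  dsum (fun i => homology X i : lmodType R).

Definition acyclic (R : comPzRingType) (X : complex R) : Prop :=
  forall i, is_zero_module (homology X i).

(* Membership in [D_b(R)]. *)
Definition bounded_homology (R : comPzRingType) (X : complex R) : Prop :=
  exists n : int, forall i : int, n < `|i| -> is_zero_module (homology X i).

Record chain_map (R : comPzRingType) (X Y : complex R) := ChainMap {
  cmap :> forall i, {linear X i -> Y i};
  cmapP : forall i x, cmap (i - 1) (cdiff X i x) = cdiff Y i (cmap i x)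
}.

Section ChainMaps.
Variable R : comPzRingType.
Implicit Types X Y Z : complex R.

Definition chain_id X : chain_map X X :=
  ChainMap (cmap := fun i => id_map (X i)) (fun i x => erefl).

Fact chain_comp_subproof X Y Z (g : chain_map Y Z) (f : chain_map X Y) i x :
  comp_map (g (i - 1)) (f (i - 1)) (cdiff X i x) =
  cdiff Z i (comp_map (g i) (f i) x).
Proof. by rewrite /= !cmapP. Qed.
Definition chain_comp X Y Z (g : chain_map Y Z) (f : chain_map X Y) :
  chain_map X Z := ChainMap (chain_comp_subproof g f).

Fact cycle_map_subproof X Y (f : chain_map X Y) i (z : cycle X i) :
  f i (val z) \in cycle_pred Y i.
Proof. by rewrite inE -cmapP cycleP linear0. Qed.
Definition cycle_map X Y (f : chain_map X Y) i (z : cycle X i) : cycle Y i :=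
  Cycle (cycle_map_subproof f z).

Definition homology_map X Y (f : chain_map X Y) i (x : homology X i) :
  homology Y i := hclass (cycle_map f (repr x)).

Fact boundary_map X Y (f : chain_map X Y) i (x : X i) :
  boundary x -> boundary (f i x).
Proof. by case=> j y; rewrite cmapP; apply: Boundary. Qed.

Fact homology_mapE X Y (f : chain_map X Y) i (z : cycle X i) :
  homology_map f (hclass z) = hclass (cycle_map f z).
Proof.
apply/hclassP; set w := repr _; rewrite /= -linearB; apply: boundary_map.
by apply/(hclassP w z); rewrite hclassK.
Qed.

Definition quasi_iso X Y (f : chain_map X Y) : Prop :=
  forall i, bijective (@homology_map X Y f i).

(* The suspension: [(shift X)_i = X_(i-1)], with differential [- d]. *)
Fact shift_diff_linear X i : linear (fun x : X (i - 1) => - cdiff X (i - 1) x).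
Proof. by move=> a x y; rewrite linearP opprD scalerN. Qed.
Fact shift_subproof X i (x : X (i - 1)) :
  mk_linear (@shift_diff_linear X (i - 1)) (mk_linear (@shift_diff_linear X i) x) = 0.
Proof. by rewrite /= linearN cdiffK !oppr0. Qed.
Definition shift X : complex R := @Complex R (fun i => X (i - 1)) _ (@shift_subproof X).

Fact shift_map_subproof X Y (f : chain_map X Y) i (x : shift X i) :
  f (i - 1 - 1) (cdiff (shift X) i x) = cdiff (shift Y) i (f (i - 1) x).
Proof. by rewrite /= linearN cmapP. Qed.
Definition shift_map X Y (f : chain_map X Y) : chain_map (shift X) (shift Y) :=
  @ChainMap R (shift X) (shift Y) (fun i => f (i - 1)) (shift_map_subproof f).

Fact quasi_isoP X Y (f : chain_map X Y) :
  quasi_iso f <->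
  forall i, (forall x : X i, cdiff X i x = 0 -> boundary (f i x) -> boundary x) /\
            (forall y : Y i, cdiff Y i y = 0 ->
              exists2 x : X i, cdiff X i x = 0 & boundary (y - f i x)).
Proof.
split=> qf i.
  have [g fK gK] := qf i; split=> [x x0 bfx|y y0].
    have xc : x \in cycle_pred X i by rewrite inE x0.
    have -> : x = val (Cycle xc) - val (0 : cycle X i) by rewrite subr0.
    apply/hclassP; apply: (can_inj fK); rewrite !homology_mapE; apply/hclassP.
    by rewrite /= linear0 subr0.
  have yc : y \in cycle_pred Y i by rewrite inE y0.
  exists (val (repr (g (hclass (Cycle yc))))).
    exact: cycleP.
  rewrite -[y - _]/(val (Cycle yc) - val (cycle_map f (repr (g (hclass (Cycle yc)))))).
  by apply/hclassP; rewrite -homology_mapE hclassK gK.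
have [inj srj] := qf i.
have hinj : injective (@homology_map X Y f i).
  move=> x y; rewrite -[x]hclassK -[y]hclassK !homology_mapE => /hclassP /=.
  rewrite -linearB => b; apply/hclassP; apply: inj b.
  by rewrite linearB !cycleP subr0.
have hsrj : forall y, exists x, homology_map f x = y :> homology Y i.
  move=> y; rewrite -[y]hclassK; have [x x0 b] := srj _ (cycleP (repr y)).
  have xc : x \in cycle_pred X i by rewrite inE x0.
  by exists (hclass (Cycle xc)); rewrite homology_mapE; apply/esym/hclassP.
exists (fun y => projT1 (cid (hsrj y))) => [x|y]; last by case: cid.
by apply: hinj; case: cid.
Qed.

Fact boundaryN X i (x : X i) : boundary (- x) <-> boundary x.
Proof.
by split=> b; [rewrite -[x]opprK|]; rewrite -scaleN1r; apply: boundaryZ.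
Qed.

Fact boundary_shift X i (x : X (i - 1)) :
  @boundary R (shift X) i x <-> @boundary R X (i - 1) x.
Proof.
split=> [|/boundary_pred[y <-]].
  have h j (z : shift X j) : @boundary R (shift X) j z -> @boundary R X (j - 1) z.
    by case=> k y; apply: (proj2 (boundaryN _)); apply: Boundary.
  exact: h.
have h j (e : j = i) (z : X j) : @boundary R (shift X) i (cdiff X i (ecast k (X k) e z)).
  subst j => /=; apply/(@boundaryN (shift X)).
  have := boundary_index i; move: (i + 1) => k ek.
  subst i; exact: (@Boundary R (shift X) k z).
exact: (h i erefl y).
Qed.

Fact shift_map_qiso X Y (f : chain_map X Y) : quasi_iso f -> quasi_iso (shift_map f).
Proof.
move/quasi_isoP=> qf; apply/quasi_isoP => i; have [inj srj] := qf (i - 1).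
split=> [x /= /eqP|y /= /eqP]; rewrite oppr_eq0 => /eqP.
  by move=> x0 /boundary_shift b; apply/boundary_shift; apply: inj.
by move=> /srj[x x0 b]; exists x; [rewrite /= x0 oppr0 | apply/boundary_shift].
Qed.

(* The mapping cone: [(cone f)_i = Y_i + X_(i-1)], [d (y, x) = (d y + f x, - d x)]. *)
Fact cone_diff_linear X Y (f : chain_map X Y) i :
  linear (fun p : (Y i * X (i - 1))%type =>
    (cdiff Y i p.1 + f (i - 1) p.2, - cdiff X (i - 1) p.2)).
Proof.
by move=> a p q; rewrite /= !linearP; congr (_, _); rewrite /= scalerDr addrACA.
Qed.
Fact cone_subproof X Y (f : chain_map X Y) i (p : (Y i * X (i - 1))%type) :
  mk_linear (@cone_diff_linear X Y f (i - 1))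
    (mk_linear (@cone_diff_linear X Y f i) p) = 0.
Proof.
case: p => y x; apply/eqP; rewrite -pair_eqE; apply/andP; split; apply/eqP => /=.
  by rewrite linearD cdiffK linearN /= cmapP add0r subrr.
by rewrite linearN cdiffK !oppr0.
Qed.
Definition cone X Y (f : chain_map X Y) : complex R :=
  @Complex R (fun i => (Y i * X (i - 1))%type : lmodType R) _ (@cone_subproof X Y f).

Fact cone_incl_linear X Y (f : chain_map X Y) i :
  linear (fun y : Y i => (y, 0) : cone f i).
Proof. by move=> a x y; congr (_, _); rewrite /= scaler0 addr0. Qed.
Fact cone_incl_subproof X Y (f : chain_map X Y) i (y : Y i) :
  mk_linear (@cone_incl_linear X Y f (i - 1)) (cdiff Y i y) =
  cdiff (cone f) i (mk_linear (@cone_incl_linear X Y f i) y).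
Proof. by rewrite /= !linear0 addr0. Qed.
Definition cone_incl X Y (f : chain_map X Y) : chain_map Y (cone f) :=
  ChainMap (cone_incl_subproof f).

Fact cone_proj_linear X Y (f : chain_map X Y) i :
  linear (fun p : cone f i => p.2 : shift X i).
Proof. by []. Qed.
Fact cone_proj_subproof X Y (f : chain_map X Y) i (p : cone f i) :
  mk_linear (@cone_proj_linear X Y f (i - 1)) (cdiff (cone f) i p) =
  cdiff (shift X) i (mk_linear (@cone_proj_linear X Y f i) p).
Proof. by []. Qed.
Definition cone_proj X Y (f : chain_map X Y) : chain_map (cone f) (shift X) :=
  ChainMap (@cone_proj_subproof X Y f).

Fact csum_diff_linear X Y i :
  linear (fun p : (X i * Y i)%type => (cdiff X i p.1, cdiff Y i p.2)).
Proof. by move=> a p q /=; rewrite !linearP. Qed.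
Fact csum_subproof X Y i (p : (X i * Y i)%type) :
  mk_linear (@csum_diff_linear X Y (i - 1)) (mk_linear (@csum_diff_linear X Y i) p) = 0.
Proof. by rewrite /= !cdiffK. Qed.
Definition csum X Y : complex R :=
  @Complex R (fun i => (X i * Y i)%type : lmodType R) _ (@csum_subproof X Y).

(* The module [M] as a complex concentrated in degree 0. *)
Definition stalk_obj (M : lmodType R) (i : int) : lmodType R :=
  if i is Posz 0 then M else zero_module R.
Definition stalk (M : lmodType R) : complex R :=
  @Complex R (stalk_obj M) (fun i => zero_map _ _) (fun i x => erefl).

Definition zero_complex : complex R := stalk (zero_module R).

Fact tensor_complex_subproof (E : lmodType R) X i (x : tensor E (X i)) :
  tensor_map E (cdiff X (i - 1)) (tensor_map E (cdiff X i) x) = 0.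
Proof.
rewrite -[x]tclassK /= !tmapE /tmap_seq -map_comp.
elim: (repr x) => [//|p s IH]; rewrite map_cons -cat1s -taddE.
have -> : tclass [:: ((fun q => (q.1, cdiff X (i - 1) q.2)) \o
                      (fun q => (q.1, cdiff X i q.2))) p] = tclass [::].
  by rewrite /= cdiffK tclass0r.
by rewrite tadd0.
Qed.
(* [E (x)_R X] *)
Definition tensor_complex (E : lmodType R) X : complex R :=
  @Complex R (fun i => tensor E (X i) : lmodType R) _ (@tensor_complex_subproof E X).

End ChainMaps.

(* The derived category [D(R)] is the localization of the category of complexes
   at the quasi-isomorphisms: its objects are the complexes, its morphisms are
   formal composites [dmor] of chain maps and of inverses of
   quasi-isomorphisms, taken modulo [dmor_eq]. *)
Section DerivedCategory.
Variable R : comPzRingType.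
Implicit Types X Y Z W : complex R.

Inductive dmor : complex R -> complex R -> Type :=
| dmap X Y of chain_map X Y : dmor X Y
| dinv X Y (s : chain_map X Y) of quasi_iso s : dmor Y X
| dcomp X Y Z of dmor Y Z & dmor X Y : dmor X Z.

Definition did X : dmor X X := dmap (chain_id X).

Inductive dmor_eq : forall X Y, dmor X Y -> dmor X Y -> Prop :=
| dmor_refl X Y (u : dmor X Y) : dmor_eq u u
| dmor_sym X Y (u v : dmor X Y) : dmor_eq u v -> dmor_eq v u
| dmor_trans X Y (u v w : dmor X Y) : dmor_eq u v -> dmor_eq v w -> dmor_eq u w
| dmor_cong X Y Z (u u' : dmor Y Z) (v v' : dmor X Y) :
    dmor_eq u u' -> dmor_eq v v' -> dmor_eq (dcomp u v) (dcomp u' v')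
| dmor_assoc X Y Z W (u : dmor Z W) (v : dmor Y Z) (w : dmor X Y) :
    dmor_eq (dcomp u (dcomp v w)) (dcomp (dcomp u v) w)
| dmor_idl X Y (u : dmor X Y) : dmor_eq (dcomp (did Y) u) u
| dmor_idr X Y (u : dmor X Y) : dmor_eq (dcomp u (did X)) u
| dmor_map X Y (f g : chain_map X Y) :
    (forall i x, f i x = g i x) -> dmor_eq (dmap f) (dmap g)
| dmor_comp X Y Z (g : chain_map Y Z) (f : chain_map X Y) :
    dmor_eq (dmap (chain_comp g f)) (dcomp (dmap g) (dmap f))
| dmor_invl X Y (s : chain_map X Y) (qs : quasi_iso s) :
    dmor_eq (dcomp (dinv qs) (dmap s)) (did X)
| dmor_invr X Y (s : chain_map X Y) (qs : quasi_iso s) :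
    dmor_eq (dcomp (dmap s) (dinv qs)) (did Y).

Fixpoint dshift X Y (u : dmor X Y) : dmor (shift X) (shift Y) :=
  match u with
  | dmap _ _ f => dmap (shift_map f)
  | dinv _ _ _ qs => dinv (shift_map_qiso qs)
  | dcomp _ _ _ u v => dcomp (dshift u) (dshift v)
  end.

Definition is_diso X Y (u : dmor X Y) : Prop :=
  exists v : dmor Y X, dmor_eq (dcomp v u) (did X) /\ dmor_eq (dcomp u v) (did Y).

Definition disomorphic X Y : Prop := exists u : dmor X Y, is_diso u.

Definition distinguished X Y Z
    (u : dmor X Y) (v : dmor Y Z) (w : dmor Z (shift X)) : Prop :=
  exists (A B : complex R) (f : chain_map A B)
         (a : dmor X A) (b : dmor Y B) (c : dmor Z (cone f)),
    [/\ is_diso a, is_diso b & is_diso c] /\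
    [/\ dmor_eq (dcomp b u) (dcomp (dmap f) a),
        dmor_eq (dcomp c v) (dcomp (dmap (cone_incl f)) b)
      & dmor_eq (dcomp (dshift a) w) (dcomp (dmap (cone_proj f)) c)].

(* The least class containing [C] and closed under isomorphism, shifts in both
   directions, finite direct sums and direct summands; [thick1_desuspend] gives
   the inverse shift up to isomorphism. *)
Inductive thick1 (C : complex R -> Prop) : complex R -> Prop :=
| thick1_in X : C X -> thick1 C X
| thick1_iso X Y : disomorphic X Y -> thick1 C X -> thick1 C Y
| thick1_shift X : thick1 C X -> thick1 C (shift X)
| thick1_desuspend X : thick1 C (shift X) -> thick1 C X
| thick1_zero : thick1 C (zero_complex R)
| thick1_sum X Y : thick1 C X -> thick1 C Y -> thick1 C (csum X Y)
| thick1_summand X Y : thick1 C (csum X Y) -> thick1 C X.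

Fixpoint thick (C : complex R -> Prop) (n : nat) (M : complex R) : Prop :=
  match n with
  | 0 => disomorphic M (zero_complex R)
  | 1 => thick1 C M
  | n'.+1 => exists K L N : complex R,
      [/\ thick1 C K, thick C n' N
        & exists (u : dmor K (csum L M)) (v : dmor (csum L M) N)
                 (w : dmor N (shift K)), distinguished u v w]
  end.

End DerivedCategory.

(* The infimum of a set of natural numbers in the extended integers, with
   value [+oo] on the empty set. *)
Definition inf_nat (P : nat -> Prop) : \bar int :=
  match pselect (exists n, `[< P n >]) with
  | left h => (ex_minn h)%:Z%:E
  | right _ => +oo%E
  end.

Section Level.
Variable R : comPzRingType.
Implicit Types (C : lmodType R -> Prop) (N G : lmodType R).

Definition as_complexes C : complex R -> Prop :=
  fun X => exists2 N : lmodType R, C N & X = stalk N.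

Definition level C (M : complex R) : \bar int :=
  inf_nat (fun n => thick (as_complexes C) n M).

(* Exact sequences [0 -> X n -> ... -> X 0 -> N -> 0] with all [X i] in [C]. *)
Definition has_resolution C (n : nat) N : Prop :=
  exists (X : nat -> lmodType R) (d : forall i, {linear X i.+1 -> X i})
         (e : {linear X 0 -> N}),
    [/\ surj e, exact_at 0 (d 0) e,
        forall i, exact_at 0 (d i.+1) (d i),
        forall i, (i <= n)%N -> C (X i)
      & forall i, (n < i)%N -> is_zero_module (X i)].

(* Exact sequences [0 -> N -> X 0 -> ... -> X n -> 0] with all [X i] in [C]. *)
Definition has_coresolution C (n : nat) N : Prop :=
  exists (X : nat -> lmodType R) (d : forall i, {linear X i -> X i.+1})
         (e : {linear N -> X 0}),
    [/\ injective e, exact_at 0 e (d 0),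
        forall i, exact_at 0 (d i) (d i.+1),
        forall i, (i <= n)%N -> C (X i)
      & forall i, (n < i)%N -> is_zero_module (X i)].

Definition left_dim C N : \bar int := inf_nat (fun n => has_resolution C n N).
Definition right_dim C N : \bar int := inf_nat (fun n => has_coresolution C n N).

Definition is_cokernel (U V : lmodType R) (f : {linear U -> V}) G : Prop :=
  exists p : {linear V -> G}, surj p /\ exact_at 0 f p.

Definition is_kernel (U V : lmodType R) (f : {linear U -> V}) G : Prop :=
  exists k : {linear G -> U}, injective k /\ exact_at 0 k f.

(* Acyclicity of [Hom(X, Q)], that is, exactness of [Hom(X_(i-2), Q) ->
   Hom(X_(i-1), Q) -> Hom(X_i, Q)]; the index avoids transport along
   [i + 1 - 1 = i]. *)
Definition acyclic_hom_from (X : complex R) (Q : lmodType R) : Prop :=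
  forall i (f : {linear X (i - 1) -> Q}),
    (forall x, f (cdiff X i x) = 0) ->
    exists g : {linear X (i - 1 - 1) -> Q}, forall x, g (cdiff X (i - 1) x) = f x.

(* Acyclicity of [Hom(E, X)]: exactness of [Hom(E, X_i) -> Hom(E, X_(i-1)) ->
   Hom(E, X_(i-2))]. *)
Definition acyclic_hom_to (E : lmodType R) (X : complex R) : Prop :=
  forall i (f : {linear E -> X (i - 1)}),
    (forall e, cdiff X (i - 1) (f e) = 0) ->
    exists g : {linear E -> X i}, forall e, cdiff X i (g e) = f e.

Definition gorenstein_projective G : Prop :=
  exists P : complex R,
    [/\ forall i, projective_module (P i), acyclic P,
        forall Q : lmodType R, projective_module Q -> acyclic_hom_from P Q
      & exists i, is_cokernel (cdiff P i) G].

Definition gorenstein_injective G : Prop :=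
  exists I : complex R,
    [/\ forall i, injective_module (I i), acyclic I,
        forall E : lmodType R, injective_module E -> acyclic_hom_to E I
      & exists i, is_kernel (cdiff I i) G].

Definition gorenstein_flat G : Prop :=
  exists F : complex R,
    [/\ forall i, flat_module (F i), acyclic F,
        forall E : lmodType R, injective_module E -> acyclic (tensor_complex E F)
      & exists i, is_cokernel (cdiff F i) G].

Definition flat_dim := left_dim (@flat_module R).
Definition gproj_dim := left_dim gorenstein_projective.
Definition ginj_dim := right_dim gorenstein_injective.
Definition gflat_dim := left_dim gorenstein_flat.

End Level.

(* Main.v *)
Require Import Defs.
From HB Require Import structures.
From mathcomp Require Import all_boot all_order all_algebra.
From mathcomp Require Import boolp classical_sets constructive_ereal.

(* Let [C] be the class of flat, Gorenstein projective or Gorenstein flat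
   modules, and [d] the [C]-dimension of [H(M)]. If [d >= 2], a sum [P] of
   shifted free modules maps to [M] surjectively on homology; the homology of
   the cone is made of syzygies of that of [M], so [d] drops by one and the
   level by at most one. If [d <= 1], replace [M] by a projective resolution
   [P]; since [C] is closed under extensions and kernels of epimorphisms, all
   cycles [Z_i] and boundaries [B_i] of [P] lie in [C], and [Z -> P -> shift B]
   gives level at most 2. As [P] is unbounded, one keeps only the [Z_i] with [i]
   at most the supremum of [H(M)].

   For Gorenstein injective modules everything is dual, except that the pieces
   come in the wrong order for the definition of [thick], which peels off the
   first term of a triangle; hence the filtrations [filt].

   Closure of Gorenstein projective modules under extensions, summands and
   kernels of epimorphisms is proved coinductively in a self-dual setting,
   which also covers Gorenstein injective modules. For Gorenstein flat modules,
   flat modules are not injective relative to the complete resolutions, but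
   their double character modules are, and these are flat as [R] is
   noetherian. *)

Set Implicit Arguments.
Unset Strict Implicit.
Unset Printing Implicit Defensive.

(* [Defs] again, because MathComp also has a [cycle]. *)
Import Order.TTheory GRing.Theory Num.Theory Defs.
Local Open Scope ring_scope.
Local Open Scope quotient_scope.

(** * Modules *)

(** The 2 in the bound comes from the base case: even if all homology modules lie in [C], a complex
    need not be isomorphic to the sum of its shifted homology modules, so dimension 0 is treated as
    dimension at most 1. That case rests on [dimle1_ker]: over an object of dimension at most 1, the
    kernel of any epimorphism from [C], not only from a projective, lies in [C]. Membership in [C]
    thus passes from [Z_i] to the boundaries in it and then to [Z_{i+1}], starting where the
    resolution vanishes.

    No calculus of fractions is needed: each triangle is the standard one of an explicit chain map,
    up to isomorphisms that come from quasi-isomorphisms.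

    For the Gorenstein classes the obstacle is that a horseshoe argument needs lifting on the left
    and extension on the right, while a complete resolution by flat modules offers neither. Hence
    the terms on the right are first exchanged for objects of a relatively injective class [T], and
    then those on the left for projectives.

    Degrees are integers and [i + 1 - 1] is not convertible to [i]; this is why so many statements
    live in degree [i - 1]. *)

Definition submod_prop (R : comPzRingType) (V : lmodType R) (S : V -> Prop) :=
  S 0 /\ forall a x y, S x -> S y -> S (a *: x + y).

(** Choice for families whose type varies with the index, as needed for the maps between the terms
    of complexes. *)
Lemma dep_choice (I : Type) (T : I -> Type) (P : forall i, T i -> Prop) :
  (forall i, exists x, P i x) -> exists f : forall i, T i, forall i, P i (f i).
Proof. by move=> PT; exists (fun i => projT1 (cid (PT i))) => i; case: cid. Qed.

Section Submodule.
Variables (R : comPzRingType) (V : lmodType R).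

(** The closure proof is bundled with the predicate so that the algebraic structures below can be
    inferred from the subset alone. *)
Record submod := Submod { submod_set :> V -> Prop; submodP : submod_prop submod_set }.

Variable S : submod.

Definition submod_pred : {pred V} := fun x => `[< S x >].

Fact submod_pred_closed : submod_closed submod_pred.
Proof.
have [S0 SD] := submodP S; split; first exact/asboolP.
by move=> a x y /asboolP Sx /asboolP Sy; apply/asboolP; apply: SD.
Qed.
HB.instance Definition _ :=
  GRing.isSubmodClosed.Build R V submod_pred submod_pred_closed.

Record submodule := Submodule { submodule_val :> V; _ : submodule_val \in submod_pred }.
HB.instance Definition _ := [isSub for submodule_val].
HB.instance Definition _ := [Choice of submodule by <:].
HB.instance Definition _ := [SubChoice_isSubLmodule of submodule by <:].

Definition quotient := Quotient.quot submod_pred.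
HB.instance Definition _ := GRing.Zmodule.on quotient.

Definition qclass (x : V) : quotient := \pi x.

Fact qclassP x y : qclass x = qclass y <-> S (x - y).
Proof.
split; first by move/eqP; rewrite /qclass -Quotient.idealrBE => /asboolP.
by move=> Sxy; apply/eqP; rewrite /qclass -Quotient.idealrBE; apply/asboolP.
Qed.

Fact qclassK x : qclass (repr x) = x. Proof. exact: reprK. Qed.
Fact qclassD x y : qclass (x + y) = qclass x + qclass y.
Proof. exact: raddfD. Qed.

Definition qscale (a : R) (x : quotient) : quotient := qclass (a *: repr x).

Fact qscaleE a x : qscale a (qclass x) = qclass (a *: x).
Proof.
apply/qclassP; rewrite -scalerBr -[_ *: _]addr0; have [S0 SD] := submodP S.
by apply: SD => //; apply/qclassP; rewrite qclassK.
Qed.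
Fact qscaleA a b x : qscale a (qscale b x) = qscale (a * b) x.
Proof. by rewrite -[x]qclassK !qscaleE scalerA. Qed.
Fact qscale1 : left_id 1 qscale.
Proof. by move=> x; rewrite -[x]qclassK qscaleE scale1r. Qed.
Fact qscaleDr : right_distributive qscale +%R.
Proof.
by move=> a x y; rewrite -[x]qclassK -[y]qclassK -qclassD !qscaleE scalerDr qclassD.
Qed.
Fact qscaleDl x : {morph qscale^~ x : a b / a + b}.
Proof. by move=> a b; rewrite -[x]qclassK !qscaleE scalerDl qclassD. Qed.
HB.instance Definition _ :=
  GRing.Zmodule_isLmodule.Build R quotient qscaleA qscale1 qscaleDr qscaleDl.

Fact qclass_linear : linear qclass.
Proof. by move=> a x y; rewrite qclassD -qscaleE. Qed.

End Submodule.

Section ModuleFacts.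
Variable R : comPzRingType.
Implicit Types U V W X Y N K P L A B C : lmodType R.

(** From here on, submodules are used only through such an inclusion, and quotients through the
    projection below. *)
Lemma submodule_ex V (S : V -> Prop) : submod_prop S ->
  exists (K : lmodType R) (k : {linear K -> V}),
    injective k /\ forall x, S x <-> exists y, k y = x.
Proof.
move=> Sc; pose T := Submod Sc.
exists (submodule T : lmodType R), (val : {linear submodule T -> V}).
split=> [|x]; first exact: val_inj.
split=> [Sx|[[y /= /asboolP Sy] <- //]].
have Tx : x \in submod_pred T by apply/asboolP.
by exists (Submodule Tx).
Qed.

Lemma quotient_ex V (S : V -> Prop) : submod_prop S ->
  exists (Q : lmodType R) (q : {linear V -> Q}),
    surj q /\ forall x, q x = 0 <-> S x.
Proof.
move=> Sc; pose T := Submod Sc.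
exists (quotient T : lmodType R), (mk_linear (@qclass_linear R V T)).
split=> [y|x]; first by exists (repr y); apply: qclassK.
have -> : 0 = qclass T 0 by rewrite -[RHS]/(mk_linear (@qclass_linear R V T) 0) linear0.
by rewrite /= qclassP subr0.
Qed.

Lemma ker_submod U V (f : {linear U -> V}) : submod_prop (fun x => f x = 0).
Proof.
split=> [|a x y fx fy]; first by rewrite linear0.
by rewrite linearP fx fy scaler0 addr0.
Qed.

Lemma im_submod U V (f : {linear U -> V}) : submod_prop (fun y => exists x, f x = y).
Proof.
split=> [|a _ _ [x <-] [y <-]]; first by exists 0; rewrite linear0.
by exists (a *: x + y); rewrite linearP.
Qed.

Lemma linear_inj0 U V (f : {linear U -> V}) :
  (forall x, f x = 0 -> x = 0) -> injective f.
Proof.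
by move=> f0 x y /eqP; rewrite -subr_eq0 -linearB => /eqP/f0/eqP; rewrite subr_eq0 => /eqP.
Qed.

Lemma inj0 U V (f : {linear U -> V}) x : injective f -> f x = 0 -> x = 0.
Proof. by move=> fi fx; apply: fi; rewrite linear0. Qed.

Lemma factor_inj U V W (k : {linear V -> W}) (f : {linear U -> W}) :
  injective k -> (forall x, exists y, k y = f x) ->
  exists h : {linear U -> V}, forall x, k (h x) = f x.
Proof.
move=> ki kf; have [h kh] := choice kf.
have hl : linear h by move=> a x y; apply: ki; rewrite kh !linearP !kh.
by exists (mk_linear hl).
Qed.

Lemma factor_surj U V W (q : {linear U -> V}) (f : {linear U -> W}) :
  surj q -> (forall x, q x = 0 -> f x = 0) ->
  exists h : {linear V -> W}, forall x, h (q x) = f x.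
Proof.
move=> qs qf; have [s qK] := choice qs.
have fE x y : q x = q y -> f x = f y.
  move=> e; apply/eqP; rewrite -subr_eq0 -linearB; apply/eqP/qf.
  by rewrite linearB e subrr.
have hl : linear (fun y => f (s y)).
  by move=> a x y /=; rewrite -linearP; apply: fE; rewrite linearP !qK.
by exists (mk_linear hl) => x /=; apply: fE; rewrite qK.
Qed.

Definition ses U V W := exists (f : {linear U -> V}) (g : {linear V -> W}),
  [/\ injective f, surj g & exact_at 0 f g].

Definition iso U V := exists (f : {linear U -> V}), injective f /\ surj f.

Definition dirsum U V : lmodType R := (U * V)%type.

Lemma fst_linear U V : linear (fun p : dirsum U V => p.1). Proof. by []. Qed.
Lemma snd_linear U V : linear (fun p : dirsum U V => p.2). Proof. by []. Qed.
Lemma inl_linear U V : linear (fun x : U => (x, 0) : dirsum U V).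
Proof. by move=> a x y; congr (_, _); rewrite /= scaler0 addr0. Qed.
Lemma inr_linear U V : linear (fun x : V => (0, x) : dirsum U V).
Proof. by move=> a x y; congr (_, _); rewrite /= scaler0 addr0. Qed.
Definition fst_map U V := mk_linear (@fst_linear U V).
Definition snd_map U V := mk_linear (@snd_linear U V).
Definition inl_map U V := mk_linear (@inl_linear U V).
Definition inr_map U V := mk_linear (@inr_linear U V).

Lemma pair_linear U V W (f : {linear U -> V}) (g : {linear U -> W}) :
  linear (fun x => (f x, g x) : dirsum V W).
Proof. by move=> a x y; rewrite !linearP. Qed.
Definition pair_map U V W (f : {linear U -> V}) (g : {linear U -> W}) :=
  mk_linear (pair_linear f g).

Lemma copair_linear U V W (f : {linear U -> W}) (g : {linear V -> W}) :
  linear (fun p : dirsum U V => f p.1 + g p.2).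
Proof. by move=> a x y /=; rewrite !linearP scalerDr addrACA. Qed.
Definition copair_map U V W (f : {linear U -> W}) (g : {linear V -> W}) :=
  mk_linear (copair_linear f g).

Lemma opp_linear U V (f : {linear U -> V}) : linear (fun x => - f x).
Proof. by move=> a x y; rewrite linearP opprD scalerN. Qed.
Definition opp_map U V (f : {linear U -> V}) := mk_linear (opp_linear f).
Lemma add_linear U V (f g : {linear U -> V}) : linear (fun x => f x + g x).
Proof. by move=> a x y; rewrite !linearP scalerDr addrACA. Qed.
Definition add_map U V (f g : {linear U -> V}) := mk_linear (add_linear f g).

Lemma iso_refl U : iso U U.
Proof. by exists (id_map U); split=> // x; exists x. Qed.

Lemma iso_inv U V (f : {linear U -> V}) : injective f -> surj f ->
  exists g : {linear V -> U}, cancel f g /\ cancel g f.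
Proof.
move=> fi fs; have [g fg] := factor_inj (f := id_map V) fi fs.
by exists g; split=> x; [apply: fi; rewrite fg | rewrite fg].
Qed.

Lemma iso_sym U V : iso U V -> iso V U.
Proof.
move=> [f [fi fs]]; have [g [fK gK]] := iso_inv fi fs.
by exists g; split; [apply: can_inj gK | move=> x; exists (f x)].
Qed.

Lemma iso_trans U V W : iso U V -> iso V W -> iso U W.
Proof.
move=> [f [fi fs]] [g [gi gs]]; exists (comp_map g f); split.
  by move=> x y /= /gi/fi.
by move=> z; have [y <-] := gs z; have [x <-] := fs y; exists x.
Qed.

Lemma zero_moduleP : is_zero_module (zero_module R).
Proof. by move=> x; rewrite [LHS]thinmx0 [RHS]thinmx0. Qed.

Lemma zero_module_iso A B : is_zero_module A -> is_zero_module B -> iso A B.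
Proof.
move=> A0 B0; exists (zero_map A B); split=> [x y _|y]; first by rewrite (A0 x) (A0 y).
by exists 0; rewrite (B0 y).
Qed.

Lemma ses_iso1 U U' V W : iso U U' -> ses U V W -> ses U' V W.
Proof.
move=> /iso_sym[h [hi hs]] [f [g [fi gs fg]]]; exists (comp_map f h), g; split=> //.
  by move=> x y /= /fi/hi.
move=> y; rewrite fg; split=> [[x <-]|[x <-]]; last by exists (h x).
by have [z <-] := hs x; exists z.
Qed.

Lemma ses_iso2 U V V' W : iso V V' -> ses U V W -> ses U V' W.
Proof.
move=> [h [hi hs]] [f [g [fi gs fg]]]; have [h' [hK h'K]] := iso_inv hi hs.
exists (comp_map h f), (comp_map g h'); split.
- by move=> x y /= /hi/fi.
- by move=> z; have [y <-] := gs z; exists (h y); rewrite /= hK.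
- move=> y /=; rewrite fg; split=> [[x fx]|[x <-]]; exists x; last by rewrite hK.
  by rewrite fx h'K.
Qed.

Lemma ses_iso3 U V W W' : iso W W' -> ses U V W -> ses U V W'.
Proof.
move=> [h [hi hs]] [f [g [fi gs fg]]]; exists f, (comp_map h g); split=> //.
  by move=> z; have [y <-] := hs z; have [x <-] := gs y; exists x.
move=> y /=; rewrite -fg; split=> [e|->]; last by rewrite linear0.
exact: inj0 e.
Qed.

Lemma ses_ker V W (g : {linear V -> W}) : surj g -> exists K, ses K V W.
Proof.
move=> gs; have [K [k [ki kE]]] := submodule_ex (ker_submod g).
by exists K, k, g; split.
Qed.

Lemma ses_coker U V (f : {linear U -> V}) : injective f -> exists C, ses U V C.
Proof.
move=> fi; have [Q [q [qs qE]]] := quotient_ex (im_submod f).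
by exists Q, f, q; split.
Qed.

Lemma ses_sumr U V : ses U (dirsum U V) V.
Proof.
exists (inl_map U V), (snd_map U V); split=> [x y []//|x|[x y]/=].
  by exists (0, x).
by split=> [->|[z [_ <-]]//]; exists x.
Qed.

Lemma iso_sumC U V : iso (dirsum U V) (dirsum V U).
Proof.
exists (pair_map (snd_map U V) (fst_map U V)); split=> [[a b] [c d] /= [-> ->]//|[a b]].
by exists (b, a).
Qed.

Lemma ses_add U V W X : ses U V W -> ses U (dirsum V X) (dirsum W X).
Proof.
move=> [f [g [fi gs fg]]]; exists (comp_map (inl_map V X) f).
exists (pair_map (comp_map g (fst_map V X)) (snd_map V X)); split.
- by move=> x y [/fi].
- by move=> [a b]; have [c <-] := gs a; exists (c, b).
move=> [a b] /=; split=> [[/fg[x <-] ->]|[x [<- <-]]]; first by exists x.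
by congr (_, _); apply/fg; exists x.
Qed.

Lemma ses_add' U V W X : ses U V W -> ses (dirsum U X) (dirsum V X) W.
Proof.
move=> [f [g [fi gs fg]]].
exists (pair_map (comp_map f (fst_map U X)) (snd_map U X)), (comp_map g (fst_map V X)); split.
- by move=> [a b] [c d] /= [/fi-> ->].
- by move=> a; have [c <-] := gs a; exists (c, 0).
move=> [a b] /=; split=> [/fg[x <-]|[[x y] [<- _]]]; first by exists (x, b).
by apply/fg; exists x.
Qed.

Lemma ses_sum U V W U' V' W' : ses U V W -> ses U' V' W' ->
  ses (dirsum U U') (dirsum V V') (dirsum W W').
Proof.
move=> [f [g [fi gs fg]]] [f' [g' [fi' gs' fg']]].
exists (pair_map (comp_map f (fst_map U U')) (comp_map f' (snd_map U U'))).
exists (pair_map (comp_map g (fst_map V V')) (comp_map g' (snd_map V V'))); split.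
- by move=> [a b] [c d] /= [/fi-> /fi'->].
- by move=> [a b]; have [c <-] := gs a; have [d <-] := gs' b; exists (c, d).
move=> [a b] /=; split=> [[/fg[x <-] /fg'[y <-]]|[[x y] [<- <-]]]; first by exists (x, y).
by congr (_, _); [apply/fg; exists x | apply/fg'; exists y].
Qed.

Lemma ses_zero_l U : ses (zero_module R) U U.
Proof.
exists (zero_map _ _), (id_map U); split=> //.
- by move=> x y _; rewrite (zero_moduleP x) (zero_moduleP y).
- by move=> x; exists x.
by move=> y /=; split=> [->|[_ <-]//]; exists 0.
Qed.

Lemma ses_zero_r U : ses U U (zero_module R).
Proof.
exists (id_map U), (zero_map _ _); split=> //.
- by move=> x; exists 0; rewrite (zero_moduleP x).
by move=> y /=; split=> // _; exists y.
Qed.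

Lemma pullback_ex U V W (f : {linear U -> W}) (g : {linear V -> W}) :
  exists (Y : lmodType R) (p : {linear Y -> U}) (q : {linear Y -> V}),
    [/\ forall y, f (p y) = g (q y),
        forall y y', p y = p y' -> q y = q y' -> y = y'
      & forall u v, f u = g v -> exists2 y, p y = u & q y = v].
Proof.
have S : submod_prop (fun x : dirsum U V => f x.1 = g x.2).
  by split=> [|a x y fx fy] /=; rewrite ?linear0 // !linearP fx fy.
have [Y [k [ki kE]]] := submodule_ex S.
exists Y, (comp_map (fst_map U V) k), (comp_map (snd_map U V) k); split=> /=.
- by move=> y; apply/kE; exists y.
- move=> y y' e1 e2; apply: ki; rewrite [LHS]surjective_pairing [RHS]surjective_pairing.
  exact: (congr2 pair e1 e2).
move=> u v e; have [y ky] : exists y, k y = (u, v) by apply/kE.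
by exists y; rewrite ky.
Qed.

Lemma pushout_ex U V W (f : {linear W -> U}) (g : {linear W -> V}) :
  exists (Y : lmodType R) (p : {linear U -> Y}) (q : {linear V -> Y}),
    [/\ forall w, p (f w) = q (g w),
        forall y, exists u v, y = p u + q v
      & forall u v, p u = q v -> exists2 w, f w = u & g w = v].
Proof.
have [Y [k [ks kE]]] := quotient_ex (im_submod (pair_map f (opp_map g))).
have kz w : k (f w, - g w) = 0 by apply/kE; exists w.
exists Y, (comp_map k (inl_map U V)), (comp_map k (inr_map U V)); split=> /=.
- move=> w; apply/eqP; rewrite -subr_eq0 -linearB /=; apply/eqP; rewrite -[RHS](kz w).
  by congr (k (_, _)); rewrite /= ?subr0 ?sub0r.
- move=> y; have [[u v] <-] := ks y; exists u, v; rewrite -linearD /=.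
  by congr (k (_, _)); rewrite /= ?addr0 ?add0r.
move=> u v /eqP; rewrite -subr_eq0 -linearB => /eqP /kE [w /= [wu wv]].
by exists w; [rewrite wu subr0 | move/oppr_inj: (etrans wv (sub0r _))].
Qed.

Lemma ses_pullback K X N K' P : ses K X N -> ses K' P N ->
  exists Y, ses K Y P /\ ses K' Y X.
Proof.
move=> [k [g [ki gs kg]]] [l [h [li hs lh]]].
have [Y [p [q [pq0 pq1 pq2]]]] := pullback_ex g h; exists Y; split.
  have [j jE] : exists j : {linear K -> Y}, forall x, p (j x) = k x /\ q (j x) = 0.
    have jx x : exists y, p y = k x /\ q y = 0.
      have [y] := pq2 (k x) 0 (etrans (proj2 (kg _) (ex_intro _ x erefl)) (esym (linear0 h))).
      by exists y.
    have [j jE] := choice jx.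
    suff jl : linear j by exists (mk_linear jl).
    move=> a x y; have [[e1 e2] [e3 e4]] := (jE x, jE y); have [e5 e6] := jE (a *: x + y).
    by apply: pq1; rewrite ?e5 ?e6 [RHS]linearP ?e1 ?e2 ?e3 ?e4 ?linearP ?scaler0 ?addr0.
  exists j, q; split.
  - by move=> x y e; apply: ki; rewrite -!(proj1 (jE _)) e.
  - by move=> v; have [u uv] := gs (h v); have [y _ <-] := pq2 _ _ uv; exists y.
  move=> y; split=> [qy|[x <-]]; last by case: (jE x).
  have [x kx] : exists x, k x = p y by apply/kg; rewrite pq0 qy linear0.
  exists x; have [e1 e2] := jE x.
  by apply: pq1; rewrite ?e1 ?e2 ?kx ?qy.
have [j jE] : exists j : {linear K' -> Y}, forall x, q (j x) = l x /\ p (j x) = 0.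
  have jx x : exists y, q y = l x /\ p y = 0.
    have [y] := pq2 0 (l x) (etrans (linear0 g) (esym (proj2 (lh _) (ex_intro _ x erefl)))).
    by exists y.
  have [j jE] := choice jx.
  suff jl : linear j by exists (mk_linear jl).
  move=> a x y; have [[e1 e2] [e3 e4]] := (jE x, jE y); have [e5 e6] := jE (a *: x + y).
  by apply: pq1; rewrite ?e5 ?e6 [RHS]linearP ?e1 ?e2 ?e3 ?e4 ?linearP ?scaler0 ?addr0.
exists j, p; split.
- by move=> x y e; apply: li; rewrite -!(proj1 (jE _)) e.
- by move=> u; have [v vu] := hs (g u); have [y <- _] := pq2 _ _ (esym vu); exists y.
move=> y; split=> [py|[x <-]]; last by case: (jE x).
have [x lx] : exists x, l x = q y by apply/lh; rewrite -pq0 py linear0.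
exists x; have [e1 e2] := jE x.
by apply: pq1; rewrite ?e1 ?e2 ?lx ?py.
Qed.

Lemma pushout_ses N X K P Y (f : {linear N -> X}) (g : {linear X -> K})
    (h : {linear N -> P}) (p : {linear X -> Y}) (q : {linear P -> Y}) :
  injective f -> surj g -> exact_at 0 f g ->
  (forall w, p (f w) = q (h w)) -> (forall y, exists u v, y = p u + q v) ->
  (forall u v, p u = q v -> exists2 w, f w = u & h w = v) -> ses P Y K.
Proof.
move=> fi gs fg pq0 pq1 pq2.
have qi : injective q.
  apply: linear_inj0 => v qv; have [w w0 <-] := pq2 0 v (etrans (linear0 p) (esym qv)).
  by rewrite (inj0 fi w0) linear0.
have [r rE] : exists r : {linear Y -> K}, forall x, r (copair_map p q x) = g x.1.
  apply: (factor_surj (f := comp_map g (fst_map X P))) => [y|[u v] /= e].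
    by have [u [v ->]] := pq1 y; exists (u, v).
  have [w wu _] : exists2 w, f w = u & h w = - v.
    by apply: pq2; rewrite linearN; apply/eqP; rewrite -addr_eq0 e.
  by apply/fg; exists w.
have rp u : r (p u) = g u by have := rE (u, 0); rewrite /= linear0 addr0.
have rq v : r (q v) = 0 by have := rE (0, v); rewrite /= !linear0 add0r.
exists q, r; split=> //.
  by move=> y; have [u <-] := gs y; exists (p u).
move=> y; split=> [|[v <-] //].
have [u [v ->]] := pq1 y; rewrite linearD rp rq addr0 => /fg[w <-].
by exists (h w + v); rewrite linearD pq0.
Qed.

Lemma ses_pushout N X K P K' : ses N X K -> ses N P K' ->
  exists Y, ses P Y K /\ ses X Y K'.
Proof.
move=> [f [g [fi gs fg]]] [h [l [hi ls hl]]].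
have [Y [p [q [pq0 pq1 pq2]]]] := pushout_ex f h.
exists Y; split; first exact: (pushout_ses fi gs fg pq0 pq1 pq2).
apply: (pushout_ses hi ls hl (fun w => esym (pq0 w))) => [y|u v e].
  by have [u [v ->]] := pq1 y; exists v, u; rewrite addrC.
by have [w wu wv] := pq2 _ _ (esym e); exists w.
Qed.

Lemma ses_comp_epi K A B L C : ses K A B -> ses L B C ->
  exists T, ses T A C /\ ses K T L.
Proof.
move=> [k [g [ki gs kg]]] [l [h [li hs lh]]].
have [T [t [ti tE]]] := submodule_ex (ker_submod (comp_map h g)).
exists T; split.
  exists t, (comp_map h g); split=> //.
  by move=> c; have [b <-] := hs c; have [a <-] := gs b; exists a.
have [r tr] : exists r : {linear K -> T}, forall x, t (r x) = k x.
  apply: factor_inj => // x; apply/tE => /=.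
  by rewrite (proj2 (kg _)) ?linear0 //; exists x.
have [s sE] : exists s : {linear T -> L}, forall x, l (s x) = comp_map g t x.
  by apply: factor_inj => // x; apply/lh/tE; exists x.
exists r, s; split.
- by move=> x y e; apply: ki; rewrite -!tr e.
- move=> y; have [a ga] := gs (l y).
  have [x tx] : exists x, t x = a by apply/tE; rewrite /= ga; apply/lh; exists y.
  by exists x; apply: li; rewrite sE /= tx.
move=> y; split=> [sy|[x <-]].
  have [x kx] : exists x, k x = t y by apply/kg; rewrite -[LHS]sE sy linear0.
  by exists x; apply: ti; rewrite tr.
by apply: (inj0 li); rewrite sE /= tr; apply/kg; exists x.
Qed.

Lemma ses_comp_mono A B X C Y : ses A B X -> ses B C Y ->
  exists T, ses A C T /\ ses X T Y.
Proof.
move=> [k [g [ki gs kg]]] [l [h [li hs lh]]].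
have [T [t [ts tE]]] := quotient_ex (im_submod (comp_map l k)).
exists T; split.
  by exists (comp_map l k), t; split=> // x y /= /li/ki.
have [r tr] : exists r : {linear X -> T}, forall x, r (g x) = comp_map t l x.
  by apply: factor_surj => // x /kg[y <-]; apply/tE; exists y.
have [s sE] : exists s : {linear T -> Y}, forall x, s (t x) = h x.
  by apply: factor_surj => // x /tE[y <-] /=; apply/lh; exists (k y).
exists r, s; split.
- apply: linear_inj0 => x; have [b <-] := gs x; rewrite tr => /tE[a /= /li <-].
  by apply/kg; exists a.
- by move=> y; have [c <-] := hs y; exists (t c).
move=> y; have [c <-] := ts y; rewrite sE; split=> [/lh[b <-]|[x]].
  by exists (g b); rewrite tr.
have [b <-] := gs x; rewrite tr /= => /eqP; rewrite -subr_eq0 -linearB => /eqP /tE [a /= e].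
have -> : c = l (b - k a) by rewrite linearB e opprB addrC subrK.
by apply/lh; exists (b - k a).
Qed.

Lemma retract_sum X Y (i : {linear X -> Y}) (p : {linear Y -> X}) :
  cancel i p -> exists X', iso Y (dirsum X X').
Proof.
move=> iK; have [K [k [ki kE]]] := submodule_ex (ker_submod p); exists K; apply: iso_sym.
exists (copair_map i k); split.
  apply: linear_inj0 => -[x y] /= e.
  have py : p (k y) = 0 by apply/kE; exists y.
  have x0 : x = 0 by rewrite -(iK x) -[LHS]addr0 -py -linearD e linear0.
  by move: e; rewrite x0 linear0 add0r => /(inj0 ki) ->.
move=> y; have [z zE] : exists z, k z = y - i (p y) by apply/kE; rewrite linearB iK subrr.
by exists (p y, z); rewrite /= zE addrC subrK.
Qed.

Lemma section_iso K Y X (k : {linear K -> Y}) (g : {linear Y -> X}) (s : {linear X -> Y}) :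
  injective k -> exact_at 0 k g -> cancel s g -> iso Y (dirsum K X).
Proof.
move=> ki kg sK; apply: iso_sym; exists (copair_map k s); split.
  apply: linear_inj0 => -[x y] /= e.
  have y0 : y = 0.
    have gk : g (k x) = 0 by apply/kg; exists x.
    by rewrite -(sK y) -[LHS]add0r -[X in X + _ = _]gk -linearD e linear0.
  by move: e; rewrite y0 linear0 addr0 => /(inj0 ki) ->.
move=> y; have [z zE] : exists z, k z = y - s (g y) by apply/kg; rewrite linearB sK subrr.
by exists (z, g y); rewrite /= zE subrK.
Qed.

Lemma retraction_iso K Y X (k : {linear K -> Y}) (g : {linear Y -> X}) (r : {linear Y -> K}) :
  surj g -> exact_at 0 k g -> cancel k r -> iso Y (dirsum K X).
Proof.
move=> gs kg kK; exists (pair_map r g); split.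
  by apply: linear_inj0 => y /= [e /kg[x xy]]; move: e; rewrite -xy kK => ->; rewrite linear0.
move=> [x z]; have [y <-] := gs z; exists (k (x - r y) + y).
congr (_, _); rewrite linearD ?kK ?subrK //.
by rewrite (proj2 (kg _)) ?add0r //; exists (x - r y).
Qed.

End ModuleFacts.

(** * Resolving classes and Gorenstein objects in exact categories *)

(** Only objects and the existence of short exact sequences are recorded, no morphisms. This
    suffices for the diagram chases below and makes the opposite category an instance, with
    injectives in the role of [eproj]. *)
Record exact_structure := ExactStructure {
  obj : Type;
  eses : obj -> obj -> obj -> Prop;
  eiso : obj -> obj -> Prop;
  esum : obj -> obj -> obj;
  ezero : obj;
  eproj : obj -> Prop;
  eiso_sym : forall A B, eiso A B -> eiso B A;
  eses_iso1 : forall A A' B C, eiso A A' -> eses A B C -> eses A' B C;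
  eses_iso2 : forall A B B' C, eiso B B' -> eses A B C -> eses A B' C;
  eses_iso3 : forall A B C C', eiso C C' -> eses A B C -> eses A B C';
  esumC : forall A B, eiso (esum A B) (esum B A);
  eses_sum : forall A B C A' B' C', eses A B C -> eses A' B' C' ->
    eses (esum A A') (esum B B') (esum C C');
  eses_sumr : forall A B, eses A (esum A B) B;
  eses_addr : forall A B C X, eses A B C -> eses A (esum B X) (esum C X);
  eses_addl : forall A B C X, eses A B C -> eses (esum A X) (esum B X) C;
  eses_0l : forall A, eses ezero A A;
  eses_0r : forall A, eses A A ezero;
  eses_pullback : forall A B C A' B', eses A B C -> eses A' B' C ->
    exists Y, eses A Y B' /\ eses A' Y B;
  eses_pushout : forall A B C B' C', eses A B C -> eses A B' C' ->
    exists Y, eses B' Y C /\ eses B Y C';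
  eses_comp_epi : forall K A B L C, eses K A B -> eses L B C ->
    exists T, eses T A C /\ eses K T L;
  eses_comp_mono : forall A B X C Y, eses A B X -> eses B C Y ->
    exists T, eses A C T /\ eses X T Y;
  eproj_sum : forall P Q, eproj P -> eproj Q -> eproj (esum P Q);
  eproj_split : forall P K Y, eproj P -> eses K Y P -> eiso Y (esum K P);
  eproj_cover : forall N, exists K P, eproj P /\ eses K P N
}.

Section Resolving.
Variable E : exact_structure.
Notation ses := (@eses E).
Notation O := (obj E).
Notation "A ++ B" := (esum A B).

Record resolving (Cl : O -> Prop) := Resolving {
  res_proj : forall P, eproj P -> Cl P;
  res_iso : forall A B, eiso A B -> Cl A -> Cl B;
  res_ext : forall A B C, ses A B C -> Cl A -> Cl C -> Cl B;
  res_ker : forall A B C, ses A B C -> Cl B -> Cl C -> Cl A;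
  res_summand : forall A B, Cl (A ++ B) -> Cl A
}.

Fixpoint dimle (Cl : O -> Prop) n N : Prop :=
  if n is n'.+1 then exists K X, [/\ Cl X, ses K X N & dimle Cl n' K] else Cl N.

Variables (Cl : O -> Prop) (rC : resolving Cl).

Lemma dimle_iso n A B : eiso A B -> dimle Cl n A -> dimle Cl n B.
Proof.
case: n => [|n] AB; first exact: res_iso.
by move=> [K [X [CX s dK]]]; exists K, X; split=> //; apply: eses_iso3 s.
Qed.

Lemma dimle_add_proj n K P : eproj P -> dimle Cl n K -> dimle Cl n (K ++ P).
Proof.
case: n => [|n] pP.
  by move=> CK; apply: (res_ext rC (eses_sumr _ _)) => //; apply: (res_proj rC).
move=> [L [X [CX s dL]]]; exists L, (X ++ P); split=> //; last exact: eses_addr.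
by apply: (res_ext rC (eses_sumr _ _)) => //; apply: (res_proj rC).
Qed.

(** Composing the first step [Y] of a resolution of [A] with [A -> X] gives a kernel [T] in [Cl],
    which maps onto [K] with the same kernel as [Y -> A]. *)
Lemma dimle_ker n K A X : ses K A X -> Cl X -> dimle Cl n A -> dimle Cl n K.
Proof.
case: n => [|n] s CX; first by move=> CA; apply: (res_ker rC s).
move=> [L [Y [CY t dL]]]; have [T [tT sT]] := eses_comp_epi t s.
by exists L, T; split=> //; apply: (res_ker rC tT).
Qed.

(** Schanuel: the pullback [Y] of [X] and [P] over [N] splits as [K' ++ P], hence has dimension at
    most [n], and [K] is the kernel of [Y -> X]. *)
Lemma dimle_syzygy n K P N :
  eproj P -> ses K P N -> dimle Cl n.+1 N -> dimle Cl n K.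
Proof.
move=> pP s [K' [X [CX t dK']]]; have [Y [s1 s2]] := eses_pullback t s.
apply: (dimle_ker (eses_iso2 (eproj_split pP s1) s2) CX).
exact: dimle_add_proj.
Qed.

(** A sum of syzygies is a syzygy of the sum, which reduces to dimension 0, where closure under
    summands is assumed. This carries the bound for the total homology to each homology module. *)
Lemma dimle_summand n A B : dimle Cl n (A ++ B) -> dimle Cl n A.
Proof.
elim: n A B => [|n IH] A B; first exact: res_summand.
have [K [P [pP s]]] := eproj_cover A; have [L [Q [pQ t]]] := eproj_cover B.
move=> /(dimle_syzygy (eproj_sum pP pQ) (eses_sum s t))/IH dK.
by exists K, P; split=> //; apply: (res_proj rC).
Qed.

(** Unlike in [dimle_syzygy], [X] is any object of [Cl]. Its pullback with a resolution of length 1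
    is an extension of [X] by [K'], hence in [Cl], and [K] is the kernel of the epimorphism from it
    to [X']. *)
Lemma dimle1_ker K X N : Cl X -> ses K X N -> dimle Cl 1 N -> Cl K.
Proof.
move=> CX s [K' [X' [CX' t CK']]]; have [Y [s1 s2]] := eses_pullback t s.
by apply: (res_ker rC s2) => //; apply: (res_ext rC s1).
Qed.

Lemma res_zero X : Cl X -> Cl (ezero E).
Proof. by move=> CX; apply: (res_ker rC (eses_0l X)). Qed.

Lemma dimle01 N : Cl N -> dimle Cl 1 N.
Proof.
by move=> CN; exists (ezero E), N; split=> //; [apply: eses_0l | apply: res_zero CN].
Qed.

End Resolving.

(** * Gorenstein objects defined coinductively *)

Section Gorenstein.
Variable E : exact_structure.
Notation ses := (@eses E).
Notation O := (obj E).
Notation "A ++ B" := (esum A B).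
Variables (W T : O -> Prop) (orth : O -> O -> Prop).

(** [W] is the class of terms of complete resolutions, and [T] consists of objects of [W] that are
    injective relative to [W] and into which all of [W] embeds with cokernel in [W]. Projective
    modules, injective modules (in the opposite category) and flat modules are the three instances
    of [W]; [T] differs from [W] only for flat modules. *)
Record gor_setup : Prop := GorSetup {
  W_ext : forall A B C, ses A B C -> W A -> W C -> W B;
  W_ker : forall A B C, ses A B C -> W B -> W C -> W A;
  W_proj : forall P, eproj P -> W P;
  T_W : forall t, T t -> W t;
  T_sum : forall t u, T t -> T u -> T (t ++ u);
  W_T : forall w, W w -> exists t X, [/\ T t, W X & ses w t X];
  orth_WT : forall w t, W w -> T t -> orth w t;
  orth_ext : forall A B C t, ses A B C -> orth A t -> orth C t -> orth B t;
  orth_summand : forall A B t, orth (A ++ B) t -> orth A t;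
  orth_split : forall X t Y, orth X t -> ses t Y X -> eiso Y (t ++ X)
}.

(* [post L R S]: every object of [S] is orthogonal to [T], and is both the end
   and the beginning of a short exact sequence with middle term in [L], resp.
   in [R], and third term in [S]. Unwinding both conditions gives a complete
   resolution, so [gor L R] is the coinductive class of Gorenstein objects. *)
Definition post (L R S : O -> Prop) := forall X, S X ->
  [/\ forall t, T t -> orth X t,
      exists w X', [/\ L w, S X' & ses X' w X]
    & exists t X', [/\ R t, S X' & ses X t X']].

Definition gor L R X := exists S, post L R S /\ S X.

Lemma gor_post L R : post L R (gor L R).
Proof.
move=> X [S [pS SX]]; have [o [w [X' [Lw SX' s]]] [t [Y [Rt SY s']]]] := pS _ SX.
split=> //; first by exists w, X'; split=> //; exists S.
by exists t, Y; split=> //; exists S.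
Qed.

Lemma gor_mono (L L' R R' : O -> Prop) X : (forall w, L w -> L' w) ->
  (forall t, R t -> R' t) -> gor L R X -> gor L' R' X.
Proof.
move=> LL RR [S [pS SX]]; exists S; split=> // Y /pS[o [w [X' [Lw SX' s]]] [t [Z [Rt SZ s']]]].
by split=> //; [exists w, X'; split; auto | exists t, Z; split; auto].
Qed.

Hypothesis H : gor_setup.


Lemma W_zero : W (ezero E).
Proof.
have [K [P [pP _]]] := eproj_cover (ezero E).
by apply: (W_ker H (eses_0l P)); apply: (W_proj H).
Qed.

Lemma W_sum A B : W A -> W B -> W (A ++ B).
Proof. by move=> WA WB; apply: (W_ext H (eses_sumr A B)). Qed.

Lemma ses_addl' t X Y Z : ses X Y Z -> ses (t ++ X) (t ++ Y) Z.
Proof.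
move=> s; apply: eses_iso1 (esumC _ _) _; apply: eses_iso2 (esumC _ _) _.
exact: eses_addl.
Qed.

(* Coinduction on the extensions [D] of objects of [W] by Gorenstein ones: an
   object of [T] on the right of [G] can be pushed out to [D], because
   [orth L t] holds for [L] in [W]. *)
Lemma gor_right X : gor W W X -> gor W T X.
Proof.
move=> gX; exists (fun D => exists G L, [/\ gor W W G, W L & ses G D L]); split; last first.
  by exists X, (ezero E); split=> //; [apply: W_zero | apply: eses_0r].
move=> D [G [L [gG WL s]]].
have [oG [w [G'' [Ww gG'' sl]]] [F [G' [WF gG' sr]]]] := gor_post gG; split.
- by move=> t Tt; apply: (orth_ext H s); [apply: oG | apply: (orth_WT H)].
- have [K [P [pP sK]]] := eproj_cover L.
  have WP := W_proj H pP; have WK := W_ker H sK WP WL.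
  have [Y [s1 s2]] := eses_pullback s sK.
  have s3 := eses_iso3 (eiso_sym (eproj_split pP s1)) (eses_addr P sl).
  have [U [s4 s5]] := eses_comp_epi s3 s2.
  by exists (w ++ P), U; split=> //; [apply: W_sum | exists G'', K].
have [t [L' [Tt WL' s1]]] := W_T H WF; have [X' [s2 s3]] := eses_comp_mono sr s1.
have [Y [s4 s5]] := eses_pushout s s2.
have {}s5 := eses_iso2 (orth_split H (orth_WT H WL Tt) s4) s5.
(* [D] now embeds in [t ++ L]; embedding [L] as well brings the middle term into [T]. The new
   cokernel [V] is again of the required form: its quotient by [G'] is an extension of [M] by
   [L']. *)
have [u [M [Tu WM s6]]] := W_T H WL.
have [V [s7 s8]] := eses_comp_mono s5 (ses_addl' t s6).
have [S [s9 s10]] := eses_comp_mono s3 s8.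
exists (t ++ u), V; split=> //; first exact: T_sum.
by exists G', S; split=> //; apply: (W_ext H s10).
Qed.

(** The mirror image of [gor_right]: coinduction on extensions of Gorenstein objects by objects of
    [W]. A term [w] on the left is covered by a projective, and the kernel of this cover, which lies
    in [W], is absorbed into the extension. On the right, the pushouts split because [T] is already
    in place there. *)
Lemma gor_left X : gor W T X -> gor (@eproj E) T X.
Proof.
move=> gX; exists (fun D => exists L G, [/\ W L, gor W T G & ses L D G]); split; last first.
  by exists (ezero E), X; split=> //; [apply: W_zero | apply: eses_0l].
move=> D [L [G [WL gG s]]].
have [oG [w [G'' [Ww gG'' sl]]] [u [G' [Tu gG' sr]]]] := gor_post gG; split.
- by move=> t Tt; apply: (orth_ext H s); [apply: (orth_WT H) | apply: oG].
- have [L1 [P [pP sP]]] := eproj_cover w.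
  have WL1 := W_ker H sP (W_proj H pP) Ww.
  have [T1 [s1 s2]] := eses_comp_epi sP sl.
  have [L' [P' [pP' sP']]] := eproj_cover L.
  have WL' := W_ker H sP' (W_proj H pP') WL.
  have [Y [s3 s4]] := eses_pullback s s1.
  have s5 := eses_iso3 (eiso_sym (eproj_split pP s3)) (eses_addr P sP').
  have [U [s6 s7]] := eses_comp_epi s5 s4.
  have [S [s8 s9]] := eses_comp_epi s7 s2.
  exists (P' ++ P), U; split=> //; first exact: eproj_sum.
  by exists S, G''; split=> //; apply: (W_ext H s9).
have [t [L1 [Tt WL1 s1]]] := W_T H WL.
have [Y [s2 s3]] := eses_pushout s s1.
have {}s3 := eses_iso2 (orth_split H (oG _ Tt) s2) s3.
have [V [s4 s5]] := eses_comp_mono s3 (ses_addl' t sr).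
exists (t ++ u), V; split=> //; first exact: T_sum.
by exists L1, G'.
Qed.

Notation gors := (gor (@eproj E) T).

(** A horseshoe on both sides: on the left the pullback splits because [Q] is projective, on the
    right the pushout splits because [C] is orthogonal to [t]. *)
Lemma gor_ext A B C : ses A B C -> gors A -> gors C -> gors B.
Proof.
move=> s gA gC; exists (fun D => exists A C, [/\ gors A, gors C & ses A D C]).
split; last by exists A, C.
move=> {s gA gC A B C} D [A [C [gA gC s]]].
have [oA [P [A' [pP gA' sP]]] [t [A'' [Tt gA'' st]]]] := gor_post gA.
have [oC [Q [C' [pQ gC' sQ]]] [u [C'' [Tu gC'' su]]]] := gor_post gC; split.
- by move=> v Tv; apply: (orth_ext H s); auto.
- have [Y [s1 s2]] := eses_pullback s sQ.
  have s3 := eses_iso3 (eiso_sym (eproj_split pQ s1)) (eses_addr Q sP).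
  have [U [s4 s5]] := eses_comp_epi s3 s2.
  by exists (P ++ Q), U; split=> //; [apply: eproj_sum | exists A', C'].
have [Y [s1 s2]] := eses_pushout s st.
have {}s2 := eses_iso2 (orth_split H (oC _ Tt) s1) s2.
have [V [s4 s5]] := eses_comp_mono s2 (ses_addl' t su).
by exists (t ++ u), V; split=> //; [apply: T_sum | exists A'', C''].
Qed.

Lemma gor_W w : W w -> gor W T w.
Proof.
move=> Ww; exists W; split=> // X WX; split.
- by move=> t; apply: (orth_WT H).
- by exists X, (ezero E); split=> //; [apply: W_zero | apply: eses_0l].
- exact: (W_T H).
Qed.

Lemma gor_iso A B : eiso A B -> gors A -> gors B.
Proof.
move=> AB gA; apply: (gor_ext (eses_iso2 AB (eses_0r A))) => //.
by apply: gor_left; apply: gor_W; apply: W_zero.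
Qed.

(* The cosyzygy of a summand of a Gorenstein object is again a summand of one:
   if [X ++ X'] embeds in [t] with cokernel [A''], then [t / X] is an
   extension of [A''] by [X'], hence [t / X ++ X] one of [A''] by [X' ++ X]. *)
Lemma gor_summand A B : gors (A ++ B) -> gors A.
Proof.
move=> gAB; exists (fun X => exists X', gors (X ++ X')); split; last by exists B.
move=> {gAB A B} X [X' gA].
have [oA [P [A' [pP gA' sP]]] [t [A'' [Tt gA'' st]]]] := gor_post gA.
have gA2 := gor_iso (esumC _ _) gA; split.
- by move=> u Tu; apply: (orth_summand H (oA _ Tu)).
- have [U [s1 s2]] := eses_comp_epi (eses_iso3 (esumC _ _) sP) (eses_sumr X' X).
  by exists P, U; split=> //; exists X; apply: (gor_ext (eses_addr X s2)).
have [V [s1 s2]] := eses_comp_mono (eses_sumr X X') st.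
by exists t, V; split=> //; exists X; apply: (gor_ext (eses_addl X s2)).
Qed.

(** Pulling back along a projective [P] onto [C] exhibits [A] as a summand of an extension of [B] by
    the syzygy [C']. *)
Lemma gor_ker A B C : ses A B C -> gors B -> gors C -> gors A.
Proof.
move=> s gB gC; have [_ [P [C' [pP gC' sP]]] _] := gor_post gC.
have [Y [s1 s2]] := eses_pullback s sP.
apply: (@gor_summand A P); apply: (gor_iso (eproj_split pP s1)).
exact: gor_ext s2 _ _.
Qed.

Lemma gor_resolving : resolving (gor W W).
Proof.
have gs X : gor W W X -> gors X by move=> /gor_right/gor_left.
have sg X : gors X -> gor W W X by apply: gor_mono; [apply: (W_proj H) | apply: (T_W H)].
split.
- by move=> P /(W_proj H)/gor_W; apply: gor_mono => // t; apply: (T_W H).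
- by move=> A B i /gs gA; apply/sg/(gor_iso i).
- by move=> A B C s /gs gA /gs gC; apply/sg/(gor_ext s).
- by move=> A B C s /gs gA /gs gC; apply/sg/(gor_ker s).
- by move=> A B /gs gA; apply/sg/(gor_summand gA).
Qed.

End Gorenstein.

(** * Injective modules, character modules and flatness *)

Section Baer.
Variables (R : comPzRingType) (E : lmodType R).

Hypothesis ideal_ext : forall (I : set R) (f : R -> E), is_ideal I ->
  (forall a x y, I x -> I y -> f (a * x + y) = a *: f x + f y) ->
  exists e, forall x, I x -> f x = x *: e.

(** The graph of a linear map defined on a submodule of [V]; the last condition is
    single-valuedness. *)
Definition partial_map (V : lmodType R) (G : set (V * E)%type) :=
  [/\ G 0, forall a p q, G p -> G q -> G (a *: p + q) & forall e, G (0, e) -> e = 0].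

(** The multiples of [v] in the domain of [G] give a linear map on an ideal. The element [e]
    representing it is a consistent value at [v], and [G'] is spanned by [G] and [(v, e)]. *)
Lemma partial_map_ext (V : lmodType R) (G : set (V * E)%type) (v : V) : partial_map G ->
  exists e G', [/\ partial_map G', forall p, G p -> G' p & G' (v, e)].
Proof.
move=> [G0 GD Gf].
have GN x y : G (x, y) -> G (- x, - y).
  by move=> Gxy; have := GD (-1) _ _ Gxy G0; rewrite addr0 scaleN1r.
have Gu x y y' : G (x, y) -> G (x, y') -> y = y'.
  move=> Gy /GN Gy'; apply/eqP; rewrite -subr_eq0; apply/eqP/Gf.
  by have := GD 1 _ _ Gy Gy'; rewrite scale1r; congr G; congr (_, _); rewrite /= subrr.
have [f fE] : exists f : R -> E, forall a, (exists e, G (a *: v, e)) -> G (a *: v, f a).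
  have /choice[f fE] a : exists e, (exists e, G (a *: v, e)) -> G (a *: v, e).
    by have [[e Ge]|?] := pselect (exists e, G (a *: v, e)); [exists e | exists 0].
  by exists f.
have GI a x y e e' : G (x *: v, e) -> G (y *: v, e') ->
    G ((a * x + y) *: v, a *: e + e').
  by move=> Ge Ge'; have := GD a _ _ Ge Ge'; rewrite scalerDl -scalerA.
have G0v : G (0 *: v, 0) by rewrite scale0r.
have [||e eE] := @ideal_ext (fun a => exists e, G (a *: v, e)) f.
- split; first by exists 0.
  + move=> x y [e Ge] [e' Ge']; exists (1 *: e + e').
    by rewrite -[x in x + y]mul1r; apply: GI.
  + by move=> a x [e Ge]; exists (a *: e + 0); rewrite -[a * x]addr0; apply: GI.
- move=> a x y Ix Iy; have Gx := fE _ Ix; have Gy := fE _ Iy.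
  by apply: (Gu ((a * x + y) *: v)); [apply: fE; exists (a *: f x + f y) |]; apply: GI.
exists e, (fun p => exists q a, G q /\ p = q + a *: (v, e)); split.
- split.
  + by exists 0, 0; split=> //; rewrite scale0r addr0.
  + move=> a _ _ [p [b [Gp ->]]] [q [c [Gq ->]]].
    exists (a *: p + q), (a * b + c); split; first exact: GD.
    by rewrite scalerDr scalerA scalerDl addrACA.
  + move=> e' [[x y] [a [Gxy [/eqP]]]]; rewrite eq_sym addr_eq0 => /eqP xE ->.
    have Ia : exists e', G (- a *: v, e') by exists y; rewrite scaleNr -xE.
    have -> : y = - a *: e.
      by rewrite -eE //; apply: (Gu x) => //; rewrite xE -scaleNr; apply: fE.
    by rewrite scaleNr addNr.
- by move=> p Gp; exists p, 0; rewrite scale0r addr0.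
- by exists 0, 1; rewrite add0r scale1r.
Qed.

Lemma Baer : injective_module E.
Proof.
move=> U V g f gi; pose G0 : set (V * E)%type := fun p => exists u, p = (g u, f u).
have pG0 : partial_map G0.
  split; first by exists 0; rewrite !linear0.
  - by move=> a _ _ [u ->] [u' ->]; exists (a *: u + u'); rewrite !linearP.
  - by move=> e [u [/esym/(inj0 gi) -> ->]]; rewrite linear0.
(* [G0] is joined to every set because Zorn's lemma in this form also asks [P] of the union of the
   empty chain. *)
pose P (A : set (V * E)%type) := partial_map (A `|` G0)%classic.
have [|A [PA Amax]] := @Zorn_bigcup _ P.
  move=> F FP Ft; have [[A0 FA0]|F0] := pselect (exists A, F A); last first.
    rewrite /P; suff -> : (\bigcup_(X in F) X `|` G0)%classic = G0 by [].
    apply/seteqP; split=> x; last by right.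
    by case=> // -[A FA]; case: F0; exists A.
  have up p q : (\bigcup_(X in F) X `|` G0)%classic p ->
      (\bigcup_(X in F) X `|` G0)%classic q ->
      exists A, [/\ F A, (A `|` G0)%classic p & (A `|` G0)%classic q].
    move=> [[A FA Ap]|Gp] [[B FB Bq]|Gq].
    - by have [AB|BA] := Ft _ _ FA FB; [exists B|exists A]; split=> //; left; auto.
    - by exists A; split=> //; [left | right].
    - by exists B; split=> //; [right | left].
    - by exists A0; split=> //; right.
  have incl A p : F A -> (A `|` G0)%classic p -> (\bigcup_(X in F) X `|` G0)%classic p.
    by move=> FA [Ap|Gp]; [left; exists A | right].
  split; first by right; case: pG0.
  - move=> a p q hp hq; have [A [FA Ap Aq]] := up _ _ hp hq.
    by apply: (incl A) => //; case: (FP _ FA) => _ D _; apply: D.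
  - move=> e he; have [A [FA Ap _]] := up _ _ he he.
    by case: (FP _ FA) => _ _; apply.
have tot v : exists e, (A `|` G0)%classic (v, e).
  have [e [G' [pG' sub Gv]]] := partial_map_ext v PA; exists e.
  apply: contrapT => nA; apply: (Amax G').
    by split=> [x Ax|sub']; [apply: sub; left | apply: nA; left; apply: sub'].
  rewrite /P; suff -> : (G' `|` G0)%classic = G' by [].
  by apply/seteqP; split=> x; [case=> // Gx; apply: sub; right | left].
have [h hE] := choice tot; have [G00 GD Gf] := PA.
have Gu x y y' : (A `|` G0)%classic (x, y) -> (A `|` G0)%classic (x, y') -> y = y'.
  move=> Gy Gy'; apply/eqP; rewrite -subr_eq0; apply/eqP/Gf.
  have := GD (-1) _ _ Gy' Gy; rewrite scaleN1r; congr ((A `|` G0)%classic _).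
  by congr (_, _); rewrite /= addrC ?subrr.
have hl : linear h.
  by move=> a x y; apply: Gu (hE _) _; apply: (GD a (x, h x) (y, h y)).
exists (mk_linear hl) => u; apply: Gu (hE _) _.
by right; exists u.
Qed.

End Baer.

(** Injectivity applied to the image of [g], so that [g] itself may have a kernel. *)
Lemma inj_factor (R : comPzRingType) (E U V : lmodType R) (g : {linear U -> V})
    (f : {linear U -> E}) : injective_module E ->
  (forall x, g x = 0 -> f x = 0) -> exists h : {linear V -> E}, forall x, h (g x) = f x.
Proof.
move=> Ei gf; have [I [i [ii iE]]] := submodule_ex (im_submod g).
have [g' g'E] : exists g' : {linear U -> I}, forall x, i (g' x) = g x.
  by apply: factor_inj => // x; apply/iE; exists x.
have [f' f'E] : exists f' : {linear I -> E}, forall x, f' (g' x) = f x.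
  apply: factor_surj => [y|x e]; last by apply: gf; rewrite -g'E e linear0.
  have [x xE] : exists x, g x = i y by apply/iE; exists y.
  by exists x; apply: ii; rewrite g'E.
by have [h hE] := Ei _ _ i f' ii; exists h => x; rewrite -g'E hE.
Qed.

(** * Injectivity and separation for the group Q/Z *)

Section RationalsModIntegers.

Definition int_in_rat (q : zmodule rat) : Prop := (q : rat) \is a Num.int.

Lemma int_in_rat_submod : @submod_prop int (zmodule rat) int_in_rat.
Proof.
split=> [|a x y]; first exact: rpred0.
by rewrite /int_in_rat scalezrE => xi yi; rewrite rpredD // rpredMz.
Qed.

Lemma int_ideal_principal (I : set int) : is_ideal I ->
  exists n : nat, forall x, I x <-> exists k, x = k * n%:Z.
Proof.
move=> [I0 ID IM]; have [[m mP]|ex] := pselect (exists m : nat, (0 < m)%N && `[< I m >]).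
  have exm : exists m : nat, (0 < m)%N && `[< I m >] by exists m.
  case: (ex_minnP exm) => n /andP[n0 /asboolP In] nmin.
  exists n => x; split=> [Ix|[k ->]]; last exact: IM.
  exists (x %/ n)%Z; rewrite [LHS](divz_eq x n); set r := (x %% n)%Z.
  have Ir : I r.
    have -> : r = x - (x %/ n)%Z * n by rewrite [X in X - _](divz_eq x n) addrC addKr.
    by apply: ID => //; rewrite -mulNr; apply: IM.
  have n0' : (n : int) != 0 by rewrite eqz_nat -lt0n.
  have r0 : 0 <= r by apply: modz_ge0.
  have rn : r < n by apply: (ltz_mod x n0').
  case: r Ir r0 rn => // -[|r] Ir _ rn; first by rewrite addr0.
  by have := nmin r.+1; rewrite (introT (asboolP _) Ir) => /(_ isT); rewrite leqNgt -ltz_nat rn.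
exists 0%N => x; split=> [Ix|[k ->]]; last by rewrite mulr0.
exists 0; rewrite mul0r; apply: contrapT => x0; case: ex; exists `|x|%N.
rewrite absz_gt0; apply/andP; split; first exact/eqP.
by apply/asboolP; rewrite abszEsign; apply: IM.
Qed.

Lemma divisible_cogenerator : exists D : lmodType int, injective_module D /\
  forall (U : lmodType int) (x : U), x <> 0 -> exists f : {linear U -> D}, f x <> 0.
Proof.
have [D [q [qs qE]]] := quotient_ex int_in_rat_submod; exists D.
have Di : injective_module D.
  apply: Baer => I f Iid flin; have [n nE] := int_ideal_principal Iid.
  have I0 : I 0 by case: Iid.
  have f0 : f 0 = 0 by have := flin (-1) 0 0 I0 I0; rewrite mulr0 addr0 scaleN1r addNr.
  have [n0|n0] := eqVneq n 0%N.
    exists 0 => x /nE[k ->]; rewrite n0 mulr0 f0 scaler0 //.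
  have In : I n by apply/nE; exists 1; rewrite mul1r.
  have [z zE] := qs (f n).
  (* Divisibility: a linear map on the ideal generated by [n] is multiplication by any [n]-th part
     of [f n], and [z] lifts [f n] to a rational. *)
  exists (q ((z : rat) / n%:Q)) => x /nE[k ->].
  rewrite -[X in f X]addr0 flin // f0 addr0 -zE -!linearZ; congr (q _).
  rewrite !scalezrE [k * _]mulrC mulrzA; congr (_ *~ _).
  by rewrite -[RHS]mulrzr divfK // pnatr_eq0.
split=> // U x x0.
have [|n nE] := @int_ideal_principal (fun k => k *: x = 0).
  split; first by rewrite scale0r.
  - by move=> a b ea eb; rewrite scalerDl ea eb addr0.
  - by move=> a b eb; rewrite -scalerA eb scaler0.
(* [n] generates the annihilator of [x]. The image [q e] of [x] must be nonzero and killed by [n]: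
   [1/n] does this since [n] is not 1, and for [n = 0] any non-integer will do. *)
pose e : zmodule rat := if n == 0%N then 2^-1 else n%:R^-1.
have n1 : n != 1%N.
  by apply/eqP => n1; apply: x0; rewrite -(scale1r x); apply/nE; exists 1; rewrite n1.
have qe : q e <> 0.
  move/qE; rewrite /int_in_rat /e => ei.
  have [m m1 em] : exists2 m, (1 < m)%N & e = m%:R^-1.
    rewrite /e; case: eqVneq => [|n0]; first by exists 2%N.
    by exists n => //; case: n n0 n1 {nE e ei} => [|[]].
  have : e * m%:R = 1 by rewrite em mulVf // pnatr_eq0; case: m m1 {em}.
  have /intrP[k ->] : (e : rat) \is a Num.int by [].
  rewrite -[m%:R]/(m%:Z%:~R) -intrM => /eqP; rewrite -[1%R]/(1%:Z%:~R) eqr_int.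
  move=> /eqP/(congr1 absz); rewrite abszM /= => /eqP.
  by rewrite muln_eq1 => /andP[_ /eqP mE]; rewrite mE in m1.
have gl : linear (fun k : int^o => k *: x : U) by move=> a b c; rewrite scalerDl -scalerA.
have fl : linear (fun k : int^o => k *: q e : D) by move=> a b c; rewrite scalerDl -scalerA.
have [|h hE] := inj_factor (g := mk_linear gl) (f := mk_linear fl) Di.
  move=> k /= /nE[j ->]; rewrite -linearZ; apply/qE; rewrite /int_in_rat scalezrE /e.
  case: eqVneq => [->|n0]; first by rewrite mulr0 mulr0z.
  rewrite -mulrzr intrM mulrCA -[n%:~R]/(n%:R) mulVf ?pnatr_eq0 // mulr1.
  exact: rpred_int.
by exists h => hx; have := hE 1; rewrite /= !scale1r hx => /esym.
Qed.

End RationalsModIntegers.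

(* An injective cogenerator of the category of abelian groups, such as Q/Z. *)
Definition qz : lmodType int := projT1 (cid divisible_cogenerator).

Lemma qz_inj : injective_module qz.
Proof. by rewrite /qz; case: cid => D [] /=. Qed.

Lemma qz_sep (U : lmodType int) (x : U) : x <> 0 -> exists f : {linear U -> qz}, f x <> 0.
Proof. by rewrite /qz; case: cid => D [Di Ds] /=; apply: Ds. Qed.

(** * Character modules *)

Section Dual.
Variables (R : comPzRingType) (V : lmodType R).

Definition is_char (f : V -> qz) : bool := `[< forall x y, f (x + y) = f x + f y >].

(* The character module [Hom_Z(V, Q/Z)]. *)
Record dual := Char { char_fun :> V -> qz; _ : is_char char_fun }.

HB.instance Definition _ := [isSub for char_fun].
HB.instance Definition _ := [Choice of dual by <:].

Lemma charD (f : dual) x y : f (x + y) = f x + f y.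
Proof. by case: f => f fa; move/asboolP: (fa); apply. Qed.

Lemma charP (f g : dual) : (forall x, f x = g x) -> f = g.
Proof. by move=> fg; apply: val_inj; apply: functional_extensionality_dep. Qed.

Lemma char0 (f : dual) : f 0 = 0.
Proof. by apply: (addrI (f 0)); rewrite -charD !addr0. Qed.

Fact dual0_subproof : is_char (fun _ => 0).
Proof. by apply/asboolP => x y; rewrite addr0. Qed.
Fact dualD_subproof (f g : dual) : is_char (fun x => f x + g x).
Proof. by apply/asboolP => x y; rewrite !charD addrACA. Qed.
Fact dualN_subproof (f : dual) : is_char (fun x => - f x).
Proof. by apply/asboolP => x y; rewrite charD opprD. Qed.
Fact dualZ_subproof (a : R) (f : dual) : is_char (fun x => f (a *: x)).
Proof. by apply/asboolP => x y; rewrite scalerDr charD. Qed.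

Definition dual0 := Char dual0_subproof.
Definition dualD f g := Char (dualD_subproof f g).
Definition dualN f := Char (dualN_subproof f).
Definition dualZ a f := Char (dualZ_subproof a f).

Fact dualDA : associative dualD.
Proof. by move=> f g h; apply: charP => x; apply: addrA. Qed.
Fact dualDC : commutative dualD.
Proof. by move=> f g; apply: charP => x; apply: addrC. Qed.
Fact dual0D : left_id dual0 dualD.
Proof. by move=> f; apply: charP => x; apply: add0r. Qed.
Fact dualND : left_inverse dual0 dualN dualD.
Proof. by move=> f; apply: charP => x; apply: addNr. Qed.
HB.instance Definition _ := GRing.isZmodule.Build dual dualDA dualDC dual0D dualND.

Fact dualZA a b f : dualZ a (dualZ b f) = dualZ (a * b) f.
Proof. by apply: charP => x /=; rewrite scalerA mulrC. Qed.
Fact dual1Z : left_id 1 dualZ.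
Proof. by move=> f; apply: charP => x /=; rewrite scale1r. Qed.
Fact dualZDr : right_distributive dualZ +%R.
Proof. by move=> a f g; apply: charP => x. Qed.
Fact dualZDl f : {morph dualZ^~ f : a b / a + b}.
Proof. by move=> a b; apply: charP => x /=; rewrite scalerDl charD. Qed.
HB.instance Definition _ :=
  GRing.Zmodule_isLmodule.Build R dual dualZA dual1Z dualZDr dualZDl.

Lemma dual_zeroE x : (0 : dual) x = 0. Proof. by []. Qed.

Lemma char_ex (f : V -> qz) : (forall x y, f (x + y) = f x + f y) ->
  exists g : dual, forall x, g x = f x.
Proof. by move=> fD; have fc : is_char f by [apply/asboolP]; exists (Char fc). Qed.

End Dual.

Section Characters.
Variable R : comPzRingType.
Implicit Types U V W X Y K P E F : lmodType R.

Lemma additive_int_linear (U : zmodType) (D : lmodType int) (f : U -> D) :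
  (forall x y, f (x + y) = f x + f y) -> linear (f : zmodule U -> D).
Proof.
move=> fD n x y; rewrite fD scalezrE; congr (_ + _).
have f0 : f 0 = 0 by apply: (addrI (f 0)); rewrite -fD !addr0.
have fn m : f (x *+ m) = m%:Z *: f x.
  elim: m => [|m IH]; first by rewrite mulr0n scale0r.
  by rewrite mulrS fD IH -add1n PoszD scalerDl scale1r.
case: n => n; first exact: fn.
rewrite NegzE mulrNz scaleNr -fn; apply: (addrI (f (x *+ n.+1))).
by rewrite -fD !subrr f0.
Qed.

(** The form in which injectivity of [qz] is used: it is applied to the underlying abelian groups,
    and [g] may have a kernel. Exactness of [dual] follows. *)
Lemma char_factor U V (g : {linear U -> V}) (f : dual U) :
  (forall x, g x = 0 -> f x = 0) -> exists h : dual V, forall x, h (g x) = f x.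
Proof.
move=> gf; have gl := @additive_int_linear U (zmodule V) g (linearD g).
have [|h hE] := inj_factor (g := mk_linear gl)
  (f := mk_linear (additive_int_linear (charD f))) qz_inj; first exact: gf.
have [h' h'E] := char_ex (f := h : V -> qz) (linearD h).
by exists h' => x; rewrite h'E -[RHS]hE.
Qed.

Lemma char_sep V (x : V) : x <> 0 -> exists f : dual V, f x <> 0.
Proof.
move=> /(@qz_sep (zmodule V))[h hx]; have [f fE] := char_ex (f := h : V -> qz) (linearD h).
by exists f; rewrite fE.
Qed.

Lemma char_sep_sub V (S : V -> Prop) x : submod_prop S -> ~ S x ->
  exists f : dual V, (forall y, S y -> f y = 0) /\ f x <> 0.
Proof.
move=> Ss Sx; have [Q [q [qs qE]]] := quotient_ex Ss.
have [|f fx] := @char_sep Q (q x); first by move/qE.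
have [g gE] := char_ex (f := fun y => f (q y)) (fun y z => etrans (congr1 f (linearD q y z)) (charD f _ _)).
by exists g; rewrite gE; split=> // y /qE qy; rewrite gE qy char0.
Qed.

Lemma dual_map_subproof U V (g : {linear U -> V}) (f : dual V) : is_char (fun x => f (g x)).
Proof. by apply/asboolP => x y; rewrite linearD charD. Qed.
Lemma dual_map_linear U V (g : {linear U -> V}) :
  linear (fun f => Char (dual_map_subproof g f)).
Proof.
by move=> a f f'; apply: charP => x; rewrite -[LHS]/(f (a *: g x) + f' (g x)) -linearZ.
Qed.
Definition dual_map U V (g : {linear U -> V}) : {linear dual V -> dual U} :=
  mk_linear (dual_map_linear g).

Lemma dual_map_surj U V (g : {linear U -> V}) : injective g -> surj (dual_map g).
Proof.
move=> gi f; have [x /(inj0 gi)->|h hE] := @char_factor _ _ g f; first exact: char0.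
by exists h; apply: charP.
Qed.

Lemma dual_map_inj U V (g : {linear U -> V}) : surj g -> injective (dual_map g).
Proof.
move=> gs f f' e; apply: charP => y; have [x <-] := gs y.
by have := congr1 (fun h : dual U => h x) e.
Qed.

Lemma dual_ses U V W : ses U V W -> ses (dual W) (dual V) (dual U).
Proof.
move=> [f [g [fi gs fg]]]; exists (dual_map g), (dual_map f); split.
- exact: dual_map_inj.
- exact: dual_map_surj.
move=> h; split=> [e|[k <-]].
  have [x /fg[y <-]|k kE] := @char_factor _ _ g h.
    exact: (congr1 (fun l : dual U => l y) e).
  by exists k; apply: charP.
apply: charP => x /=; rewrite (_ : g (f x) = 0) ?char0 //.
by apply/fg; exists x.
Qed.

Lemma dual_swap_subproof U V (f : {linear U -> dual V}) v : is_char (fun u => f u v).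
Proof. by apply/asboolP => x y; rewrite linearD. Qed.
Lemma dual_swap_linear U V (f : {linear U -> dual V}) :
  linear (fun v => Char (dual_swap_subproof f v)).
Proof.
move=> a x y; apply: charP => u; rewrite -[LHS]/(f u (a *: x + y)) charD.
by rewrite -[f u (a *: x)]/((a *: f u) x) -linearZ.
Qed.
(* The isomorphism [Hom(U, dual V) = Hom(V, dual U)]. *)
Definition dual_swap U V (f : {linear U -> dual V}) : {linear V -> dual U} :=
  mk_linear (dual_swap_linear f).

(** Evaluation of characters at an element. *)
Definition bidual V : {linear V -> dual (dual V)} := dual_swap (id_map (dual V)).

Lemma bidual_inj V : injective (bidual V).
Proof.
apply: linear_inj0 => x e; apply: contrapT => /char_sep[f]; apply.
by have := congr1 (fun h : dual (dual V) => h f) e.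
Qed.

Lemma inj_module_split E X Y : injective_module E -> ses E Y X -> iso Y (dirsum E X).
Proof.
move=> Ei [k [g [ki gs kg]]]; have [r rK] := Ei _ _ k (id_map E) ki.
exact: (retraction_iso gs kg rK).
Qed.

Lemma inj_retract E F (i : {linear E -> F}) (p : {linear F -> E}) :
  cancel i p -> injective_module F -> injective_module E.
Proof.
move=> iK Fi U V g f gi; have [h hE] := Fi _ _ g (comp_map i f) gi.
by exists (comp_map p h) => x; rewrite /= hE /= iK.
Qed.

Lemma inj_iso E F : iso E F -> injective_module E -> injective_module F.
Proof.
move=> [f [fi fs]]; have [g [fK gK]] := iso_inv fi fs.
exact: (inj_retract gK).
Qed.

Lemma zero_injective : injective_module (zero_module R).
Proof.
by move=> U V g f gi; exists (zero_map _ _) => x; rewrite [LHS]zero_moduleP [RHS]zero_moduleP.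
Qed.

Lemma zero_projective : projective_module (zero_module R).
Proof.
by move=> U V g f gs; exists (zero_map _ _) => x; rewrite (zero_moduleP x) !linear0.
Qed.

Lemma inj_sum E F : injective_module E -> injective_module F -> injective_module (dirsum E F).
Proof.
move=> Ei Fi U V g f gi; have [h hE] := Ei _ _ g (comp_map (fst_map E F) f) gi.
have [k kE] := Fi _ _ g (comp_map (snd_map E F) f) gi.
by exists (pair_map h k) => x; rewrite /= hE kE /= -surjective_pairing.
Qed.

Lemma proj_retract E F (i : {linear E -> F}) (p : {linear F -> E}) :
  cancel i p -> projective_module F -> projective_module E.
Proof.
move=> iK Fp U V g f gs; have [h hE] := Fp _ _ g (comp_map f p) gs.
by exists (comp_map h i) => x; rewrite /= hE /= iK.
Qed.

Lemma proj_sum E F : projective_module E -> projective_module F ->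
  projective_module (dirsum E F).
Proof.
move=> Ep Fp U V g f gs; have [h hE] := Ep _ _ g (comp_map f (inl_map E F)) gs.
have [k kE] := Fp _ _ g (comp_map f (inr_map E F)) gs.
exists (copair_map h k) => -[x y] /=; rewrite linearD hE kE /= -linearD /=.
by congr (f (_, _)); rewrite /= ?addr0 ?add0r.
Qed.

Lemma proj_split P K Y : projective_module P -> ses K Y P -> iso Y (dirsum K P).
Proof.
move=> Pp [k [g [ki gs kg]]]; have [s sK] := Pp _ _ g (id_map P) gs.
exact: (section_iso ki kg sK).
Qed.

(** By [dual_swap], extending a map [U -> dual P] along [g] amounts to lifting [P -> dual U] through
    the surjection [dual_map g]. *)
Lemma proj_dual_inj P : projective_module P -> injective_module (dual P).
Proof.
move=> Pp U V g f gi.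
have [h hE] := Pp _ _ (dual_map g) (dual_swap f) (dual_map_surj gi).
exists (dual_swap h) => x; apply: charP => p.
exact: (congr1 (fun k : dual U => k x) (hE p)).
Qed.

End Characters.

(** * Free modules, projective covers and embeddings into injectives *)

Section FreeModule.
Variables (R : comPzRingType) (T : choiceType).

Definition is_fsupp (f : T -> R) : bool :=
  `[< exists s : seq T, forall x, x \notin s -> f x = 0 >].
Record free_mod := FreeMod { fm_fun :> T -> R; _ : is_fsupp fm_fun }.
HB.instance Definition _ := [isSub for fm_fun].
HB.instance Definition _ := [Choice of free_mod by <:].

Lemma fmP (f g : free_mod) : (forall x, f x = g x) -> f = g.
Proof. by move=> fg; apply: val_inj; apply: functional_extensionality_dep. Qed.

Lemma fm_supp (f : free_mod) : exists s : seq T, forall x, x \notin s -> f x = 0.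
Proof. by case: f => f fa; apply/asboolP. Qed.

Fact fm0_subproof : is_fsupp (fun _ => 0).
Proof. by apply/asboolP; exists [::]. Qed.
Fact fmL_subproof a (f g : free_mod) : is_fsupp (fun x => a * f x + g x).
Proof.
have [[s fs] [t gt]] := (fm_supp f, fm_supp g); apply/asboolP; exists (s ++ t) => x.
by rewrite mem_cat negb_or => /andP[xs xt]; rewrite fs // gt // mulr0 addr0.
Qed.
Definition fm0 := FreeMod fm0_subproof.
Definition fmL a f g := FreeMod (fmL_subproof a f g).
Definition fmD f g := fmL 1 f g.
Definition fmZ a f := fmL a f fm0.
Definition fmN f := fmZ (-1) f.

Fact fmDA : associative fmD.
Proof. by move=> f g h; apply: fmP => x /=; rewrite !mul1r addrA. Qed.
Fact fmDC : commutative fmD.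
Proof. by move=> f g; apply: fmP => x /=; rewrite !mul1r addrC. Qed.
Fact fm0D : left_id fm0 fmD.
Proof. by move=> f; apply: fmP => x /=; rewrite mulr0 add0r. Qed.
Fact fmND : left_inverse fm0 fmN fmD.
Proof. by move=> f; apply: fmP => x /=; rewrite mul1r addr0 mulN1r addNr. Qed.
HB.instance Definition _ := GRing.isZmodule.Build free_mod fmDA fmDC fm0D fmND.
Fact fmZA a b f : fmZ a (fmZ b f) = fmZ (a * b) f.
Proof. by apply: fmP => x /=; rewrite !addr0 mulrA. Qed.
Fact fm1Z : left_id 1 fmZ.
Proof. by move=> f; apply: fmP => x /=; rewrite mul1r addr0. Qed.
Fact fmZDr : right_distributive fmZ +%R.
Proof. by move=> a f g; apply: fmP => x /=; rewrite !mul1r !addr0 mulrDr. Qed.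
Fact fmZDl f : {morph fmZ^~ f : a b / a + b}.
Proof. by move=> a b; apply: fmP => x /=; rewrite mul1r !addr0 mulrDl. Qed.
HB.instance Definition _ :=
  GRing.Zmodule_isLmodule.Build R free_mod fmZA fm1Z fmZDr fmZDl.

Lemma fm_linE a (f g : free_mod) x : (a *: f + g) x = a * f x + g x.
Proof. by rewrite /= mul1r addr0. Qed.

Fact fm_delta_subproof t : is_fsupp (fun x => (x == t)%:R).
Proof. by apply/asboolP; exists [:: t] => x; rewrite inE => /negbTE->. Qed.
Definition fm_delta t := FreeMod (fm_delta_subproof t).

(** Makes [fm_eval] independent of the support that is chosen in its definition. *)
Lemma sum_supp (V : zmodType) (F : T -> V) (s t : seq T) : uniq s -> uniq t ->
  (forall x, x \notin s -> F x = 0) -> (forall x, x \notin t -> F x = 0) ->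
  \sum_(x <- s) F x = \sum_(x <- t) F x.
Proof.
have filt (r : seq T) : \sum_(x <- r) F x = \sum_(x <- [seq x <- r | F x != 0]) F x.
  rewrite big_filter big_mkcond [RHS]big_mkcond /=; apply: eq_bigr => x _.
  by case: eqP.
move=> us ut Fs Ft; rewrite filt [RHS]filt; apply: perm_big.
apply: uniq_perm; rewrite ?filter_uniq // => x; rewrite !mem_filter.
case: eqP => //= Fx; case: (boolP (x \in s)) => [|/Fs //] _.
by case: (boolP (x \in t)) => // /Ft.
Qed.

Variables (V : lmodType R) (u : T -> V).

Definition fm_eval (f : free_mod) : V :=
  \sum_(x <- undup (projT1 (cid (fm_supp f)))) f x *: u x.

Lemma fm_evalE (f : free_mod) s : uniq s -> (forall x, x \notin s -> f x = 0) ->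
  fm_eval f = \sum_(x <- s) f x *: u x.
Proof.
move=> us fs; rewrite /fm_eval; case: cid => t ft /=; apply: sum_supp => //.
- exact: undup_uniq.
- by move=> x; rewrite mem_undup => /ft->; rewrite scale0r.
- by move=> x /fs->; rewrite scale0r.
Qed.

Lemma fm_eval_linear : linear fm_eval.
Proof.
move=> a f g; have [[s fs] [t gt]] := (fm_supp f, fm_supp g).
have hf x : x \notin undup (s ++ t) -> f x = 0.
  by rewrite mem_undup mem_cat negb_or => /andP[/fs].
have hg x : x \notin undup (s ++ t) -> g x = 0.
  by rewrite mem_undup mem_cat negb_or => /andP[_ /gt].
have un := undup_uniq (s ++ t); rewrite (fm_evalE un hf) (fm_evalE un hg).
rewrite (fm_evalE un) => [|x xs]; last by rewrite fm_linE hf // hg // mulr0 addr0.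
rewrite scaler_sumr -big_split; apply: eq_bigr => x _ /=.
by rewrite mul1r addr0 scalerDl scalerA.
Qed.

Lemma fm_eval_delta t : fm_eval (fm_delta t) = u t.
Proof.
rewrite (@fm_evalE _ [:: t]) ?big_seq1 /= ?eqxx ?scale1r // => x.
by rewrite inE => /negbTE->.
Qed.

End FreeModule.

Section FreeCover.
Variable R : comPzRingType.
Implicit Types U V N : lmodType R.

Lemma fm_eval_comp (T : choiceType) U V (u : T -> U) (g : {linear U -> V}) (f : free_mod R T) :
  g (fm_eval u f) = fm_eval (fun x => g (u x)) f.
Proof.
have [s fs] := fm_supp f.
have fs' x : x \notin undup s -> f x = 0 by rewrite mem_undup => /fs.
rewrite !(fm_evalE _ (undup_uniq s) fs') linear_sum; apply: eq_bigr => x _.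
by rewrite linearZ.
Qed.

Lemma fm_evalK (T : choiceType) (f : free_mod R T) : fm_eval (@fm_delta R T) f = f.
Proof.
have [s fs] := fm_supp f.
have fs' x : x \notin undup s -> f x = 0 by rewrite mem_undup => /fs.
rewrite (fm_evalE _ (undup_uniq s) fs'); apply: fmP => x.
have -> : forall r : seq T, (\sum_(y <- r) f y *: fm_delta R y) x =
    \sum_(y <- r) f y * (x == y)%:R.
  elim=> [|y r IH]; first by rewrite !big_nil.
  by rewrite !big_cons -IH /= mul1r !addr0.
have [xs|xs] := boolP (x \in undup s).
  rewrite (bigD1_seq x) ?undup_uniq //= eqxx mulr1 big1 ?addr0 // => y.
  by rewrite eq_sym => /negbTE->; rewrite mulr0.
rewrite fs' // big1_seq // => y /andP[_ ys]; case: eqP => [e|_]; last by rewrite mulr0.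
by rewrite e ys in xs.
Qed.

Lemma free_projective (T : choiceType) : projective_module (free_mod R T : lmodType R).
Proof.
move=> U V g f gs; have [s sK] := choice gs.
exists (mk_linear (fm_eval_linear (fun t => s (f (fm_delta R t))))) => x /=.
rewrite fm_eval_comp -[in RHS](fm_evalK x) fm_eval_comp; congr (fm_eval _ _).
exact/functional_extensionality_dep.
Qed.

Lemma proj_cover N : exists K P, projective_module P /\ ses K P N.
Proof.
have [|K s] := @ses_ker R _ _ (mk_linear (fm_eval_linear (@id N))).
  by move=> x; exists (fm_delta R x); apply: fm_eval_delta.
by exists K, (free_mod R N : lmodType R); split=> //; apply: free_projective.
Qed.

(** [N] embeds in its double dual, which embeds in [dual P] for a projective [P] mapping onto
    [dual N]. The embedding need not be essential. *)
Lemma inj_hull N : exists E C, injective_module E /\ ses N E C.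
Proof.
have [K [P [Pp [k [g [_ gs _]]]]]] := proj_cover (dual N : lmodType R).
have i : injective (comp_map (dual_map g) (bidual N)).
  by move=> x y e; apply/bidual_inj/(dual_map_inj gs e).
have [C s] := ses_coker i; exists (dual P : lmodType R), C; split=> //.
exact: proj_dual_inj.
Qed.

End FreeCover.

(** * Tensor products and flatness through characters *)

Section TensorDual.
Variable R : comPzRingType.
Implicit Types E F U V : lmodType R.

(** The character of [tensor F U] adjoint to [f], evaluated on a formal sum of pure tensors. *)
Definition pairing F U (f : {linear U -> dual F}) (s : seq (F * U)) : qz :=
  \sum_(p <- s) f p.2 p.1.

Lemma pairing_eq F U (f : {linear U -> dual F}) s t :
  tensor_eq s t -> pairing f s = pairing f t.
Proof.
rewrite /pairing; elim=> {s t} [//|s t _ -> //|s t r _ -> _ -> //| | | | | |].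
- by move=> s s' t t' _ IH1 _ IH2; rewrite !big_cat /= IH1 IH2.
- by move=> s t; rewrite !big_cat /= addrC.
- by move=> v; rewrite big_seq1 big_nil char0.
- by move=> u u' v; rewrite !big_cons !big_nil !addr0 /= charD.
- by move=> u v v'; rewrite !big_cons !big_nil !addr0 /= linearD.
- by move=> a u v; rewrite !big_seq1 /= linearZ.
Qed.

Lemma tensor_char F U (f : {linear U -> dual F}) :
  exists c : dual (tensor F U), forall s, c (tclass s) = pairing f s.
Proof.
have E x y : pairing f (repr (x + y : tensor F U)) = pairing f (repr x) + pairing f (repr y).
  by rewrite (pairing_eq f (tensor_repr _)) /pairing big_cat.
have [c cE] := char_ex E; exists c => s.
by rewrite cE; apply/pairing_eq/tensor_repr.
Qed.

Lemma char_tensor F U (c : dual (tensor F U)) :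
  exists f : {linear U -> dual F}, forall s, c (tclass s) = pairing f s.
Proof.
have cf u : is_char (fun x => c (tclass [:: (x, u)])).
  apply/asboolP => x y; rewrite -charD; congr (c _).
  by rewrite [RHS]taddE; apply/tclassP/tensor_Dl.
have fl : linear (fun u => Char (cf u)).
  move=> a u v; apply: charP => x.
  rewrite -[LHS]/(c (tclass [:: (x, a *: u + v)])).
  rewrite -[RHS]/(c (tclass [:: (a *: x, u)]) + c (tclass [:: (x, v)])).
  rewrite -charD [X in _ = c X]taddE; congr (c _); apply/tclassP.
  apply: tensor_trans (tensor_Dr _ _ _) _.
  rewrite -cat1s -[[:: (a *: x, u)]]cats0 cat1s; apply: (@tensor_cat _ _ _ [:: _] [:: _] [:: _] [:: _]).
    exact/tensor_sym/tensor_bal.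
  exact: tensor_refl.
exists (mk_linear fl); elim=> [|[x u] s IH].
  by rewrite /pairing big_nil; apply: (@char0 _ _ c).
rewrite -cat1s -taddE [LHS](charD c) IH /pairing big_cat big_seq1 /=.
by [].
Qed.

Lemma pairing_map F U V (f : {linear V -> dual F}) (g : {linear U -> V}) s :
  pairing f (tmap_seq g s) = pairing (comp_map f g) s.
Proof. by rewrite /pairing /tmap_seq big_map. Qed.

Lemma pairing1 F U (f : {linear U -> dual F}) x u : pairing f [:: (x, u)] = f u x.
Proof. exact: big_seq1. Qed.

(** Lambek's criterion. Characters of [tensor F U] are linear maps [U -> dual F], and a homomorphism
    is injective exactly when every character of its source extends along it. *)
Lemma flat_dual F : flat_module F <-> injective_module (dual F).
Proof.
split=> [Ff U V g f gi|Fi U V g gi].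
  have [c cE] := tensor_char f.
  have [x /(inj0 (Ff _ _ g gi)) ->|c' c'E] := @char_factor _ _ _ (tensor_map F g) c.
    exact: char0.
  have [h hE] := char_tensor c'; exists h => u; apply: charP => x.
  by rewrite -!pairing1 -cE -c'E /= tmapE hE pairing_map.
apply: linear_inj0 => t tE; apply: contrapT => /char_sep[c]; apply.
have [f fE] := char_tensor c; have [h hE] := Fi _ _ g f gi.
have [c' c'E] := tensor_char h.
have -> : c t = c' (tensor_map F g t).
  rewrite -(tclassK t) /= tmapE c'E pairing_map fE; apply: eq_bigr => p _.
  by rewrite /= hE.
by rewrite tE char0.
Qed.

Lemma acyclicP (X : complex R) : acyclic X <->
  forall i (x : X (i - 1)), cdiff X (i - 1) x = 0 -> exists y, cdiff X i y = x.
Proof.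
split=> [aX i x dx|H i].
  have xc : x \in cycle_pred X (i - 1) by rewrite inE dx.
  have /hclassP : hclass (Cycle xc) = hclass (0 : cycle X (i - 1)).
    by rewrite (aX _ (hclass _)) (aX _ (hclass 0)).
  by rewrite subr0 => /boundary_pred.
suff Hi j : is_zero_module (homology X (j - 1)) by have := Hi (i + 1); rewrite addrK.
move=> x; rewrite -(hclassK x) -(hclassK (0 : homology X (j - 1))).
apply/hclassP/boundary_pred; apply: H.
by rewrite linearB !cycleP subrr.
Qed.

(** Characters turn the tensor complex into [Hom(X, dual E)], and they detect exactness: a cycle
    that is not a boundary is separated from the boundaries by a character. *)
Lemma acyclic_tensor E (X : complex R) :
  acyclic (tensor_complex E X) <-> acyclic_hom_from X (dual E).
Proof.
rewrite acyclicP; split=> [ac i f fd|ah i t dt].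
  have [c cE] := tensor_char f.
  have [t /= /ac[t' <-]|c' c'E] := @char_factor _ _ _ (tensor_map E (cdiff X (i - 1))) c.
    rewrite -(tclassK t') /= tmapE cE pairing_map; apply: big1 => p _.
    by rewrite /= fd.
  have [h hE] := char_tensor c'; exists h => x; apply: charP => e.
  by rewrite -!pairing1 -cE -c'E /= tmapE hE pairing_map.
apply: contrapT => nb.
have [c [c0]] := char_sep_sub (im_submod (tensor_map E (cdiff X i))) nb; apply.
have [f fE] := char_tensor c.
have [x|h hE] := ah i f.
  apply: charP => e; rewrite -pairing1 -fE c0 //.
  by exists (tclass [:: (e, x)]); rewrite /= tmapE.
have [c' c'E] := tensor_char h.
have -> : c t = c' (tensor_map E (cdiff X (i - 1)) t).
  rewrite -(tclassK t) /= tmapE c'E pairing_map fE; apply: eq_bigr => p _.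
  by rewrite /= hE.
by rewrite -[tensor_map _ _ t]/(cdiff (tensor_complex E X) (i - 1) t) dt char0.
Qed.

End TensorDual.

(** * Double duals of injective modules over noetherian rings *)

Section Noetherian.
Variable R : comPzRingType.
Implicit Types V E : lmodType R.
Hypothesis Rn : noetherian R.

(** Generation is expressed by an induction principle rather than by linear combinations; it is
    applied below to the kernel of a linear map. *)
Definition fin_gen V (S : V -> Prop) := exists s : seq V,
  (forall v, v \in s -> S v) /\
  forall S' : V -> Prop, submod_prop S' -> (forall v, v \in s -> S' v) -> forall v, S v -> S' v.

Lemma submod_sum V (S : V -> Prop) (I : Type) (r : seq I) (c : I -> R) (v : I -> V) :
  submod_prop S -> (forall i, S (v i)) -> S (\sum_(i <- r) c i *: v i).
Proof.
move=> [S0 SD] Sv; elim: r => [|i r IH]; first by rewrite big_nil.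
by rewrite big_cons; apply: SD.
Qed.

(** Induction on the number [n] of coordinates that may be nonzero: the last of them takes its
    values in an ideal; lifts of generators of this ideal, together with generators of the submodule
    where that coordinate vanishes, generate everything. *)
Lemma noetherian_free m (S : {ffun 'I_m -> R^o} -> Prop) : submod_prop S -> fin_gen S.
Proof.
move=> Ssub; suff gen n (S' : {ffun 'I_m -> R^o} -> Prop) : submod_prop S' ->
    (forall v (i : 'I_m), S' v -> (n <= i)%N -> v i = 0) -> fin_gen S'.
  by apply: (gen m) => // v i _; rewrite leqNgt ltn_ord.
elim: n S' {S Ssub} => [|n IH] S Ssub Sn.
  exists [::]; split=> // S' [S'0 _] _ v /Sn v0.
  by rewrite (_ : v = 0) //; apply/ffunP => i; rewrite v0 // ffunE.
have [nm|mn] := ltnP n m; last first.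
  apply: IH => // v i Sv; rewrite leqNgt => /negP; case.
  exact: leq_trans (ltn_ord i) mn.
pose j := Ordinal nm.
have [S0 SD] := Ssub.
have [|k [a aE]] := Rn (I := fun x => exists2 v, S v & v j = x).
  split; first by exists 0 => //; rewrite ffunE.
  - move=> _ _ [v Sv <-] [w Sw <-]; exists (1 *: v + w); first exact: SD.
    by rewrite !ffunE scale1r.
  - move=> b _ [v Sv <-]; exists (b *: v + 0); first exact: SD.
    by rewrite !ffunE addr0.
have av i : exists v, S v /\ v j = a i.
  have /aE[v Sv vj] : exists c, a i = \sum_(l < k) c l * a l; last by exists v.
  exists (fun l => (l == i)%:R); rewrite (bigD1 i) //= eqxx mul1r big1 ?addr0 // => l.
  by move=> /negbTE->; rewrite mul0r.
have [v vE] := choice av.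
have [||s [sS sgen]] := IH (fun w => S w /\ w j = 0).
- split; first by rewrite ffunE.
  by move=> b x y [Sx xj] [Sy yj]; split; [apply: SD | rewrite !ffunE xj yj scaler0 addr0].
- move=> w i [Sw wj]; rewrite leq_eqVlt => /orP[/eqP e|]; last exact: Sn.
  by rewrite -wj; congr (w _); apply: val_inj.
exists (codom v ++ s); split.
  move=> w; rewrite mem_cat => /orP[/codomP[i ->]|/sS[]//]; by case: (vE i).
move=> S' S'sub S's w Sw.
have [c cE] : exists c, w j = \sum_(l < k) c l * a l by apply/aE; exists w.
pose u := \sum_(l < k) c l *: v l.
have Su : S u by apply: submod_sum => // i; case: (vE i).
have S'u : S' u by apply: submod_sum => // i; apply: S's; rewrite mem_cat codom_f.
have S'wu : S' ((-1) *: u + w).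
  apply: sgen => //; first by move=> x xs; apply: S's; rewrite mem_cat xs orbT.
  split; first exact: SD.
  rewrite !ffunE scaleN1r cE sum_ffunE; apply/eqP; rewrite addrC subr_eq0; apply/eqP.
  by apply: eq_bigr => l _; rewrite ffunE; case: (vE l) => _ ->.
have -> : w = 1 *: u + ((-1) *: u + w) by rewrite scaleN1r scale1r addNKr.
by case: S'sub => _; apply.
Qed.

Lemma lin_comb_linear V n (y : 'I_n -> V) :
  linear (fun r : {ffun 'I_n -> R^o} => \sum_i r i *: y i).
Proof.
move=> a r r'; rewrite scaler_sumr -big_split; apply: eq_bigr => i _ /=.
by rewrite !ffunE scalerDl scalerA.
Qed.

Lemma scal_comb_linear V n (a : 'I_n -> R) :
  linear (fun y : {ffun 'I_n -> V} => \sum_i a i *: y i).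
Proof.
move=> b y y'; rewrite scaler_sumr -big_split; apply: eq_bigr => i _ /=.
by rewrite !ffunE scalerDr !scalerA mulrC.
Qed.

Lemma sum_delta V n (y : 'I_n -> V) i :
  \sum_l [ffun l => (l == i)%:R : R] l *: y l = y i.
Proof.
rewrite (bigD1 i) //= ffunE eqxx scale1r big1 ?addr0 // => l /negbTE li.
by rewrite ffunE li scale0r.
Qed.

(* Generators [a] of an ideal and generators [s] of their relations give
   exactness of [E -> E^n -> E^m] by injectivity of [E]. Exactness survives
   dualizing twice, and is what the extension of [f] along the ideal requires. *)
Lemma bidual_injective E : injective_module E -> injective_module (dual (dual E)).
Proof.
move=> Ei; apply: Baer => I f Iid flin; have [n [a aE]] := Rn Iid.
have [I0 ID IM] := Iid.
have f0 : f 0 = 0 by have := flin (-1) 0 0 I0 I0; rewrite mulr0 addr0 scaleN1r addNr.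
have Ia i : I (a i).
  apply/aE; exists (fun l => (l == i)%:R); rewrite (bigD1 i) //= eqxx mul1r.
  by rewrite big1 ?addr0 // => l /negbTE->; rewrite mul0r.
have fsum c : f (\sum_(i < n) c i * a i) = \sum_(i < n) c i *: f (a i).
  suff [] : I (\sum_(i < n) c i * a i) /\
      f (\sum_(i < n) c i * a i) = \sum_(i < n) c i *: f (a i) by [].
  elim/big_rec2: _ => [//|i x y _ [Iy fy]]; split; first by apply: ID => //; apply: IM.
  by rewrite flin // fy.
pose al := mk_linear (@lin_comb_linear (R^o : lmodType R) n a).
have [s [sS sgen]] := @noetherian_free n _ (ker_submod al).
pose m := size s; pose rl (j : 'I_m) (i : 'I_n) : R := (nth 0 s j) i.
pose rh := fun y : {ffun 'I_n -> E} => [ffun j : 'I_m => \sum_i rl j i *: y i].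
have rhl : linear rh.
  move=> b y y'; apply/ffunP => j; rewrite !ffunE.
  exact: (@scal_comb_linear E n (rl j) b y y').
have ker_rh y : rh y = 0 -> exists x, forall i, y i = a i *: x.
  move=> ry; have [r /= /sgen rr|h hE] :=
      inj_factor (g := al) (f := mk_linear (lin_comb_linear y)) Ei.
    apply: (rr _ (ker_submod (mk_linear (lin_comb_linear y)))) => v vs /=.
    have jm : (index v s < m)%N by rewrite index_mem.
    by have := congr1 (fun g : {ffun 'I_m -> E} => g (Ordinal jm)) ry; rewrite !ffunE /rl /= nth_index.
  exists (h 1) => i; have := hE [ffun l => (l == i)%:R : R^o].
  rewrite -[mk_linear (lin_comb_linear y) _]/(\sum_l [ffun l => (l == i)%:R : R] l *: y l).
  rewrite sum_delta => <-; rewrite -linearZ; congr (h _).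
  rewrite -[LHS]/(\sum_l [ffun l => (l == i)%:R : R] l *: (a l : R^o)) sum_delta.
  by rewrite [RHS]/GRing.scale /= mulr1.
pose th := mk_linear (@scal_comb_linear (dual E : lmodType R) n a).
have [Ga GaE] : exists c : dual {ffun 'I_n -> dual E},
    forall p, c p = \sum_i f (a i) (p i).
  apply: char_ex => x y; rewrite -big_split; apply: eq_bigr => i _.
  by rewrite ffunE charD.
have sumE W (r : seq 'I_n) (p : 'I_n -> dual W) (x : W) :
    (\sum_(i <- r) p i) x = \sum_(i <- r) p i x.
  by elim: r => [|i r IH]; rewrite ?big_nil // !big_cons -IH.
(* The required [e] satisfies [f (a i) = a i *: e] for all [i], that is, [e (th p) = Ga p] for all
   [p]. It exists once [Ga] vanishes on the kernel of [th]. *)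
have [p tp|e eE] := @char_factor _ _ _ th Ga.
  have [Ph PhE] : exists c : dual {ffun 'I_n -> E}, forall y, c y = \sum_i p i (y i).
    apply: char_ex => x y; rewrite -big_split; apply: eq_bigr => i _.
    by rewrite ffunE charD.
  have [y /ker_rh[x yE]|Ps PsE] := @char_factor _ _ _ (mk_linear rhl) Ph.
    rewrite PhE -[RHS](dual_zeroE x) -tp /= sumE; apply: eq_bigr => i _.
    by rewrite yE.
  pose ij (j : 'I_m) (x : E) : {ffun 'I_m -> E} := [ffun l => if l == j then x else 0].
  have ijD j x y : Ps (ij j (x + y)) = Ps (ij j x) + Ps (ij j y).
    rewrite -charD; congr (Ps _); apply/ffunP => l; rewrite !ffunE.
    by case: eqP; rewrite ?addr0.
  have /choice[ps psE] j : exists p : dual E, forall x, p x = Ps (ij j x) by exact: char_ex.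
  (* As [Ph] factors through [rh], [p] is a combination of the relations [rl j] with coefficients
     [ps j]; [Ga] vanishes on it because [f] respects relations. *)
  have pE i : p i = \sum_(j < m) rl j i *: ps j.
    apply: charP => x.
    have -> : p i x = Ph [ffun l => if l == i then x else 0].
      rewrite PhE (bigD1 i) //= ffunE eqxx big1 ?addr0 // => l /negbTE li.
      by rewrite ffunE li char0.
    rewrite -PsE /=.
    have -> : rh [ffun l => if l == i then x else 0] =
        \sum_(j < m) ij j (rl j i *: x).
      apply/ffunP => j; rewrite sum_ffunE ffunE (bigD1 i) //= ffunE eqxx big1 => [|l /negbTE li].
        rewrite addr0 (bigD1 j) //= ffunE eqxx big1 ?addr0 // => l /negbTE lj.
        by rewrite ffunE eq_sym lj.
      by rewrite ffunE li scaler0.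
    have -> : forall r : seq 'I_m, (\sum_(j <- r) rl j i *: ps j) x =
        Ps (\sum_(j <- r) ij j (rl j i *: x)).
      elim=> [|j r IH]; first by rewrite !big_nil char0.
      by rewrite !big_cons charD -IH -psE.
    by [].
  have swap : Ga p = \sum_(j < m) (\sum_i rl j i *: f (a i)) (ps j).
    rewrite GaE; under [RHS]eq_bigr do rewrite sumE; rewrite exchange_big.
    apply: eq_bigr => i _; rewrite pE.
    elim/big_rec2: _ => [|j x y _ <-]; first exact: char0.
    by rewrite charD.
  rewrite swap big1 // => j _; rewrite -fsum.
  have /sS /= : nth 0 s j \in s by rewrite mem_nth.
  by move=> e; rewrite [X in f X](e : \sum_i rl j i * a i = 0) f0.
exists e => x /aE[c ->]; rewrite fsum; apply: charP => p; rewrite sumE.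
rewrite -[RHS]/(e ((\sum_(i < n) c i * a i) *: p)).
have -> : (\sum_(i < n) c i * a i) *: p = th [ffun i => c i *: p].
  by rewrite scaler_suml; apply: eq_bigr => i _; rewrite ffunE scalerA mulrC.
by rewrite eE GaE; apply: eq_bigr => i _; rewrite ffunE.
Qed.

End Noetherian.

(** * Complete resolutions *)

Section IntChoice.
Variables (S : int -> Type) (Rel : forall i, S (i - 1) -> S i -> Prop).
Arguments Rel {i}.

Let tagged_rel (p q : {i & S i}) :=
  exists e : tag p = tag q - 1, Rel (ecast i (S i) e (tagged p)) (tagged q).

Lemma tagged_relP i (p q : {i & S i}) (ep : tag p = i - 1) (eq : tag q = i) :
  tagged_rel p q -> Rel (ecast j (S j) ep (tagged p)) (ecast j (S j) eq (tagged q)).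
Proof.
case: p q ep eq => [j x] [k y] /= ep eq; subst k => -[e] /=.
by rewrite (eq_irrelevance e ep).
Qed.

(** Dependent choice in both directions from degree [i0]. The states of all degrees are packed into
    one sigma type so that the two steps can be iterated; the transports to the expected degree come
    at the end. *)
Lemma int_choice i0 (s0 : S i0) :
  (forall i (s : S (i - 1)), i0 < i -> exists s', Rel s s') ->
  (forall i (s : S i), i <= i0 -> exists s', Rel s' s) ->
  exists f : forall i, S i, f i0 = s0 /\ forall i, Rel (f (i - 1)) (f i).
Proof.
move=> up dn.
have /choice[u uE] (p : {i & S i}) : exists q, i0 <= tag p -> tag q = tag p + 1 /\ tagged_rel p q.
  have [ip|] := boolP (i0 <= tag p); last by exists p.
  case: p ip => i x /= ii.
  have [|s' Rs] := up (i + 1) (ecast j (S j) (boundary_index i) x).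
    by rewrite (le_lt_trans ii) ?ltrDl.
  exists (Tagged S s') => _; split=> //; exists (boundary_index i) => /=.
  exact: Rs.
have /choice[d dE] (p : {i & S i}) : exists q, tag p <= i0 -> tag q = tag p - 1 /\ tagged_rel q p.
  have [ip|] := boolP (tag p <= i0); last by exists p.
  case: p ip => i x /= ii; have [s' Rs] := dn i x ii.
  by exists (Tagged S s') => _; split=> //; exists erefl.
pose st := Tagged S s0.
have ut n : tag (iter n u st) = i0 + n%:Z.
  elim: n => [|n IH] /=; first by rewrite addr0.
  have [|-> _] := uE (iter n u st); first by rewrite IH lerDl.
  by rewrite IH -addrA -PoszD addn1.
have dt n : tag (iter n d st) = i0 - n%:Z.
  elim: n => [|n IH] /=; first by rewrite subr0.
  have [|-> _] := dE (iter n d st); first by rewrite IH gerBl.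
  by rewrite IH -addrA -opprD -PoszD addn1.
pose g (i : int) := if i0 <= i then iter `|(i - i0)%R|%N u st else iter `|(i0 - i)%R|%N d st.
have gt (i : int) : tag (g i) = i.
  rewrite /g; case: (leP i0 i) => ii.
    by rewrite ut gez0_abs ?subr_ge0 // subrKC.
  by rewrite dt gez0_abs ?subr_ge0 ?(ltW ii) // subKr.
have gR (i : int) : tagged_rel (g (i - 1)) (g i).
  rewrite /g; case: (ltP i0 i) => ii.
    rewrite (ltW ii) (_ : i0 <= i - 1); last by rewrite lerBrDr lezD1.
    have -> : `|(i - i0)%R|%N = `|(i - 1 - i0)%R|%N.+1.
      apply/eqP; rewrite -eqz_nat -addn1 PoszD !gez0_abs ?subr_ge0 ?(ltW ii) //; last first.
        by rewrite lerBrDr lezD1.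
      by rewrite [X in _ == X]addrAC subrK.
    by have [|_] := uE (iter `|(i - 1 - i0)%R|%N u st); first by rewrite ut lerDl.
  rewrite [i0 <= i - 1]leNgt (_ : i - 1 < i0) /=; last by rewrite ltrBlDr ltzD1.
  have -> : `|(i0 - (i - 1))%R|%N = `|(i0 - i)%R|%N.+1.
    apply/eqP; rewrite -eqz_nat -addn1 PoszD !gez0_abs ?subr_ge0 //.
      by rewrite opprB [1 - i]addrC addrA.
    by rewrite lerBlDr (le_trans ii) // lerDl.
  have [|_] := dE (iter `|(i0 - i)%R|%N d st); first by rewrite dt gerBl.
  case: (eqVneq i i0) => [->|ne]; first by rewrite lexx subrr.
  by rewrite leNgt lt_neqAle ne ii.
exists (fun i => ecast j (S j) (gt i) (tagged (g i))); split; last first.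
  by move=> i; apply: tagged_relP.
have gi0 : g i0 = st by rewrite /g lexx subrr.
by move: (gt i0); rewrite gi0 => e; rewrite (eq_irrelevance e erefl).
Qed.

End IntChoice.

Section Splice.
Variables (R : comPzRingType) (S W : lmodType R -> Prop).
Hypothesis left_step : forall X, S X -> exists w X', [/\ W w, S X' & ses X' w X].
Hypothesis right_step : forall X, S X -> exists w X', [/\ W w, S X' & ses X w X'].

(** One short exact sequence of the resolution. Neighbouring ones are matched along an isomorphism,
    since an equality of modules would have to be transported through the maps. *)
Record splice_state := SpliceState {
  sp_ker : lmodType R; sp_mid : lmodType R; sp_coker : lmodType R;
  sp_in : {linear sp_ker -> sp_mid}; sp_out : {linear sp_mid -> sp_coker};
  sp_inj : injective sp_in; sp_surj : surj sp_out; sp_exact : exact_at 0 sp_in sp_out;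
  sp_kerS : S sp_ker; sp_cokerS : S sp_coker; sp_midW : W sp_mid
}.

Lemma splice X i0 : S X -> exists (P : complex R) (Z : int -> lmodType R)
    (k : forall i, {linear Z i -> P i}) (p : forall i, {linear P i -> Z (i - 1)}),
  [/\ forall i, [/\ injective (k i), surj (p i) & exact_at 0 (k i) (p i)],
      forall i x, cdiff P i x = k (i - 1) (p i x),
      forall i, S (Z i) /\ W (P i)
    & Z i0 = X].
Proof.
move=> SX; have [w [X' [Ww SX' [f [g [fi gs fg]]]]]] := right_step SX.
have [||s [s0 sR]] := @int_choice (fun _ => splice_state)
  (fun i s s' => exists h : {linear sp_coker s' -> sp_ker s}, injective h /\ surj h)
  i0 (SpliceState fi gs fg SX SX' Ww).
- move=> i s _; have [v [Y [Wv SY [l [q [li qs lq]]]]]] := left_step (sp_kerS s).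
  exists (SpliceState li qs lq SY (sp_kerS s) Wv), (id_map _); split=> // x.
  by exists x.
- move=> i s _; have [v [Y [Wv SY [l [q [li qs lq]]]]]] := right_step (sp_cokerS s).
  exists (SpliceState li qs lq (sp_cokerS s) SY Wv), (id_map _); split=> // x.
  by exists x.
have [h hP] := dep_choice sR.
pose p i : {linear sp_mid (s i) -> sp_ker (s (i - 1))} := comp_map (h i) (sp_out (s i)).
pose k i := sp_in (s i).
have ex i : exact_at 0 (k i) (p i).
  move=> y; rewrite -sp_exact; split=> [/= e|/= ->]; last by rewrite linear0.
  by apply: (inj0 (proj1 (hP i)) e).
have dK i x : comp_map (k (i - 1 - 1)) (p (i - 1)) (comp_map (k (i - 1)) (p i) x) = 0.
  by rewrite /= -[h _ _]/(p (i - 1) _) (proj2 (ex _ _)) ?linear0 //; exists (p i x).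
exists (@Complex R (fun i => sp_mid (s i)) (fun i => comp_map (k (i - 1)) (p i)) dK).
exists (fun i => sp_ker (s i)), k, p; split=> //; last by rewrite s0.
- move=> i; split=> //; first exact: sp_inj.
  move=> z; have [hi hs] := hP i; have [y <-] := hs z.
  by have [x <-] := sp_surj y; exists x.
- by move=> i; split; [apply: sp_kerS | apply: sp_midW].
Qed.

End Splice.

(** * Exact structures on modules, and vanishing of Ext^1 *)

Section Structures.
Variable R : comPzRingType.
Implicit Types X Y K T A B C E P : lmodType R.

Definition mod_exact : exact_structure :=
  @ExactStructure (lmodType R) (@ses R) (@iso R) (@dirsum R) (zero_module R)
    (@projective_module R) (@iso_sym R) (@ses_iso1 R) (@ses_iso2 R) (@ses_iso3 R)
    (@iso_sumC R) (@ses_sum R) (@ses_sumr R) (@ses_add R) (@ses_add' R)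
    (@ses_zero_l R) (@ses_zero_r R) (@ses_pullback R) (@ses_pushout R)
    (@ses_comp_epi R) (@ses_comp_mono R) (@proj_sum R) (@proj_split R) (@proj_cover R).

(** Kept transparent, so that [eses] unfolds to reversed sequences of modules. *)
Definition mod_op_exact : exact_structure.
Proof.
refine (@ExactStructure (lmodType R) (fun A B C => ses C B A) (@iso R) (@dirsum R)
  (zero_module R) (@injective_module R) (@iso_sym R) _ _ _ (@iso_sumC R) _ _ _ _ _ _ _ _ _ _
  (@inj_sum R) _ _).
- by move=> A A' B C; apply: ses_iso3.
- by move=> A B B' C; apply: ses_iso2.
- by move=> A B C C'; apply: ses_iso1.
- by move=> A B C A' B' C'; apply: ses_sum.
- by move=> A B; apply: (ses_iso2 (iso_sumC B A)); apply: ses_sumr.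
- by move=> A B C X; apply: ses_add'.
- by move=> A B C X; apply: ses_add.
- by move=> A; apply: ses_zero_r.
- by move=> A; apply: ses_zero_l.
- by move=> A B C A' B' s t; have [Y []] := ses_pushout s t; exists Y.
- by move=> A B C A' B' s t; have [Y []] := ses_pullback s t; exists Y.
- by move=> A B C L D s t; have [Y []] := ses_comp_mono t s; exists Y.
- by move=> A B C L D s t; have [Y []] := ses_comp_epi t s; exists Y.
- move=> P K Y Pi /(inj_module_split Pi) i; exact: iso_trans i (iso_sumC _ _).
- by move=> N; have [E [C [Ei s]]] := inj_hull N; exists C, E.
Defined.

(* [orth X T] and [orthi X T] say [Ext^1(X, T) = 0], resp. [Ext^1(T, X) = 0]. *)
Definition orth X T := forall K Y (k : {linear K -> Y}) (g : {linear Y -> X}),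
  injective k -> surj g -> exact_at 0 k g ->
  forall f : {linear K -> T}, exists h : {linear Y -> T}, forall x, h (k x) = f x.

Definition orthi X T := forall Y C (k : {linear X -> Y}) (g : {linear Y -> C}),
  injective k -> surj g -> exact_at 0 k g ->
  forall f : {linear T -> C}, exists h : {linear T -> Y}, forall x, g (h x) = f x.

Lemma orth_split_iso X T Y : orth X T -> ses T Y X -> iso Y (dirsum T X).
Proof.
move=> o [k [g [ki gs kg]]]; have [r rK] := o _ _ k g ki gs kg (id_map T).
exact: (retraction_iso gs kg rK).
Qed.

Lemma orthi_split_iso X T Y : orthi X T -> ses X Y T -> iso Y (dirsum T X).
Proof.
move=> o [k [g [ki gs kg]]]; have [r rK] := o _ _ k g ki gs kg (id_map T).
exact: iso_trans (section_iso ki kg rK) (iso_sumC _ _).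
Qed.

(** The restriction to [A] of an extension of [B], realized inside [Y]. *)
Lemma preimage_ses A B C K Y (a : {linear A -> B}) (b : {linear B -> C})
    (k : {linear K -> Y}) (g : {linear Y -> B}) :
  injective a -> exact_at 0 a b -> injective k -> surj g -> exact_at 0 k g ->
  exists Y1 (i : {linear Y1 -> Y}) (k1 : {linear K -> Y1}) (g1 : {linear Y1 -> A}),
    [/\ injective i, exact_at 0 i (comp_map b g), forall x, i (k1 x) = k x
      & [/\ injective k1, surj g1, exact_at 0 k1 g1 & forall y, a (g1 y) = g (i y)]].
Proof.
move=> ai ab ki gs kg; have [Y1 [i [ii iE]]] := submodule_ex (ker_submod (comp_map b g)).
have [k1 k1E] : exists k1 : {linear K -> Y1}, forall x, i (k1 x) = k x.
  apply: factor_inj => // x; apply/iE => /=.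
  by rewrite (proj2 (kg _)) ?linear0 //; exists x.
have [g1 g1E] : exists g1 : {linear Y1 -> A}, forall y, a (g1 y) = comp_map g i y.
  by apply: factor_inj => // y; apply/ab/iE; exists y.
exists Y1, i, k1, g1; split=> //; split=> //.
- by move=> x y e; apply: ki; rewrite -!k1E e.
- move=> x; have [y gy] := gs (a x); have [y1 y1E] : exists y1, i y1 = y.
    by apply/iE; rewrite /= gy; apply/ab; exists x.
  by exists y1; apply: ai; rewrite g1E /= y1E.
move=> y; split=> [gy|[x <-]].
  have [x xE] : exists x, k x = i y by apply/kg; rewrite -[LHS]g1E gy linear0.
  by exists x; apply: ii; rewrite k1E.
by apply: (inj0 ai); rewrite g1E /= k1E; apply/kg; exists x.
Qed.

(** A map is extended first to the preimage of [A] in [Y], an extension of [A] by [K], and then to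
    [Y], whose quotient by that preimage is [C]. *)
Lemma orth_ses A B C T : ses A B C -> orth A T -> orth C T -> orth B T.
Proof.
move=> [a [b [ai bs ab]]] oA oC K Y k g ki gs kg f.
have [Y1 [i [k1 [g1 [ii ie ik [k1i g1s kg1 _]]]]]] := preimage_ses ai ab ki gs kg.
have [f1 f1E] := oA _ _ k1 g1 k1i g1s kg1 f.
have [|h hE] := oC _ _ i (comp_map b g) ii _ ie f1.
  by move=> c; have [x <-] := bs c; have [y <-] := gs x; exists y.
by exists h => x; rewrite -ik hE f1E.
Qed.

Lemma orth_sum_l A B T : orth (dirsum A B) T -> orth A T.
Proof.
move=> o K Y k g ki gs kg f.
have [|||h hE] := o K (dirsum Y B) (comp_map (inl_map Y B) k)
    (pair_map (comp_map g (fst_map Y B)) (snd_map Y B)) _ _ _ f.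
- by move=> x y [/ki].
- by move=> [a b]; have [y <-] := gs a; exists (y, b).
- move=> [y b] /=; split=> [[/kg[x <-] ->]|[x [<- <-]]]; first by exists x.
  by congr (_, _); apply/kg; exists x.
by exists (comp_map h (inl_map Y B)).
Qed.

Lemma orth_sum_r X A B : orth X A -> orth X B -> orth X (dirsum A B).
Proof.
move=> oA oB K Y k g ki gs kg f.
have [h hE] := oA _ _ k g ki gs kg (comp_map (fst_map A B) f).
have [l lE] := oB _ _ k g ki gs kg (comp_map (snd_map A B) f).
by exists (pair_map h l) => x; rewrite /= hE lE /= -surjective_pairing.
Qed.

Lemma orth_proj P T : projective_module P -> orth P T.
Proof.
move=> Pp K Y k g ki gs kg f; have [s sK] := Pp _ _ g (id_map P) gs.
have [r rE] : exists r : {linear Y -> K}, forall y,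
    k (r y) = add_map (id_map Y) (opp_map (comp_map s g)) y.
  by apply: factor_inj => // y; apply/kg; rewrite /= linearB sK subrr.
exists (comp_map f r) => x /=; congr (f _); apply: ki; rewrite rE /=.
have -> : g (k x) = 0 by apply/kg; exists x.
by rewrite linear0 subr0.
Qed.

(** A piece of the long exact Ext sequence. On the pullback [Y'] of [P] and [Y] over [X], [f]
    extends by orthogonality of [P]. Restricting the result to [K0], extending the restriction to
    [P] and subtracting yields a map that vanishes on [K0] and so descends to [Y]. *)
Lemma orth_shift K0 P X T (k0 : {linear K0 -> P}) (p : {linear P -> X}) :
  injective k0 -> surj p -> exact_at 0 k0 p -> orth P T ->
  (forall f : {linear K0 -> T}, exists h : {linear P -> T}, forall x, h (k0 x) = f x) ->
  orth X T.
Proof.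
move=> k0i ps k0p oP ext K Y k g ki gs kg f.
have [Y' [u [v [uv uv1 uv2]]]] := pullback_ex p g.
have [k1 k1E] : exists k1 : {linear K -> Y'}, forall x, u (k1 x) = 0 /\ v (k1 x) = k x.
  have /choice[k1 k1E] x : exists y, u y = 0 /\ v y = k x.
    have [y] := uv2 0 (k x) (etrans (linear0 p) (esym (proj2 (kg _) (ex_intro _ x erefl)))).
    by exists y.
  suff kl : linear k1 by exists (mk_linear kl).
  move=> a x y; have [[e1 e2] [e3 e4]] := (k1E x, k1E y); have [e5 e6] := k1E (a *: x + y).
  by apply: uv1; rewrite ?e5 ?e6 [RHS]linearP ?e1 ?e2 ?e3 ?e4 ?linearP ?scaler0 ?addr0.
have [k2 k2E] : exists k2 : {linear K0 -> Y'}, forall x, u (k2 x) = k0 x /\ v (k2 x) = 0.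
  have /choice[k2 k2E] x : exists y, u y = k0 x /\ v y = 0.
    have [y] := uv2 (k0 x) 0 (etrans (proj2 (k0p _) (ex_intro _ x erefl)) (esym (linear0 g))).
    by exists y.
  suff kl : linear k2 by exists (mk_linear kl).
  move=> a x y; have [[e1 e2] [e3 e4]] := (k2E x, k2E y); have [e5 e6] := k2E (a *: x + y).
  by apply: uv1; rewrite ?e5 ?e6 [RHS]linearP ?e1 ?e2 ?e3 ?e4 ?linearP ?scaler0 ?addr0.
have [|||f1 f1E] := oP K Y' k1 u _ _ _ f.
- by move=> x y e; apply: ki; rewrite -!(proj2 (k1E _)) e.
- by move=> w; have [y gy] := gs (p w); have [z <- _] := uv2 _ _ (esym gy); exists z.
- move=> y; split=> [uy|[x <-]]; last by case: (k1E x).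
  have [x xE] : exists x, k x = v y by apply/kg; rewrite -uv uy linear0.
  by have [e1 e2] := k1E x; exists x; apply: uv1; rewrite ?e1 ?e2 ?uy ?xE.
have [f2 f2E] := ext (comp_map f1 k2).
have [||h hE] := factor_surj (q := v) (f := add_map f1 (opp_map (comp_map f2 u))).
- by move=> y; have [w pw] := ps (g y); have [z _ <-] := uv2 _ _ pw; exists z.
- move=> y vy; have [x xE] : exists x, k0 x = u y by apply/k0p; rewrite uv vy linear0.
  have -> : y = k2 x by have [e1 e2] := k2E x; apply: uv1; rewrite ?e1 ?e2 ?vy.
  by rewrite /= (proj1 (k2E x)) f2E subrr.
by exists h => x; have [e1 e2] := k1E x; rewrite -e2 hE /= e1 linear0 subr0 f1E.
Qed.

Lemma orthi_ses A B C T : ses C B A -> orthi A T -> orthi C T -> orthi B T.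
Proof.
move=> [a [b [ai bs ab]]] oA oC Y D k g ki gs kg f.
have [Q [q [qs qE]]] := quotient_ex (im_submod (comp_map k a)).
have [k1 k1E] : exists k1 : {linear A -> Q}, forall x, k1 (b x) = comp_map q k x.
  by apply: factor_surj => // x /ab[y <-]; apply/qE; exists y.
have [g1 g1E] : exists g1 : {linear Q -> D}, forall x, g1 (q x) = g x.
  by apply: factor_surj => // x /qE[y <-]; apply/kg; exists (a y).
have [|||f1 f1E] := oA _ _ k1 g1 _ _ _ f.
- apply: linear_inj0 => x; have [y <-] := bs x; rewrite k1E => /qE[z /ki <-].
  by apply/ab; exists z.
- by move=> x; have [y <-] := gs x; exists (q y).
- move=> z; have [y <-] := qs z; rewrite g1E kg; split=> [[x <-]|[x]].
    by exists (b x); rewrite k1E.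
  have [w <-] := bs x; rewrite k1E /= => /eqP; rewrite -subr_eq0 -linearB => /eqP/qE[c /= cE].
  by exists (w - a c); rewrite linearB cE opprB addrC subrK.
have [||h hE] := oC _ _ (comp_map k a) q _ qs _ f1.
- by move=> x y /ki/ai.
- exact: qE.
by exists h => x; rewrite -g1E hE f1E.
Qed.

Lemma orthi_sum A B T : orthi (dirsum A B) T -> orthi A T.
Proof.
move=> o Y C k g ki gs kg f.
have [|||h hE] := o (dirsum Y B) C
    (pair_map (comp_map k (fst_map A B)) (snd_map A B)) (comp_map g (fst_map Y B)) _ _ _ f.
- by move=> [a b] [c d] /= [/ki-> ->].
- by move=> c; have [y <-] := gs c; exists (y, 0).
- move=> [y b] /=; rewrite kg; split=> [[x <-]|[[x b'] [<- _]]]; last by exists x.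
  by exists (x, b).
by exists (comp_map (fst_map Y B) h).
Qed.

Lemma orthi_inj E T : injective_module E -> orthi E T.
Proof.
move=> Ei Y C k g ki gs kg f; have [r rK] := Ei _ _ k (id_map E) ki.
have [s sE] : exists s : {linear C -> Y}, forall y,
    s (g y) = add_map (id_map Y) (opp_map (comp_map k r)) y.
  apply: factor_surj => // y /kg[x <-] /=; by rewrite rK subrr.
exists (comp_map s f) => x /=; have [y <-] := gs (f x).
have gk : g (k (r y)) = 0 by apply/kg; exists (r y).
by rewrite sE /= linearB gk subr0.
Qed.

(** Dual to [orth_shift], with the pushout [Y'] of [E] and [Y] along [X]. *)
Lemma orthi_shift X E K0 T (k : {linear X -> E}) (p : {linear E -> K0}) :
  injective k -> surj p -> exact_at 0 k p -> orthi E T ->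
  (forall f : {linear T -> K0}, exists h : {linear T -> E}, forall x, p (h x) = f x) ->
  orthi X T.
Proof.
move=> ki ps kp oE lift Y C l g li gs lg f.
have [Y' [u [v [uv uv1 uv2]]]] := pushout_ex k l.
have vi : injective v.
  apply: linear_inj0 => y vy; have [x kx <-] := uv2 0 y (etrans (linear0 u) (esym vy)).
  by rewrite (inj0 ki kx) linear0.
have ui : injective u.
  apply: linear_inj0 => y uy; have [x <- lx] := uv2 y 0 (etrans uy (esym (linear0 v))).
  by rewrite (inj0 li lx) linear0.
have cs : surj (copair_map u v) by move=> y; have [a [b ->]] := uv1 y; exists (a, b).
have [c cE] : exists c : {linear Y' -> C}, forall x, c (copair_map u v x) = g x.2.
  apply: (factor_surj (f := comp_map g (snd_map E Y)) cs) => -[a b] /= e.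
  have [x _ lx] : exists2 x, k x = - a & l x = b.
    by apply: uv2; rewrite linearN; apply/eqP; rewrite eq_sym -addr_eq0 addrC e.
  by rewrite -lx; apply/lg; exists x.
have [d dE] : exists d : {linear Y' -> K0}, forall x, d (copair_map u v x) = p x.1.
  apply: (factor_surj (f := comp_map p (fst_map E Y)) cs) => -[a b] /= e.
  have [x kx _] : exists2 x, k x = a & l x = - b.
    by apply: uv2; rewrite linearN; apply/eqP; rewrite -addr_eq0 e.
  by rewrite -kx; apply/kp; exists x.
have cu a : c (u a) = 0 by have := cE (a, 0); rewrite /= !linear0 addr0.
have cv b : c (v b) = g b by have := cE (0, b); rewrite /= linear0 add0r.
have du a : d (u a) = p a by have := dE (a, 0); rewrite /= linear0 addr0.
have dv b : d (v b) = 0 by have := dE (0, b); rewrite /= !linear0 add0r.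
have [||f1 f1E] := oE _ _ u c ui _ _ f.
- by move=> x; have [y <-] := gs x; exists (v y).
- move=> y; split=> [|[a <-] //]; have [a [b ->]] := uv1 y.
  rewrite linearD cu cv add0r => /lg[x <-]; exists (a + k x).
  by rewrite linearD uv.
have [f2 f2E] := lift (comp_map d f1).
have [h hE] : exists h : {linear T -> Y}, forall t,
    v (h t) = add_map f1 (opp_map (comp_map u f2)) t.
  apply: factor_inj => // t /=; have [a [b abE]] := uv1 (f1 t).
  have := f2E t; rewrite /= abE linearD du dv addr0 => /eqP.
  rewrite -subr_eq0 -linearB => /eqP/kp[x xE]; exists (b - l x).
  by rewrite linearB -uv xE linearB opprB addrCA addrA.
by exists h => t; rewrite -cv hE /= linearB cu subr0 f1E.
Qed.

End Structures.

(** * Flat and Gorenstein modules as resolving classes *)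

Section GorensteinComplexes.
Variable R : comPzRingType.
Implicit Types X Y A B C T E F P Q : lmodType R.

Lemma cokernel_ses (P : complex R) i X X' : acyclic P ->
  is_cokernel (cdiff P i) X -> is_cokernel (cdiff P (i - 1)) X' ->
  exists (p : {linear P (i - 1) -> X}) (k : {linear X -> P (i - 1 - 1)})
         (p' : {linear P (i - 1 - 1) -> X'}),
    [/\ surj p, forall x, k (p x) = cdiff P (i - 1) x,
        injective k, surj p' & exact_at 0 k p'].
Proof.
move=> /acyclicP aP [p [ps pE]] [p' [ps' pE']].
have [k kE] : exists k : {linear X -> P (i - 1 - 1)}, forall x, k (p x) = cdiff P (i - 1) x.
  by apply: factor_surj => // x /pE[y <-]; apply: cdiffK.
exists p, k, p'; split=> //.
  apply: linear_inj0 => x; have [y <-] := ps x; rewrite kE => /aP[z <-].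
  by apply/pE; exists z.
move=> y; rewrite pE'; split=> [[x <-]|[x <-]]; first by exists (p x).
by have [z <-] := ps x; exists z; rewrite kE.
Qed.

Lemma kernel_ses (P : complex R) i X X' : acyclic P ->
  is_kernel (cdiff P i) X -> is_kernel (cdiff P (i - 1)) X' ->
  exists (k : {linear X -> P i}) (p : {linear P i -> X'}) (k' : {linear X' -> P (i - 1)}),
    [/\ forall x, k' (p x) = cdiff P i x, injective k', exact_at 0 k' (cdiff P (i - 1)),
        injective k & surj p /\ exact_at 0 k p].
Proof.
move=> /acyclicP aP [k [ki kE]] [k' [ki' kE']].
have [p pE] : exists p : {linear P i -> X'}, forall x, k' (p x) = cdiff P i x.
  by apply: factor_inj => // x; apply/kE'; apply: cdiffK.
exists k, p, k'; split=> //; split.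
  move=> x; have [|y yE] := aP i (k' x); first by apply/kE'; exists x.
  by exists y; apply: ki'; rewrite pE.
move=> y; rewrite -kE -pE; split=> [->|e]; first by rewrite linear0.
exact: inj0 e.
Qed.

Lemma cokernel_ex A B (f : {linear A -> B}) : exists X, is_cokernel f X.
Proof. by have [Q [q [qs qE]]] := quotient_ex (im_submod f); exists Q, q. Qed.

Lemma kernel_ex A B (f : {linear A -> B}) : exists X, is_kernel f X.
Proof.
have [K [k [ki kE]]] := submodule_ex (ker_submod f).
by exists K, k; split=> // y; apply: kE.
Qed.

Lemma spliced_acyclic (P : complex R) (Z : int -> lmodType R)
    (k : forall i, {linear Z i -> P i}) (p : forall i, {linear P i -> Z (i - 1)}) :
  (forall i, [/\ injective (k i), surj (p i) & exact_at 0 (k i) (p i)]) ->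
  (forall i x, cdiff P i x = k (i - 1) (p i x)) -> acyclic P.
Proof.
move=> kp dE; apply/acyclicP => i x; rewrite dE.
have [[[ki _ _] [_ _ kpe]] [_ ps _]] := (kp (i - 1 - 1), kp (i - 1), kp i).
move=> /(inj0 ki)/kpe[z <-]; have [y <-] := ps z.
by exists y; rewrite dE.
Qed.

Section Projective.
Variables W T Q : lmodType R -> Prop.
Hypothesis orthWQ : forall w q, W w -> Q q -> orth w q.
Hypothesis orthTQ : forall X, (forall t, T t -> orth X t) <-> (forall q, Q q -> orth X q).

(** [Q] is the class against which complete resolutions are tested, [T] the one used in the
    coinduction; only their left orthogonals must agree. One direction splices. In the other, the
    cokernels of differentials satisfy [post]: their orthogonality is [orth_shift] fed with the
    acyclicity of [Hom(P, q)]. *)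
Lemma gor_cokernel G :
  gor (E := mod_exact R) T (@orth R) W W G <->
  exists P : complex R,
    [/\ forall i, W (P i), acyclic P, forall q, Q q -> acyclic_hom_from P q
      & exists i, is_cokernel (cdiff P i) G].
Proof.
split=> [gG|[P [PW aP Pq [j jG]]]].
  pose S := gor (E := mod_exact R) T (@orth R) W W.
  (* In this degree [G] is the target of [p (0 - 1)], hence the cokernel of [cdiff P 0], without any
     transport. *)
  have [||P [Z [k [p [kp dE ZW ZG]]]]] := @splice R S W _ _ G (0 - 1 - 1) gG.
  - by move=> X /gor_post[].
  - by move=> X /gor_post[].
  exists P; split; first by move=> i; case: (ZW i).
  - exact: spliced_acyclic kp dE.
  - move=> q Qq i f fd.
    have [[k1i _ k1p] [_ pis _]] := (kp (i - 1), kp i).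
    have [k2i p2s k2p] := kp (i - 1 - 1).
    have [||f' f'E] := factor_surj (q := p (i - 1)) (f := f); first by case: (kp (i - 1)).
      by move=> x /k1p[z <-]; have [y <-] := pis z; rewrite -dE.
    have [/gor_post[/orthTQ oZ _ _] _] := ZW (i - 1 - 1 - 1).
    have [h hE] := oZ _ Qq _ _ _ _ k2i p2s k2p f'.
    by exists h => x; rewrite dE hE.
  - rewrite -ZG; exists 0, (p (0 - 1)).
    have [[_ ps ex] [_ p0s _]] := (kp (0 - 1), kp 0); split=> // y.
    rewrite ex; split=> [[z <-]|[x <-]].
      by have [x <-] := p0s z; exists x; rewrite dE.
    by exists (p 0 x); rewrite dE.
exists (fun X => exists i, is_cokernel (cdiff P i) X); split; last by exists j.
move=> {jG} X [i iX]; split.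
(* Writing [i] as [l - 1] makes [cdiff P l] and [cdiff P (l - 1)] composable as they stand. *)
- apply/orthTQ => q Qq; move: iX; rewrite -(addrK 1 i); set l := i + 1 => lX.
  have [Y lY] := cokernel_ex (cdiff P l).
  have [p [k [p' [ps kE ki ps' kp']]]] := cokernel_ses aP lY lX.
  apply: (orth_shift ki ps' kp'); first exact: orthWQ.
  move=> f; have [x|h hE] := Pq q Qq l (comp_map f p).
    by rewrite /= (_ : p _ = 0) ?linear0 //; apply: (inj0 ki); rewrite kE cdiffK.
  by exists h => x; have [y <-] := ps x; rewrite kE hE.
- move: iX; rewrite -(addrK 1 i); set l := i + 1 => lX.
  have [Y lY] := cokernel_ex (cdiff P l).
  have [p [k [p' [ps kE ki ps' kp']]]] := cokernel_ses aP lY lX.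
  by exists (P (l - 1 - 1)), Y; split=> //; [exists l | exists k, p'].
have [Y iY] := cokernel_ex (cdiff P (i - 1)).
have [p [k [p' [ps kE ki ps' kp']]]] := cokernel_ses aP iX iY.
by exists (P (i - 1 - 1)), Y; split=> //; [exists (i - 1) | exists k, p'].
Qed.

End Projective.

Lemma ginj_gor G : gorenstein_injective G <->
  gor (E := mod_op_exact R) (@injective_module R) (@orthi R)
      (@injective_module R) (@injective_module R) G.
Proof.
split=> [[P [PW aP Pq [j jG]]]|gG].
  exists (fun X => exists i, is_kernel (cdiff P i) X); split; last by exists j.
  move=> {jG} X [i iX]; split.
  - move=> q Qq; have [Y iY] := kernel_ex (cdiff P (i - 1)).
    have [k [p [k' [kE ki' ke' ki [ps kp]]]]] := kernel_ses aP iX iY.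
    apply: (orthi_shift ki ps kp); first exact: orthi_inj.
    move=> f; have [x|h hE] := Pq q Qq i (comp_map k' f).
      by apply/ke'; exists (f x).
    by exists h => x; apply: ki'; rewrite kE hE.
  - have [Y iY] := kernel_ex (cdiff P (i - 1)).
    have [k [p [k' [kE ki' ke' ki [ps kp]]]]] := kernel_ses aP iX iY.
    by exists (P i), Y; split=> //; [exists (i - 1) | exists k, p].
  move: iX; rewrite -(addrK 1 i); set l := i + 1 => lX.
  have [Y lY] := kernel_ex (cdiff P l).
  have [k [p [k' [kE ki' ke' ki [ps kp]]]]] := kernel_ses aP lY lX.
  by exists (P l), Y; split=> //; [exists l | exists k, p].
pose S := gor (E := mod_op_exact R) (@injective_module R) (@orthi R)
  (@injective_module R) (@injective_module R).
have [||P [Z [k [p [kp dE ZW ZG]]]]] := @splice R S (@injective_module R) _ _ G 0 gG.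
- by move=> X /gor_post[].
- by move=> X /gor_post[].
exists P; split; first by move=> i; case: (ZW i).
- exact: spliced_acyclic kp dE.
- move=> E Ei i f fd.
  have [[k1i _ k1p] [k0i p0s k0p]] := (kp (i - 1), kp i).
  have [|f' f'E] := factor_inj (k := k (i - 1)) (f := f) k1i.
    by move=> x; apply/k1p; apply: (inj0 (f := k (i - 1 - 1))); [case: (kp (i - 1 - 1)) | rewrite -dE].
  have oZ : orthi (Z i) E by have [/gor_post[o _ _] _] := ZW i; apply: o.
  have [h hE] := oZ _ _ _ _ k0i p0s k0p f'.
  by exists h => x; rewrite dE hE f'E.
rewrite -ZG; exists 0, (k 0); have [[ki _ ex] [k1i _ _]] := (kp 0, kp (0 - 1)).
split=> // y; rewrite dE -ex; split=> [/(inj0 k1i) //|->].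
exact: linear0.
Qed.

Lemma proj_setup : gor_setup (E := mod_exact R) (@projective_module R)
  (@projective_module R) (@orth R).
Proof.
have ext A B C : ses A B C -> projective_module A -> projective_module C -> projective_module B.
  move=> s Ap Cp; have [f [fi fs]] := proj_split Cp s.
  by have [g [fK _]] := iso_inv fi fs; apply: (proj_retract fK); apply: proj_sum.
split=> //.
- move=> A B C s Bp Cp; have [f [fi fs]] := iso_sym (proj_split Cp s).
  have [g [fK _]] := iso_inv fi fs.
  apply: (@proj_retract _ _ _ (comp_map f (inl_map A C)) (comp_map (fst_map A C) g)) => //.
  by move=> x /=; rewrite fK.
- exact: proj_sum.
- move=> w wp; exists w, (zero_module R); split=> //; last exact: ses_zero_r.
  exact: zero_projective.
- by move=> w t wp _; apply: orth_proj.
- by move=> A B C t; apply: orth_ses.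
- by move=> A B t; apply: orth_sum_l.
- by move=> X t Y; apply: orth_split_iso.
Qed.

Lemma inj_setup : gor_setup (E := mod_op_exact R) (@injective_module R)
  (@injective_module R) (@orthi R).
Proof.
split=> //.
- move=> A B C s Ai Ci; have i := inj_module_split Ci s.
  by apply: (inj_iso (iso_sym i)); apply: inj_sum.
- move=> A B C s Bi Ci; have [f [fi fs]] := iso_sym (inj_module_split Ci s).
  have [g [fK _]] := iso_inv fi fs.
  apply: (@inj_retract _ _ _ (comp_map f (inr_map C A)) (comp_map (snd_map C A) g)) => //.
  by move=> x /=; rewrite fK.
- exact: inj_sum.
- move=> w wp; exists w, (zero_module R); split=> //; last exact: ses_zero_l.
  exact: zero_injective.
- by move=> w t wp _; apply: orthi_inj.
- by move=> A B C t; apply: orthi_ses.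
- by move=> A B t; apply: orthi_sum.
- by move=> X t Y; apply: orthi_split_iso.
Qed.

Lemma flat_iso A B : iso A B -> flat_module A -> flat_module B.
Proof.
move=> [f [fi fs]] /flat_dual Ai; apply/flat_dual; apply: inj_iso Ai.
have [g [fK gK]] := iso_inv fi fs.
exists (dual_map g); split; first by apply: dual_map_inj => x; exists (f x).
by apply: dual_map_surj; apply: can_inj gK.
Qed.

(** Through [flat_dual], closure properties of flat modules become properties of injective ones: a
    dual sequence that starts in an injective module splits. *)
Lemma flat_ext A B C : ses A B C -> flat_module A -> flat_module C -> flat_module B.
Proof.
move=> /dual_ses s /flat_dual Ai /flat_dual Ci; apply/flat_dual.
by apply: (inj_iso (iso_sym (inj_module_split Ci s))); apply: inj_sum.
Qed.

Lemma flat_ker A B C : ses A B C -> flat_module B -> flat_module C -> flat_module A.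
Proof.
move=> /dual_ses s /flat_dual Bi /flat_dual Ci; apply/flat_dual.
have [f [fi fs]] := iso_sym (inj_module_split Ci s); have [g [fK _]] := iso_inv fi fs.
apply: (@inj_retract _ _ _ (comp_map f (inr_map (dual C) (dual A)))
  (comp_map (snd_map (dual C) (dual A)) g)) => //.
by move=> x /=; rewrite fK.
Qed.

Lemma flat_proj P : projective_module P -> flat_module P.
Proof. by move=> Pp; apply/flat_dual/proj_dual_inj. Qed.

Lemma flat_summand A B : flat_module (dirsum A B) -> flat_module A.
Proof.
move=> /flat_dual ABi; apply/flat_dual.
apply: (@inj_retract _ _ _ (dual_map (fst_map A B)) (dual_map (inl_map A B))) => //.
by move=> c; apply: charP.
Qed.

Lemma flat_resolving : resolving (E := mod_exact R) (@flat_module R).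
Proof.
split; [exact: flat_proj | exact: flat_iso | exact: flat_ext | exact: flat_ker |].
exact: flat_summand.
Qed.

(* The dual of a short exact sequence ending in a flat module splits. *)
Lemma orth_flat_dual F E : flat_module F -> orth F (dual E).
Proof.
move=> /flat_dual Fi K Y k g ki gs kg f.
have [r rK] := Fi _ _ (dual_map g) (id_map (dual F)) (dual_map_inj gs).
have [s sE] : exists s : {linear dual K -> dual Y}, forall c,
    s (dual_map k c) = add_map (id_map _) (opp_map (comp_map (dual_map g) r)) c.
  apply: factor_surj; first exact: dual_map_surj.
  move=> c ck; have [x /kg[y <-]|d dE] := @char_factor _ _ _ g c.
    exact: (congr1 (fun h : dual K => h y) ck).
  have -> : c = dual_map g d by apply: charP => x; rewrite -dE.
  by rewrite /= rK subrr.
exists (dual_swap (comp_map s (dual_swap f))) => x; apply: charP => e.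
have [c cE] := dual_map_surj ki (dual_swap f e).
rewrite -[LHS]/(s (dual_swap f e) (k x)) -[RHS]/(dual_swap f e x) -cE sE.
rewrite -[LHS]/(c (k x) + - (r c) (g (k x))).
have -> : g (k x) = 0 by apply/kg; exists x.
by rewrite char0 subr0.
Qed.

(* Over a noetherian ring this class contains [dual E] for [E] injective, and
   so detects the same orthogonal; unlike these duals, it is visibly closed
   under direct sums. *)
Definition flat_cotorsion T := flat_module T /\
  forall X, (forall E, injective_module E -> orth X (dual E)) -> orth X T.

Section Noetherian.
Hypothesis Rn : noetherian R.

Lemma flat_dual_inj E : injective_module E -> flat_module (dual E).
Proof. by move=> Ei; apply/flat_dual/bidual_injective. Qed.

(** The dual of [bidual F] is split by [bidual (dual F)], so [dual L] is a retract of the triple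
    dual of [F]. The latter is injective because the double dual of [F] is flat, which is where
    noetherianity enters. *)
Lemma flat_bidual F : flat_module F ->
  exists L, flat_module L /\ ses F (dual (dual F)) L.
Proof.
move=> /flat_dual Fi; have [L [q [qs qE]]] := quotient_ex (im_submod (bidual F)).
have qe : exact_at 0 (bidual F) q by [].
have /flat_dual FFi := flat_dual_inj Fi.
exists L; split; last by exists (bidual F), q; split=> //; apply: bidual_inj.
apply/flat_dual; pose s := bidual (dual F : lmodType R).
have [r rE] : exists r : {linear dual (dual (dual F)) -> dual L}, forall c,
    dual_map q (r c) = add_map (id_map _) (opp_map (comp_map s (dual_map (bidual F)))) c.
  apply: factor_inj; first exact: dual_map_inj.
  move=> c /=; have [x /qe[y <-]|d dE] := @char_factor _ _ _ q
      (c - s (dual_map (bidual F) c)).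
    by rewrite -[LHS]/(c (bidual F y) - c (bidual F y)) subrr.
  by exists d; apply: charP => x; rewrite -dE.
apply: (inj_retract (i := dual_map q) (p := r)) FFi => c.
apply: (dual_map_inj qs); rewrite rE; apply: charP => x.
rewrite -[LHS]/(c (q x) - x (dual_map (bidual F) (dual_map q c))).
have -> : dual_map (bidual F) (dual_map q c) = 0.
  apply: charP => y; rewrite -[LHS]/(c (q (bidual F y))).
  by rewrite (proj2 (qe _)) ?char0 //; exists y.
by rewrite char0 subr0.
Qed.

Lemma flat_setup : gor_setup (E := mod_exact R) (@flat_module R) flat_cotorsion (@orth R).
Proof.
split.
- exact: flat_ext.
- exact: flat_ker.
- exact: flat_proj.
- by move=> t [].
- move=> t u [tf to] [uf uo]; split; first exact: flat_ext (ses_sumr t u) _ _.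
  by move=> X oX; apply: orth_sum_r; [apply: to | apply: uo].
- move=> w wf; have [L [Lf s]] := flat_bidual wf; have /flat_dual wi := wf.
  exists (dual (dual w) : lmodType R), L; split=> //; split; first exact: flat_dual_inj.
  by move=> X; apply.
- by move=> w t wf [_]; apply=> E _; apply: orth_flat_dual.
- by move=> A B C t; apply: orth_ses.
- by move=> A B t; apply: orth_sum_l.
- by move=> X t Y; apply: orth_split_iso.
Qed.

(** By [acyclic_tensor], tensoring with an injective [E] is tested by [Hom] into [dual E]. These
    duals form [Q], which has the same left orthogonal as [flat_cotorsion]. *)
Lemma gflat_resolving : resolving (E := mod_exact R) (@gorenstein_flat R).
Proof.
pose Q (q : lmodType R) := exists2 E : lmodType R, injective_module E & q = dual E.
have -> : @gorenstein_flat R =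
    gor (E := mod_exact R) flat_cotorsion (@orth R) (@flat_module R) (@flat_module R).
  apply/funext => G; apply/propext.
  have [||g1 g2] := gor_cokernel (W := @flat_module R) (T := flat_cotorsion) (Q := Q) _ _ G.
  - by move=> w _ wf [E _ ->]; apply: orth_flat_dual.
  - move=> X; split=> [oT _ [E Ei ->]|oQ t [_ to]].
      by apply: oT; split=> [|Y]; [apply: flat_dual_inj | apply].
    by apply: to => E Ei; apply: oQ; exists E.
  split=> [[P [Pf aP Pq jG]]|/g1[P [Pf aP Pq jG]]].
    by apply: g2; exists P; split=> // _ [E Ei ->]; apply/acyclic_tensor/Pq.
  by exists P; split=> // E Ei; apply/acyclic_tensor/Pq; exists E.
exact: gor_resolving flat_setup.
Qed.

End Noetherian.

Lemma gproj_resolving : resolving (E := mod_exact R) (@gorenstein_projective R).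
Proof.
have -> : @gorenstein_projective R = gor (E := mod_exact R) (@projective_module R)
    (@orth R) (@projective_module R) (@projective_module R).
  apply/funext => G; apply/propext.
  have [||g1 g2] := gor_cokernel (W := @projective_module R) (T := @projective_module R) (Q := @projective_module R) _ _ G => //.
  by move=> w q wp _; apply: orth_proj.
exact: gor_resolving proj_setup.
Qed.

Lemma ginj_resolving : resolving (E := mod_op_exact R) (@gorenstein_injective R).
Proof.
have -> : @gorenstein_injective R = gor (E := mod_op_exact R) (@injective_module R)
    (@orthi R) (@injective_module R) (@injective_module R).
  by apply/funext => G; apply/propext/ginj_gor.
exact: gor_resolving inj_setup.
Qed.

Lemma resolution_dimle (C : lmodType R -> Prop) n N :
  (forall A B, iso A B -> C A -> C B) ->
  has_resolution C n N -> dimle (E := mod_exact R) C n N.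
Proof.
move=> Ci; elim: n N => [|n IH] N [X [d [e [es de dd CX X0]]]].
  apply: (Ci (X 0%N)) (CX 0%N isT); exists e; split=> //; apply: linear_inj0 => x /de[y <-].
  by rewrite (X0 1%N isT y) linear0.
have [K [k [ki kE]]] := submodule_ex (ker_submod e).
have [e' e'E] : exists e' : {linear X 1%N -> K}, forall x, k (e' x) = d 0%N x.
  by apply: factor_inj => // x; apply/kE/de; exists x.
exists K, (X 0%N); split; [exact: CX | by exists k, e | apply: IH].
exists (fun i => X i.+1), (fun i => d i.+1), e'; split.
- move=> y; have /de[x xE] : e (k y) = 0 by apply/kE; exists y.
  by exists x; apply: ki; rewrite e'E.
- move=> y; rewrite -dd -e'E; split=> [->|]; first exact: linear0.
  exact: inj0.
- by move=> i; apply: dd.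
- by move=> i; apply: (CX i.+1).
- by move=> i; apply: (X0 i.+1).
Qed.

Lemma coresolution_dimle (C : lmodType R -> Prop) n N :
  (forall A B, iso A B -> C A -> C B) ->
  has_coresolution C n N -> dimle (E := mod_op_exact R) C n N.
Proof.
move=> Ci; elim: n N => [|n IH] N [X [d [e [ei de dd CX X0]]]].
  apply: (Ci (X 0%N)) (CX 0%N isT); apply: iso_sym; exists e; split=> // x.
  by apply/de; apply: X0.
have [K [k [ks kE]]] := quotient_ex (im_submod e).
have [e' e'E] : exists e' : {linear K -> X 1%N}, forall x, e' (k x) = d 0%N x.
  by apply: factor_surj => // x /kE/de.
exists K, (X 0%N); split; [exact: CX | by exists e, k | apply: IH].
exists (fun i => X i.+1), (fun i => d i.+1), e'; split.
- apply: linear_inj0 => y; have [x <-] := ks y; rewrite e'E => /de xe.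
  exact/kE.
- move=> y; rewrite dd; split=> [[x <-]|[x <-]]; first by exists (k x).
  by have [z <-] := ks x; exists z; rewrite e'E.
- by move=> i; apply: dd.
- by move=> i; apply: (CX i.+1).
- by move=> i; apply: (X0 i.+1).
Qed.

End GorensteinComplexes.

(** * Levels in the derived category *)

Section Derived.
Variable R : comPzRingType.
Implicit Types X Y Z K M N : complex R.
Implicit Types V W : int -> lmodType R.

Lemma diso_refl X : disomorphic X X.
Proof. by exists (did X), (did X); split; apply: dmor_idl. Qed.

Lemma diso_sym X Y : disomorphic X Y -> disomorphic Y X.
Proof. by move=> [u [v [vu uv]]]; exists v, u. Qed.

Lemma dcomp_cancel X Y Z (u : dmor X Y) (u' : dmor Y X) (v : dmor Y Z) (v' : dmor Z Y) :
  dmor_eq (dcomp u' u) (did X) -> dmor_eq (dcomp v' v) (did Y) ->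
  dmor_eq (dcomp (dcomp u' v') (dcomp v u)) (did X).
Proof.
move=> uu vv; apply: dmor_trans (dmor_assoc _ _ _) _; apply: dmor_trans uu.
apply: dmor_cong (dmor_refl u); apply: dmor_trans (dmor_sym (dmor_assoc _ _ _)) _.
apply: dmor_trans (dmor_idr u'); exact: dmor_cong (dmor_refl u') vv.
Qed.

Lemma diso_trans X Y Z : disomorphic X Y -> disomorphic Y Z -> disomorphic X Z.
Proof.
move=> [u [u' [uu uu']]] [v [v' [vv vv']]]; exists (dcomp v u), (dcomp u' v').
by split; apply: dcomp_cancel.
Qed.

Lemma diso_qiso X Y (f : chain_map X Y) : quasi_iso f -> disomorphic X Y.
Proof.
by move=> qf; exists (dmap f), (dinv qf); split; [apply: dmor_invl | apply: dmor_invr].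
Qed.

(** In degree [i - 1] the boundaries are literally the values of [cdiff X i]. *)
Lemma quasi_iso_pred X Y (f : chain_map X Y) :
  (forall i (x : X (i - 1)), cdiff X (i - 1) x = 0 ->
     (exists y, cdiff Y i y = f (i - 1) x) -> exists x', cdiff X i x' = x) ->
  (forall i (y : Y (i - 1)), cdiff Y (i - 1) y = 0 ->
     exists x, cdiff X (i - 1) x = 0 /\ exists w, cdiff Y i w = y - f (i - 1) x) ->
  quasi_iso f.
Proof.
move=> inj srj; apply/quasi_isoP => i; rewrite -(addrK 1 i); set j := i + 1; split.
  by move=> x dx /boundary_pred b; apply/boundary_pred/inj.
by move=> y /srj[x [dx w]]; exists x => //; apply/boundary_pred.
Qed.

Lemma iso_quasi_iso X Y (f : chain_map X Y) :
  (forall i, injective (f i)) -> (forall i, surj (f i)) -> quasi_iso f.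
Proof.
move=> fi fs; apply: quasi_iso_pred => i x dx.
  move=> [y]; have [z <-] := fs i y; rewrite -cmapP => /fi <-.
  by exists z.
have [z zx] := fs _ x; exists z; split.
  by apply: (fi _); rewrite cmapP zx dx linear0.
by exists 0; rewrite zx subrr linear0.
Qed.

Lemma quasi_iso_comp X Y Z (g : chain_map Y Z) (f : chain_map X Y) :
  quasi_iso f -> quasi_iso g -> quasi_iso (chain_comp g f).
Proof.
move=> qf qg i; apply: (eq_bij (bij_comp (qg i) (qf i))) => x /=.
by rewrite -(hclassK x) !homology_mapE; congr hclass; apply: val_inj.
Qed.

Lemma csum_proj_subproof X Y i (p : csum X Y i) :
  snd_map (X (i - 1)) (Y (i - 1)) (cdiff (csum X Y) i p) = cdiff Y i (snd_map (X i) (Y i) p).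
Proof. by []. Qed.
Definition csum_proj X Y : chain_map (csum X Y) Y := ChainMap (@csum_proj_subproof X Y).

Lemma csum_proj_qiso Y : quasi_iso (csum_proj (zero_complex R) Y).
Proof.
have z i (x : zero_complex R i) : x = 0.
  by case: i x => [[|n]|n] x; rewrite [LHS]zero_moduleP [RHS]zero_moduleP.
apply: iso_quasi_iso => i.
  by move=> [a b] [c d] /= ->; rewrite (z _ a) (z _ c).
by move=> y; exists (0, y).
Qed.

Lemma is_diso_did X : is_diso (did X).
Proof. by exists (did X); split; apply: dmor_idl. Qed.

Lemma dshift_did X Y (w : dmor Y (shift X)) : dmor_eq (dcomp (dshift (did X)) w) w.
Proof.
apply: dmor_trans (dmor_idl w); apply: dmor_cong (dmor_refl w).
exact: dmor_map.
Qed.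

(** The summand [L] is taken to be zero. [M] enters only through an isomorphism of
    [csum (zero_complex R) M] with [X], along which the standard triangle of [f] is transported. *)
Lemma thick_cone (C : complex R -> Prop) n K M X (f : chain_map K X) :
  disomorphic M X -> thick1 C K -> thick C n.+1 (cone f) -> thick C n.+2 M.
Proof.
move=> MX CK tf; exists K, (zero_complex R), (cone f); split=> //.
have [b [b' [bb bb']]] := diso_trans (diso_qiso (@csum_proj_qiso M)) MX.
exists (dcomp b' (dmap f)), (dcomp (dmap (cone_incl f)) b), (dmap (cone_proj f)).
exists K, X, f, (did K), b, (did _); split.
  by split; [apply: is_diso_did | exists b' | apply: is_diso_did].
split.
- apply: dmor_trans (dmor_assoc _ _ _) _; apply: dmor_trans _ (dmor_sym (dmor_idr _)).
  by apply: dmor_trans (dmor_idl _); apply: dmor_cong (dmor_refl _).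
- exact: dmor_idl.
- by apply: dmor_trans (dshift_did _) _; apply: dmor_sym; apply: dmor_idr.
Qed.

Lemma zcomplex_subproof V i (x : V i) : zero_map (V (i - 1)) (V (i - 1 - 1)) (zero_map (V i) (V (i - 1)) x) = 0.
Proof. by []. Qed.
Definition zcomplex V : complex R := @Complex R V (fun i => zero_map _ _) (@zcomplex_subproof V).

Lemma diso_zdiff X Y : (forall i x, cdiff X i x = 0) -> (forall i x, cdiff Y i x = 0) ->
  (forall i, iso (X i) (Y i)) -> disomorphic X Y.
Proof.
move=> dX dY XY; have [f fP] := dep_choice XY.
have fc i x : f (i - 1) (cdiff X i x) = cdiff Y i (f i x) by rewrite dX dY linear0.
apply: (@diso_qiso _ _ (ChainMap fc)).
by apply: iso_quasi_iso => i; [apply: (fP i).1 | apply: (fP i).2].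
Qed.

Section ThickZcomplex.
Variable C : lmodType R -> Prop.
Hypothesis C0 : C (zero_module R).
Notation tC := (thick1 (as_complexes C)).

(** Induction on the degree: a positive degree is lowered by writing the complex as a shift, a
    negative one is raised by [thick1_desuspend]. *)
Lemma thick1_conc a V : C (V a) -> (forall i, i != a -> is_zero_module (V i)) ->
  tC (zcomplex V).
Proof.
have isoeq (U : int -> lmodType R) i j : i = j -> iso (U i) (U j) by move=> ->; apply: iso_refl.
elim/int_rec: a V => [|n IH|n IH] V Ca Vz.
- apply: (@thick1_iso _ _ (stalk (V 0))); last by apply: thick1_in; exists (V 0).
  apply: diso_zdiff => // -[[|n]|n]; first exact: iso_refl.
    by apply: zero_module_iso; [apply: zero_moduleP | apply: Vz].
  by apply: zero_module_iso; [apply: zero_moduleP | apply: Vz].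
- apply: (@thick1_iso _ _ (shift (zcomplex (fun i => V (i + 1))))).
    apply: diso_zdiff => // i; first by move=> x; rewrite /= oppr0.
    by apply: (isoeq V (i - 1 + 1)); rewrite subrK.
  apply/thick1_shift/IH; first by rewrite -PoszD addn1.
  by move=> i ne; apply: Vz; rewrite -addn1 PoszD (inj_eq (addIr 1)).
- apply: thick1_desuspend; apply: (@thick1_iso _ _ (zcomplex (fun i => V (i - 1)))).
    apply: diso_zdiff => // i; first by move=> x; rewrite /= oppr0.
    exact: iso_refl.
  apply: IH; first by rewrite -opprD -PoszD addn1.
  by move=> i ne; apply: Vz; rewrite -addn1 PoszD opprD (inj_eq (addIr _)).
Qed.

Lemma thick1_zcomplex (s : seq int) V : (forall i, C (V i)) ->
  (forall i, i \notin s -> is_zero_module (V i)) -> tC (zcomplex V).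
Proof.
have z0 := @zero_moduleP R.
elim: s V => [|a s IH] V CV Vz.
  apply: (@thick1_iso _ _ (zero_complex R)); last exact: thick1_zero.
  apply: diso_zdiff => // i; apply: zero_module_iso; last exact: Vz.
  by case: i => [[|n]|n].
pose V1 i := if i == a then V i else zero_module R.
pose V2 i := if i == a then zero_module R else V i.
apply: (@thick1_iso _ _ (csum (zcomplex V1) (zcomplex V2))).
  apply: diso_zdiff => // i; rewrite /= /V1 /V2; case: eqP => _.
    exists (fst_map (V i) (zero_module R)); split=> [[x y] [z t] /= ->|x]; last by exists (x, 0).
    by rewrite (z0 y) (z0 t).
  exists (snd_map (zero_module R) (V i)); split=> [[x y] [z t] /= ->|x]; last by exists (0, x).
  by rewrite (z0 x) (z0 z).
apply: thick1_sum.
  by apply: (@thick1_conc a); rewrite /V1 ?eqxx // => i /negbTE->.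
apply: IH => i; rewrite /V2; first by case: eqP.
by move=> si; case: eqP => // /eqP ia; apply: Vz; rewrite inE negb_or ia.
Qed.

Lemma thick1_zcomplex_range (n : int) V : (forall i, C (V i)) ->
  (forall i : int, n < `|i| -> is_zero_module (V i)) -> tC (zcomplex V).
Proof.
(* The bound [n] may be negative, hence the absolute value. *)
move=> CV Vz; pose m := `|n|%N.
apply: (@thick1_zcomplex ([seq k%:Z | k <- iota 0 m.+1] ++ [seq - k%:Z | k <- iota 0 m.+1])) => //.
move=> i; rewrite mem_cat => ni; apply: Vz; rewrite ltNge; apply: contra ni => ni.
have im : (`|i| <= m)%N by rewrite -lez_nat abszE (le_trans ni) // abszE ler_norm.
have [i0|i0] := leP 0 i; apply/orP; [left|right]; apply/mapP; exists `|i|%N.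
- by rewrite mem_iota.
- by rewrite gez0_abs.
- by rewrite mem_iota.
- by rewrite ltz0_abs // opprK.
Qed.

End ThickZcomplex.
End Derived.

(** * Classes defined by left resolutions *)

Lemma add_eq0_opp (V : zmodType) (x y : V) : x + y = 0 -> y = - x.
Proof. by move/eqP; rewrite addrC addr_eq0 => /eqP. Qed.

Section Homology.
Variable R : comPzRingType.
Implicit Types X Y M : complex R.

Lemma hclass_linear X i : linear (@hclass R X i).
Proof. by move=> a x y; rewrite hclassD -hscaleE. Qed.
Definition hclass_map X i : {linear cycle X i -> homology X i} := mk_linear (@hclass_linear X i).

Lemma hclass_surj X i : surj (@hclass_map X i).
Proof. by move=> x; exists (repr x); apply: hclassK. Qed.

Lemma hclass_eq0 X i (z : cycle X i) : hclass_map X i z = 0 <-> boundary (val z).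
Proof. by rewrite -[0](linear0 (hclass_map X i)) hclassP subr0. Qed.

Lemma homology0 X i (x : X i) : is_zero_module (homology X i) -> cdiff X i x = 0 -> boundary x.
Proof.
move=> H0 dx; have xc : x \in cycle_pred X i by rewrite inE dx.
by have /hclass_eq0 := H0 (hclass_map X i (Cycle xc)).
Qed.

Definition cycle_val_map X i : {linear cycle X i -> X i} := (val : {linear cycle X i -> X i}).

Lemma lift_cycle (V : lmodType R) X i (f : {linear V -> X i}) :
  (forall x, cdiff X i (f x) = 0) -> exists g : {linear V -> cycle X i}, forall x, val (g x) = f x.
Proof.
move=> fc; apply: (@factor_inj _ _ _ _ (cycle_val_map X i)); first exact: val_inj.
move=> x; have xc : f x \in cycle_pred X i by rewrite inE fc.
by exists (Cycle xc).
Qed.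

End Homology.

Section Left.
Variables (R : comPzRingType) (C : lmodType R -> Prop).
Notation modE := (mod_exact R).
Hypothesis rC : resolving (E := modE) C.
Implicit Types M X : complex R.
Implicit Types P V : int -> lmodType R.

Let C0 : C (zero_module R).
Proof.
have [K [P [pP _]]] := proj_cover (zero_module R).
exact: (@res_zero modE C rC P (res_proj rC pP)).
Qed.

(** Surjectivity of [f] on homology cuts the long exact sequence of the cone into short ones. Since
    [zcomplex P] is its own homology, the homology of the cone consists of syzygies of that of
    [M]. *)
Lemma cone_homology_ses M P (f : chain_map (zcomplex P) M) i :
  (forall i (m : M i), cdiff M i m = 0 -> exists p, boundary (m - f i p)) ->
  ses (homology (cone f) (i - 1)) (P (i - 1 - 1)) (homology M (i - 1 - 1)).
Proof.
move=> fs; pose N := cone f.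
have [al alE] : exists al : {linear homology N (i - 1) -> P (i - 1 - 1)},
    forall z, al (hclass_map N (i - 1) z) = (val z).2.
  apply: (factor_surj (f := comp_map (snd_map (M (i - 1)) (P (i - 1 - 1))) (cycle_val_map N (i - 1)))).
    exact: hclass_surj.
  by move=> z /hclass_eq0/boundary_pred[[m p] /= <-]; rewrite oppr0.
have [g gE] := @lift_cycle _ _ _ _ (f (i - 1 - 1)) (fun x => etrans (esym (cmapP f x)) (linear0 _)).
exists al, (comp_map (hclass_map _ _) g); split.
- apply: linear_inj0 => x; have [z <-] := hclass_surj x; rewrite alE => z2.
  apply/hclass_eq0/boundary_pred; have := cycleP z; move: z2.
  case: (val z) => m p /= -> [].
  rewrite linear0 addr0 => /fs[q] /boundary_pred[w wE] _.
  by exists (w, q); rewrite /= wE subrK oppr0.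
- move=> x; have [z <-] := hclass_surj x; have [p b] := fs _ _ (cycleP z).
  exists p; apply/(hclassP (g p) z); rewrite gE -(opprB (val z) (f _ p)); exact/boundaryN.
move=> p; rewrite [X in X = 0]/= -[hclass _]/(hclass_map M _ (g p)) hclass_eq0 gE; split.
  move=> /boundary_pred[m mE].
  have zc : ((- m, p) : N (i - 1)) \in cycle_pred N (i - 1).
    by rewrite inE; apply/eqP; congr (_, _); rewrite /= ?oppr0 // linearN mE addNr.
  by exists (hclass_map N _ (Cycle zc)); rewrite alE.
move=> [x]; have [z <-] := hclass_surj x; rewrite alE => <-.
have := cycleP z; case: (val z) => m q /= [] /add_eq0_opp-> _; rewrite -linearN; exact: Boundary.
Qed.

Definition dim_bounded n M :=
  (forall i, dimle (E := modE) C n (homology M i)) /\ bounded_homology M.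

Lemma thick_step n k M : (forall N, dim_bounded k N -> thick (as_complexes C) n.+1 N) ->
  dim_bounded k.+1 M -> thick (as_complexes C) n.+2 M.
Proof.
move=> IH [dM [b bM]].
have cov i : exists (P : lmodType R) (p : {linear P -> M i}),
    [/\ projective_module P, forall x, cdiff M i (p x) = 0,
        forall m, cdiff M i m = 0 -> exists x, boundary (m - p x)
      & is_zero_module (homology M i) -> is_zero_module P].
  (* Where the homology vanishes the cover must be zero, because [thick1] only allows finite
     sums. *)
  have [H0|nH] := pselect (is_zero_module (homology M i)).
    exists (zero_module R), (zero_map _ _); split=> //=.
    - exact: zero_projective.
    - by move=> _; apply: linear0.
    - by move=> m dm; exists 0; rewrite subr0; apply: homology0.
    - by move=> _; apply: zero_moduleP.
  have [K [P [pP [k' [g [_ gs _]]]]]] := proj_cover (cycle M i : lmodType R).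
  exists P, (comp_map (cycle_val_map M i) g); split=> //=.
    by move=> x; apply: cycleP.
  move=> m dm; have mc : m \in cycle_pred M i by rewrite inE dm.
  by have [x xE] := gs (Cycle mc); exists x; rewrite /= xE subrr; apply: boundary0.
have [P /dep_choice[p pE]] := choice cov.
have fc i (x : zcomplex P i) : p (i - 1) (cdiff (zcomplex P) i x) = cdiff M i (p i x).
  by rewrite [RHS](let: And4 _ h _ _ := pE i in h x) linear0.
pose f := ChainMap (X := zcomplex P) fc.
have fs i (m : M i) : cdiff M i m = 0 -> exists p, boundary (m - f i p).
  by case: (pE i) => _ _ h _; apply: h.
apply: (thick_cone (f := f) (diso_refl M)).
  apply: (thick1_zcomplex_range C0 (n := b)) => i.
    by have [pP _ _ _] := pE i; apply: (res_proj rC).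
  by move=> /bM H0; have [_ _ _] := pE i; apply.
apply: IH; split.
  move=> i; rewrite -(addrK 1 i); set j := i + 1.
  apply: (@dimle_syzygy modE C rC k _ _ _ _ (cone_homology_ses j fs)); last exact: dM.
  by case: (pE (j - 1 - 1)).
(* The cone moves the syzygies by one degree. *)
exists (b + 1) => i bi; rewrite -(addrK 1 i); set j := i + 1.
have [a [_ [ai _ _]]] := cone_homology_ses j fs.
have H0 : is_zero_module (P (j - 1 - 1)).
  have [_ _ _] := pE (j - 1 - 1); apply; apply: bM; rewrite /j addrK.
  by rewrite -(ltrD2r 1) (lt_le_trans bi) // -{1}[i](subrK 1) ler_normD.
by move=> x; apply: ai; rewrite (H0 (a x)) (H0 (a 0)).
Qed.

End Left.

(** * Projective resolutions of complexes *)

Section ProjectiveResolution.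
Variables (R : comPzRingType) (M : complex R) (i0 : int).
Hypothesis M0 : forall i, i <= i0 -> is_zero_module (homology M i).

(* The degree [i] part of a projective resolution of [M]: the projective
   module, its map to [M i], and its submodule of cycles. *)
Record pres_state (i : int) := PresState {
  ps_proj : lmodType R; ps_cyc : lmodType R;
  ps_in : {linear ps_cyc -> ps_proj}; ps_map : {linear ps_proj -> M i};
  ps_inj : injective ps_in;
  ps_projP : projective_module ps_proj;
  ps_cycP : forall z, cdiff M i (ps_map (ps_in z)) = 0;
  ps_surj : forall m, cdiff M i m = 0 -> exists z, boundary (m - ps_map (ps_in z));
  ps_zero : i <= i0 -> is_zero_module ps_proj
}.

(** The differential is [d] followed by the inclusion of cycles. Its image is all cycles whose image
    in [M] bounds, which gives injectivity on homology; surjectivity is [ps_surj]. *)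
Definition pres_rel i (s' : pres_state (i - 1)) (s : pres_state i) :=
  exists d : {linear ps_proj s -> ps_cyc s'},
  [/\ exact_at 0 (ps_in s) d,
      forall z, (exists x, d x = z) <-> (exists m, cdiff M i m = ps_map s' (ps_in s' z))
    & forall x, ps_map s' (ps_in s' (d x)) = cdiff M i (ps_map s x)].

(** In these degrees every cycle of [M] bounds, so the zero module is enough even where [M] is not
    zero. *)
Lemma zero_state i : i <= i0 -> exists s : pres_state i,
  is_zero_module (ps_proj s) /\ is_zero_module (ps_cyc s).
Proof.
move=> ii; pose Z := zero_module R.
have ki : injective (id_map Z) by [].
have pP : projective_module Z by exact: zero_projective.
have cP z : cdiff M i (zero_map Z (M i) (id_map Z z)) = 0 by apply: linear0.
have sP m : cdiff M i m = 0 -> exists z, boundary (m - zero_map Z (M i) (id_map Z z)).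
  by move=> dm; exists 0; rewrite subr0; apply: homology0 dm; apply: M0.
exists (PresState ki pP cP sP (fun _ => @zero_moduleP R)).
by split; apply: zero_moduleP.
Qed.

Lemma proj_resolution_ex : exists (P Z : int -> lmodType R)
    (k : forall i, {linear Z i -> P i}) (p : forall i, {linear P i -> M i})
    (d : forall i, {linear P i -> Z (i - 1)}),
  [/\ forall i, [/\ injective (k i), projective_module (P i),
        forall z, cdiff M i (p i (k i z)) = 0,
        forall m, cdiff M i m = 0 -> exists z, boundary (m - p i (k i z))
        & i <= i0 -> is_zero_module (P i)]
    & forall i, [/\ exact_at 0 (k i) (d i),
        forall z, (exists x, d i x = z) <->
          (exists m, cdiff M i m = p (i - 1) (k (i - 1) z))
        & forall x, p (i - 1) (k (i - 1) (d i x)) = cdiff M i (p i x)]].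
Proof.
have [s0 _] := zero_state (lexx i0).
have [||s [_ sR]] := @int_choice pres_state pres_rel i0 s0.
- move=> i s' ii.
  (* [Q] consists of the pairs of a cycle one degree lower and an element of [M i] bounding its
     image; the next term is a projective mapping onto [Q]. *)
  have [Q [a [b [ab ab1 ab2]]]] := pullback_ex (comp_map (ps_map s') (ps_in s')) (cdiff M i).
  have [K [F [Fp [k [q [ki qs kq]]]]]] := proj_cover Q.
  have [Z [l [li lE]]] := submodule_ex (ker_submod (comp_map a q)).
  have cP z : cdiff M i (comp_map b q (l z)) = 0.
    have /= az : comp_map a q (l z) = 0 by apply/lE; exists z.
    by rewrite /= -ab /= az !linear0.
  have sP m : cdiff M i m = 0 -> exists z, boundary (m - comp_map b q (l z)).
    move=> dm; have [|y ay bm] := ab2 0 m; first by rewrite dm linear0.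
    have [x qx] := qs y; have /lE[z zx] : comp_map a q x = 0 by rewrite /= qx.
    by exists z; rewrite zx /= qx bm subrr; apply: boundary0.
  have z0 : i <= i0 -> is_zero_module F by rewrite leNgt ii.
  exists (PresState li Fp cP sP z0), (comp_map a q); split.
  + exact: lE.
  + move=> z; split=> [[x <-]|[m dm]]; first by exists (b (q x)); rewrite -ab.
    have [y ay _] := ab2 _ _ (esym dm).
    by have [x xy] := qs y; exists x; rewrite /= xy.
  + by move=> x; rewrite /= -ab.
- move=> i s ii; have [|s' [z1 z2]] := @zero_state (i - 1).
    by rewrite (le_trans _ ii) // gerBl.
  have z0 : is_zero_module (ps_proj s) by apply: ps_zero.
  exists s', (zero_map _ _); split.
  + by move=> y; split=> // _; exists 0; rewrite (z0 y) linear0.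
  + move=> z; split=> _; first by exists 0; rewrite (z2 z) !linear0.
    by exists 0; rewrite (z2 z).
  + by move=> x; rewrite (z0 x) !linear0.
have [d dP] := dep_choice sR.
exists (fun i => ps_proj (s i)), (fun i => ps_cyc (s i)), (fun i => ps_in (s i)).
exists (fun i => ps_map (s i)), d; split=> i; last exact: dP.
split; [exact: ps_inj | exact: ps_projP | exact: ps_cycP | exact: ps_surj | exact: ps_zero].
Qed.

End ProjectiveResolution.

(** * The case of homology of dimension at most one *)

Section LeftBase.
Variables (R : comPzRingType) (C : lmodType R -> Prop).
Notation modE := (mod_exact R).
Hypothesis rC : resolving (E := modE) C.
Implicit Types M X : complex R.

Lemma int_up_ind (Q : int -> Prop) i0 : (forall i, i <= i0 -> Q i) ->
  (forall i, Q (i - 1) -> Q i) -> forall i, Q i.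
Proof.
move=> Q0 QS i; have [/Q0 //|ii] := leP i i0.
have -> : i = i0 + `|(i - i0)%R|%N%:Z by rewrite gez0_abs ?subrKC // subr_ge0 ltW.
elim: `|_|%N => [|n IH]; first by rewrite addr0; apply: Q0.
by apply: QS; rewrite -addrA -addn1 PoszD addrK.
Qed.

Let C0 : C (zero_module R).
Proof.
have [K [P [pP _]]] := proj_cover (zero_module R).
exact: (@res_zero modE C rC P (res_proj rC pP)).
Qed.

Lemma thick_base M : dim_bounded C 1 M -> thick (as_complexes C) 2 M.
Proof.
move=> [dM [b0 bM0]]; pose b := `|b0|%N%:Z.
have bM (i : int) : b < `|i| -> is_zero_module (homology M i).
  by move=> bi; apply: bM0; apply: le_lt_trans bi; rewrite /b abszE ler_norm.
pose i0 := - (b + 1).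
have ib i : i <= i0 -> b < `|i|.
  move=> ii; apply: (@lt_le_trans _ _ (- i)); last by rewrite -normrN ler_norm.
  by rewrite ltrNr (le_lt_trans ii) // ltrN2 ltrDl.
have M0 i : i <= i0 -> is_zero_module (homology M i) by move=> /ib/bM.
have [P [Z [k [p [d [sP dP]]]]]] := proj_resolution_ex M0.
have dd i x : comp_map (k (i - 1 - 1)) (d (i - 1)) (comp_map (k (i - 1)) (d i) x) = 0.
  have [ex _ _] := dP (i - 1); rewrite /= (proj2 (ex _)) ?linear0 //.
  by exists (d i x).
pose PC := @Complex R P (fun i => comp_map (k (i - 1)) (d i)) dd.
have pc i (x : PC i) : p (i - 1) (cdiff PC i x) = cdiff M i (p i x).
  by have [_ _ e] := dP i; apply: e.
have PM : quasi_iso (ChainMap (X := PC) pc).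
  apply: quasi_iso_pred => i x dx.
    have [k2i _ _ _ _] := sP (i - 1 - 1); have [ex _ _] := dP (i - 1).
    move: dx => /= /(inj0 k2i)/ex[z <-] [m /= mE].
    have [_ imd _] := dP i; have [y yz] : exists y, d i y = z by apply/imd; exists m.
    by exists y; rewrite /= yz.
  have [_ _ cz sz _] := sP (i - 1).
  have [z /boundary_pred[w wE]] := sz _ dx.
  exists (k (i - 1) z); split; last by exists w.
  have [ex _ _] := dP (i - 1); rewrite /= (proj2 (ex _)) ?linear0 //.
  by exists z.
have im_ex i : exists (I : lmodType R) (u : {linear I -> Z (i - 1)}) (v : {linear P i -> I}),
    [/\ injective u, surj v & forall x, u (v x) = d i x].
  have [I [u [ui uE]]] := submodule_ex (im_submod (d i)).
  have [v vE] : exists v : {linear P i -> I}, forall x, u (v x) = d i x.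
    by apply: factor_inj => // x; apply/uE; exists x.
  exists I, u, v; split=> // y; have [x xy] : exists x, d i x = u y by apply/uE; exists y.
  by exists x; apply: ui; rewrite vE.
have im_ker i (I : lmodType R) (u : {linear I -> Z (i - 1)}) (v : {linear P i -> I}) :
    injective u -> (forall x, u (v x) = d i x) -> exact_at 0 (k i) v.
  move=> ui vE y; have [ex _ _] := dP i; rewrite -ex -vE.
  by split=> [->|/(inj0 ui)]; first exact: linear0.
(* The image of [d i] is the kernel of [Z (i - 1) -> homology M (i - 1)], so [dimle1_ker] applies
   once [Z (i - 1)] lies in [C]. *)
have im_C i (I : lmodType R) (u : {linear I -> Z (i - 1)}) (v : {linear P i -> I}) :
    injective u -> surj v -> (forall x, u (v x) = d i x) -> C (Z (i - 1)) -> C I.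
  move=> ui vs vE CZ; apply: (@dimle1_ker modE C rC I _ _ CZ _ (dM (i - 1))).
  have [_ _ cz sz _] := sP (i - 1).
  have [g gE] := @lift_cycle _ _ _ _ (comp_map (p (i - 1)) (k (i - 1))) cz.
  exists u, (comp_map (hclass_map _ _) g); split=> //.
    move=> h; have [z <-] := hclass_surj h; have [y b1] := sz _ (cycleP z).
    exists y; apply/(hclassP (g y) z); rewrite gE -(opprB (val z)); exact/boundaryN.
  move=> z; rewrite -[comp_map _ _ z]/(hclass_map _ _ (g z)) hclass_eq0 gE boundary_pred.
  have [_ imd _] := dP i; rewrite -[comp_map _ _ z]/(p (i - 1) (k (i - 1) z)) -imd.
  split=> [[x <-]|[y <-]]; first by exists (v x); rewrite vE.
  by have [x <-] := vs y; exists x; rewrite vE.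
have CZ : forall i, C (Z i).
  apply: (int_up_ind (i0 := i0)) => i.
    move=> ii; apply: (@res_iso modE C rC (zero_module R)) => //.
    apply: zero_module_iso; first exact: zero_moduleP.
    have [ki _ _ _ P0] := sP i; move=> z; apply: ki.
    by rewrite (P0 ii (k i z)) (P0 ii (k i 0)).
  move=> CZ; have [I [u [v [ui vs vE]]]] := im_ex i.
  have [ki Pp _ _ _] := sP i.
  apply: (@res_ker modE C rC (Z i) (P i) I).
  - by exists (k i), v; split=> //; apply: im_ker ui vE.
  - exact: (@res_proj modE C rC _ Pp).
  - exact: im_C ui vs vE CZ.
have Zzero i : i <= i0 -> is_zero_module (Z i).
  move=> ii; have [ki _ _ _ P0] := sP i; move=> z; apply: ki.
  by rewrite (P0 ii (k i z)) (P0 ii (k i 0)).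
have K_ex i : exists (K : lmodType R) (c : {linear K -> Z i}),
    [/\ injective c, C K, i <= b -> surj c, b < i -> is_zero_module K
      & i <= i0 -> is_zero_module K].
  have [ib'|bi] := leP i b.
    exists (Z i), (id_map _); split=> //; last exact: Zzero.
    by move=> _ z; exists z.
  exists (zero_module R), (zero_map _ _); split=> //; try by move=> *; apply: zero_moduleP.
  by move=> x y _; rewrite (zero_moduleP x) (zero_moduleP y).
have [K /dep_choice[c cP]] := choice K_ex.
(* The images are kept one degree further than the cycles: in degree [b + 1] no cycles are divided
   out, but as [H_{b+1}(M) = 0] the homology of the quotient there is still the image of
   [d (b + 1)]. Above that degree the quotient is exact. *)
have B_ex i : exists (B : lmodType R) (v : {linear P i -> B}),
    [/\ surj v, C B, forall z, v (k i z) = 0,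
        i <= b + 1 -> forall x, v x = 0 -> exists z, k i z = x
      & (b + 1 < i -> is_zero_module B) /\ (i <= i0 -> is_zero_module B)].
  have [ib'|bi] := leP i (b + 1).
    have [I [u [v [ui vs vE]]]] := im_ex i; have ex := im_ker _ _ _ _ ui vE.
    exists I, v; split=> //.
    - exact: im_C ui vs vE (CZ _).
    - by move=> z; apply/ex; exists z.
    - by move=> _ x /ex.
    - split=> // ii x; have [y <-] := vs x; have [_ _ _ _ P0] := sP i.
      by rewrite (P0 ii y) linear0.
  exists (zero_module R), (zero_map _ _); split=> //.
  - by move=> y; exists 0; rewrite (zero_moduleP y).
  - by split=> _; apply: zero_moduleP.
have [B /dep_choice[v vP]] := choice B_ex.
have gc i (x : zcomplex K i) :
    comp_map (k (i - 1)) (c (i - 1)) (cdiff (zcomplex K) i x) =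
    cdiff PC i (comp_map (k i) (c i) x).
  have [ex _ _] := dP i; rewrite [RHS]/= (proj2 (ex _)) ?linear0 //.
  by exists (c i x).
pose g := ChainMap (X := zcomplex K) (Y := PC) gc.
apply: (thick_cone (f := g) (diso_sym (diso_qiso PM))).
  apply: (thick1_zcomplex_range C0 (n := b + 1)) => i; first by case: (cP i).
  move=> bi; have [_ _ _ K1 K2] := cP i.
  have [i1|i1] := leP i i0; first exact: K2.
  apply: K1; rewrite ltNge; apply/negP => ib'; move: bi; rewrite ltNge; case/negP.
  rewrite ler_norml (le_trans ib') ?lerDl // andbT; exact: ltW i1.
have qc i (x : cone g i) :
    comp_map (v (i - 1)) (fst_map (P (i - 1)) (K (i - 1 - 1))) (cdiff (cone g) i x) =
    cdiff (zcomplex B) i (comp_map (v i) (fst_map (P i) (K (i - 1))) x).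
  have [_ _ vk _ _] := vP (i - 1); rewrite /= linearD !vk addr0 //.
apply: (@thick1_iso _ _ (zcomplex B)).
  apply/diso_sym/(@diso_qiso _ _ _ (ChainMap (X := cone g) (Y := zcomplex B) qc)).
  apply: quasi_iso_pred => i.
    move=> [x e] /= dx [_ /esym vx].
    have [vs1 _ vk1 vker1 _] := vP (i - 1); have [k2i _ _ _ _] := sP (i - 1 - 1).
    have [c2i _ _ c2z _] := cP (i - 1 - 1); have [_ _ c1s _ _] := cP (i - 1).
    case: dx => dx _; have [ex1 _ _] := dP (i - 1); have [ki _ cz sz _] := sP (i - 1).
    have [e0 [z zx]] : e = 0 /\ exists z, k (i - 1) z = x.
      have [ib'|bi] := leP (i - 1) (b + 1).
        have [z zx] := vker1 ib' _ vx; split; last by exists z.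
        apply: (inj0 c2i); apply: (inj0 k2i); rewrite -dx -zx.
        by rewrite (proj2 (ex1 _)) ?linear0 ?add0r //; exists z.
      have e0 : e = 0 by apply: c2z; rewrite ltrBrDr.
      split=> //; apply/ex1/(inj0 k2i).
      by move: dx; rewrite e0 !linear0 addr0.
    have [ib'|bi] := leP (i - 1) b.
      have [z' zz] := c1s ib' z; exists (0, z'); rewrite /= !linear0 add0r ?oppr0 e0.
      by rewrite zz zx.
    (* In this degree [K] is zero, so the cycle must bound in the resolution itself; it does because
       the homology of [M] vanishes above [b]. *)
    have : boundary (p (i - 1) (k (i - 1) z)).
      apply: homology0 (cz z); apply: bM; apply: (lt_le_trans bi); exact: ler_norm.
    move=> /boundary_pred[m mE]; have [_ imd _] := dP i.
    have [y yz] : exists y, d i y = z by apply/imd; exists m.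
    by exists (y, 0); rewrite /= !linear0 addr0 yz zx e0 ?oppr0.
  move=> y _; have [vs1 _ vk1 vker1 [vz _]] := vP (i - 1).
  have [x vx] := vs1 y; have [_ _ c2s _ _] := cP (i - 1 - 1).
  have [ib'|bi] := leP (i - 1) (b + 1).
    have [|e eE] := c2s _ (- d (i - 1) x); first by rewrite lerBlDr.
    exists (x, e); split; first by rewrite /= eE linearN subrr oppr0.
    by exists 0; rewrite /= vx subrr.
  exists 0; split; first exact: linear0.
  by exists 0; rewrite (vz bi y) /= linear0 subrr.
apply: (thick1_zcomplex_range C0 (n := b + 1)) => i; first by case: (vP i).
move=> bi; have [_ _ _ _ [B1 B2]] := vP i.
have [i1|i1] := leP i i0; first exact: B2.
apply: B1; rewrite ltNge; apply/negP => ib'; move: bi; rewrite ltNge; case/negP.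
by rewrite ler_norml ib' andbT; exact: ltW i1.
Qed.

Lemma thick_left n M : dim_bounded C n.+1 M -> thick (as_complexes C) n.+2 M.
Proof.
elim: n M => [|n IH] M; first exact: thick_base.
exact: thick_step.
Qed.

End LeftBase.

(** * Classes defined by right resolutions *)

Section Filtrations.
Variables (R : comPzRingType) (C : complex R -> Prop).
Implicit Types K X Y M I : complex R.

(* [X] is built in [n + 1] steps from [thick1 C]: [X] has a filtration, up to
   quasi-isomorphisms of the successive quotients, of length [n + 1]. Such
   filtrations can be extended on the right, unlike those of [thick]. *)
Inductive filt : nat -> complex R -> Prop :=
| filt0 X : thick1 C X -> filt 0 X
| filtS n K X Y (f : chain_map K X) (g : chain_map (cone f) Y) :
    thick1 C K -> quasi_iso g -> filt n Y -> filt n.+1 X.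

Lemma filt_thick n M X : filt n X -> disomorphic M X -> thick C n.+1 M.
Proof.
move=> fX; elim: fX M => {n X} [X tX|n K X Y f g tK qg _ IH] M MX.
  exact: thick1_iso (diso_sym MX) tX.
exact: thick_cone MX tK (IH _ (diso_qiso qg)).
Qed.

Lemma quasi_iso_predP X Y (f : chain_map X Y) : quasi_iso f ->
  (forall i (x : X (i - 1)), cdiff X (i - 1) x = 0 ->
     (exists y, cdiff Y i y = f (i - 1) x) -> exists x', cdiff X i x' = x) /\
  (forall i (y : Y (i - 1)), cdiff Y (i - 1) y = 0 ->
     exists x, cdiff X (i - 1) x = 0 /\ exists w, cdiff Y i w = y - f (i - 1) x).
Proof.
move/quasi_isoP => qf; split=> i.
  move=> x dx /boundary_pred b; apply/boundary_pred.
  by have [inj _] := qf (i - 1); apply: inj.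
move=> y dy; have [_ srj] := qf (i - 1); have [x dx /boundary_pred b] := srj y dy.
by exists x.
Qed.

Definition cone_map_fun K X Y (f : chain_map K X) (h : chain_map X Y) i :
    {linear cone f i -> cone (chain_comp h f) i} :=
  pair_map (comp_map (h i) (fst_map (X i) (K (i - 1)))) (snd_map (X i) (K (i - 1))).
Lemma cone_map_subproof K X Y (f : chain_map K X) (h : chain_map X Y) i (p : cone f i) :
  cone_map_fun f h (i - 1) (cdiff (cone f) i p) =
  cdiff (cone (chain_comp h f)) i (cone_map_fun f h i p).
Proof. by rewrite /= linearD cmapP. Qed.
Definition cone_map K X Y (f : chain_map K X) (h : chain_map X Y) :
  chain_map (cone f) (cone (chain_comp h f)) := ChainMap (@cone_map_subproof K X Y f h).

Lemma cone_map_qiso K X Y (f : chain_map K X) (h : chain_map X Y) :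
  quasi_iso h -> quasi_iso (cone_map f h).
Proof.
move=> /quasi_iso_predP[inj srj]; apply: quasi_iso_pred => i.
  move=> [x k] /= [dx dk] [[y k'] /= [yE kE]].
  have [||x' x'E] := inj i (x - f (i - 1) k').
  - by rewrite linearB -cmapP -[in RHS]dx -kE linearN.
  - by exists y; rewrite linearB -yE addrK.
  by exists (x', k'); rewrite /= x'E subrK kE.
move=> [y k] /= [dy /eqP]; rewrite oppr_eq0 => /eqP dk.
have [||x0 x0E] := inj (i - 1) (f (i - 1 - 1) k).
- by rewrite -cmapP dk linear0.
- by exists (- y); rewrite linearN (add_eq0_opp dy).
have [|x1 [dx1 [w wE]]] := srj i (y + h (i - 1) x0).
  by rewrite linearD -cmapP x0E.
exists (x1 - x0, k); split; first by rewrite /= linearB dx1 x0E sub0r addNr dk oppr0.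
exists (w, 0); rewrite /= !linear0 addr0 wE ?oppr0.
by congr (_, _); rewrite /= ?subrr // linearB opprB addrA addrAC.
Qed.

Definition cone_incl_proj_fun X I (f : chain_map I X) i :
    {linear cone (cone_incl f) i -> shift I i} :=
  comp_map (snd_map (X i) (I (i - 1))) (fst_map (cone f i) (X (i - 1))).
Lemma cone_incl_proj_subproof X I (f : chain_map I X) i (p : cone (cone_incl f) i) :
  cone_incl_proj_fun f (i - 1) (cdiff (cone (cone_incl f)) i p) =
  cdiff (shift I) i (cone_incl_proj_fun f i p).
Proof. by rewrite /= addr0. Qed.
Definition cone_incl_proj X I (f : chain_map I X) : chain_map (cone (cone_incl f)) (shift I) :=
  ChainMap (@cone_incl_proj_subproof X I f).

(** The two copies of [X] in the iterated cone cancel, as in a rotated triangle. *)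
Lemma cone_incl_proj_qiso X I (f : chain_map I X) :
  quasi_iso (cone_incl_proj f).
Proof.
apply: quasi_iso_pred => i.
  move=> [[x a] x'] /= dx [a' /= a'E].
  case: dx => dx _ _; exists ((0, a'), x - f (i - 1) a').
  have da : cdiff I (i - 1) a' = - a by rewrite -a'E opprK.
  rewrite /= linear0 add0r; congr (_, _); first by congr (_, _); rewrite /= ?addr0 // subrKC.
  by rewrite linearB opprB -cmapP da linearN (add_eq0_opp dx) opprD [RHS]addrC.
move=> a /= da; exists ((0, a), - f (i - 1 - 1) a).
have {}da : cdiff I (i - 1 - 1) a = 0 by rewrite -[LHS]opprK da oppr0.
split; last by exists 0; rewrite subrr linear0 oppr0.
congr (_, _); rewrite /= ?linearN -?cmapP da ?linear0 ?oppr0 //.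
by congr (_, _); rewrite /= ?addr0 ?oppr0 ?linear0 ?add0r ?subrr ?oppr0 ?addr0.
Qed.

(** Both iterated cones consist of [X] and the shifts of [I] and [K], attached in the two possible
    orders. *)
Definition cone_swap_fun K X I (f : chain_map I X) (f' : chain_map K X) i :
    {linear cone (chain_comp (cone_incl f) f') i -> cone (chain_comp (cone_incl f') f) i} :=
  pair_map (pair_map (comp_map (fst_map (X i) (I (i - 1))) (fst_map (cone f i) (K (i - 1))))
                     (snd_map (cone f i) (K (i - 1))))
           (comp_map (snd_map (X i) (I (i - 1))) (fst_map (cone f i) (K (i - 1)))).
Lemma cone_swap_subproof K X I (f : chain_map I X) (f' : chain_map K X) i
    (p : cone (chain_comp (cone_incl f) f') i) :
  cone_swap_fun f f' (i - 1) (cdiff (cone (chain_comp (cone_incl f) f')) i p) =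
  cdiff (cone (chain_comp (cone_incl f') f)) i (cone_swap_fun f f' i p).
Proof.
case: p => [[x a] k] /=; congr (_, _); last by rewrite /= addr0.
by congr (_, _); rewrite /= ?addr0 // addrAC.
Qed.
Definition cone_swap K X I (f : chain_map I X) (f' : chain_map K X) :
    chain_map (cone (chain_comp (cone_incl f) f')) (cone (chain_comp (cone_incl f') f)) :=
  ChainMap (@cone_swap_subproof K X I f f').

Lemma cone_swap_qiso K X I (f : chain_map I X) (f' : chain_map K X) :
  quasi_iso (cone_swap f f').
Proof.
apply: iso_quasi_iso => i; first by move=> [[x a] k] [[y b] l] /= [-> -> ->].
by move=> [[x k] a]; exists ((x, a), k).
Qed.

(** The piece [I] moves past the pieces of [X] one by one: by [cone_swap], attaching [K] after [I]
    is attaching [I] after [K], and the latter cone may be computed on [Y]. Once a single piece is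
    left, the cone of [X -> cone f] is the shift of [I]. *)
Lemma filt_cone n X I (f : chain_map I X) : filt n X -> thick1 C I -> filt n.+1 (cone f).
Proof.
move=> fX tI; elim: fX f => {n X} [X tX|n K X Y f' g tK qg _ IH] f.
  apply: (filtS tX (cone_incl_proj_qiso f)); apply: filt0; exact: thick1_shift.
apply: (filtS tK _ (IH (chain_comp g (chain_comp (cone_incl f') f)))).
exact: quasi_iso_comp (cone_swap_qiso f f') (cone_map_qiso _ qg).
Qed.

End Filtrations.

(** * Injective resolutions of complexes *)

Section InjectiveResolution.
Variables (R : comPzRingType) (M : complex R) (i0 : int).
Hypothesis M0 : forall i, i0 <= i -> is_zero_module (homology M i).

(* The degree [i] part of an injective resolution of [M]: the injective
   module, the map from [M i] to it, and its quotient by the boundaries. *)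
Record ires_state (i : int) := IresState {
  ir_inj : lmodType R; ir_quo : lmodType R;
  ir_out : {linear ir_inj -> ir_quo}; ir_map : {linear M i -> ir_inj};
  ir_surj : surj ir_out;
  ir_injP : injective_module ir_inj;
  ir_bound : forall x : M i, boundary x -> ir_out (ir_map x) = 0;
  ir_hinj : forall m : M i, cdiff M i m = 0 -> ir_out (ir_map m) = 0 -> boundary m;
  ir_zero : i0 <= i -> is_zero_module ir_inj
}.

(** Dual to [pres_rel]: the differential is [d] after [ir_out]. The kernel of [d] is the image of
    the cycles of [M], which gives surjectivity on homology; injectivity is [ir_hinj]. *)
Definition ires_rel i (s' : ires_state (i - 1)) (s : ires_state i) :=
  exists d : {linear ir_quo s -> ir_inj s'},
  [/\ exact_at 0 d (ir_out s'),
      forall y, d y = 0 <-> exists m, cdiff M i m = 0 /\ ir_out s (ir_map s m) = y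
    & forall m, ir_map s' (cdiff M i m) = d (ir_out s (ir_map s m))].

Lemma zero_ires_state i : i0 <= i -> exists s : ires_state i,
  is_zero_module (ir_inj s) /\ is_zero_module (ir_quo s).
Proof.
move=> ii; pose Z := zero_module R.
have ks : surj (id_map Z) by move=> x; exists x.
have iP : injective_module Z by exact: zero_injective.
have bP (x : M i) : boundary x -> id_map Z (zero_map (M i) Z x) = 0 by [].
have hP (m : M i) : cdiff M i m = 0 -> id_map Z (zero_map (M i) Z m) = 0 -> boundary m.
  by move=> dm _; apply: homology0 dm; apply: M0.
exists (IresState ks iP bP hP (fun _ => @zero_moduleP R)).
by split; apply: zero_moduleP.
Qed.

Lemma inj_resolution_ex : exists (J Y : int -> lmodType R)
    (p : forall i, {linear J i -> Y i}) (q : forall i, {linear M i -> J i})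
    (d : forall i, {linear Y i -> J (i - 1)}),
  [/\ forall i, [/\ surj (p i), injective_module (J i),
        forall x : M i, boundary x -> p i (q i x) = 0,
        forall m : M i, cdiff M i m = 0 -> p i (q i m) = 0 -> boundary m
        & i0 <= i -> is_zero_module (J i)]
    & forall i, [/\ exact_at 0 (d i) (p (i - 1)),
        forall y, d i y = 0 <-> exists m, cdiff M i m = 0 /\ p i (q i m) = y
        & forall m, q (i - 1) (cdiff M i m) = d i (p i (q i m))]].
Proof.
have [s0 _] := zero_ires_state (lexx i0).
have [||s [_ sR]] := @int_choice ires_state ires_rel i0 s0.
- move=> i s' ii; have [|s [z1 z2]] := @zero_ires_state i; first exact: ltW.
  have z0 : is_zero_module (ir_inj s') by apply: ir_zero; rewrite lerBrDr lezD1.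
  exists s, (zero_map _ _); split.
  + move=> y; split=> [_|_]; first by exists 0; rewrite (z0 y).
    by rewrite (z0 y) linear0.
  + move=> y; split=> // _; exists 0; rewrite !linear0 (z2 y).
    by rewrite -(z2 0).
  + by move=> m; rewrite [LHS]z0 [RHS]z0.
- move=> i s ii.
  (* The next injective contains the pushout of the quotient in degree [i] and [M (i - 1)] along
     [M i]. *)
  have [Q [a [b [ab ab1 ab2]]]] := pushout_ex (comp_map (ir_out s) (ir_map s)) (cdiff M i).
  have [J [L [Ji [e [l [ei ls el]]]]]] := inj_hull Q.
  have [Y [p [ps pE]]] := quotient_ex (im_submod (comp_map e a)).
  have bP (x : M (i - 1)) : boundary x -> p (comp_map e b x) = 0.
    move=> /boundary_pred[y <-]; apply/pE; exists (ir_out s (ir_map s y)).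
    by rewrite /= -ab.
  have hP (m : M (i - 1)) : cdiff M (i - 1) m = 0 -> p (comp_map e b m) = 0 -> boundary m.
    by move=> _ /pE[y /= /ei/ab2[w _ <-]]; apply: Boundary.
  have z0 : i0 <= i - 1 -> is_zero_module J by rewrite lerBrDr lezD1 ltNge ii.
  exists (IresState ps Ji bP hP z0), (comp_map e a); split.
  + exact: pE.
  + move=> y; split=> [/= /(inj0 ei) ay|[m [dm <-]]].
      by have [w wy dw] := ab2 y 0 (etrans ay (esym (linear0 b))); exists w.
    by have /= abm := ab m; rewrite /= abm dm !linear0.
  + by move=> m; have /= abm := ab m; rewrite /= abm.
have [d dP] := dep_choice sR.
exists (fun i => ir_inj (s i)), (fun i => ir_quo (s i)), (fun i => ir_out (s i)).
exists (fun i => ir_map (s i)), d; split=> i; last exact: dP.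
split; [exact: ir_surj | exact: ir_injP | exact: ir_bound | exact: ir_hinj | exact: ir_zero].
Qed.

End InjectiveResolution.

(** * The bound for coresolutions *)

Section Right.
Variables (R : comPzRingType) (C : lmodType R -> Prop).
Notation opE := (mod_op_exact R).
Hypothesis rC : resolving (E := opE) C.
Implicit Types M X : complex R.
Implicit Types E : int -> lmodType R.

Let C0 : C (zero_module R).
Proof.
have [K [P [pP _]]] := @eproj_cover opE (zero_module R).
exact: (@res_zero opE C rC P (res_proj rC pP)).
Qed.

Definition codim_bounded n M :=
  (forall i, dimle (E := opE) C n (homology M i)) /\ bounded_homology M.

Section Fiber.
Variables (M : complex R) (E : int -> lmodType R) (g : forall i, {linear M i -> E (i - 1)}).
Hypothesis gd : forall i (m : M i), g (i - 1) (cdiff M i m) = 0.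

Lemma fiber_diff_linear i : linear (fun p : (M i * E i)%type => (cdiff M i p.1, g i p.1)).
Proof. by move=> a p q; rewrite /= !linearP. Qed.
Lemma fiber_subproof i (p : (M i * E i)%type) :
  mk_linear (@fiber_diff_linear (i - 1)) (mk_linear (@fiber_diff_linear i) p) = 0.
Proof. by rewrite /= cdiffK gd. Qed.
(* The homotopy fiber of [g], seen as a chain map from [M] to the shift of [E]. *)
Definition fiber : complex R :=
  @Complex R (fun i => (M i * E i)%type : lmodType R) _ fiber_subproof.

Lemma fiber_incl_subproof i (e : zcomplex E i) :
  inr_map (M (i - 1)) (E (i - 1)) (cdiff (zcomplex E) i e) = cdiff fiber i (inr_map (M i) (E i) e).
Proof. by rewrite /= !linear0. Qed.
Definition fiber_incl : chain_map (zcomplex E) fiber := ChainMap (Y := fiber) fiber_incl_subproof.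

Lemma fiber_cone_subproof i (m : M i) :
  pair_map (inl_map (M (i - 1)) (E (i - 1))) (opp_map (g (i - 1))) (cdiff M i m) =
  cdiff (cone fiber_incl) i (pair_map (inl_map (M i) (E i)) (opp_map (g i)) m).
Proof.
rewrite /= gd oppr0; congr (_, _).
by congr (_, _); rewrite /= ?addr0 // subrr.
Qed.
Definition fiber_cone : chain_map M (cone fiber_incl) :=
  ChainMap (Y := cone fiber_incl) fiber_cone_subproof.

(** [M] is recovered from its fiber by attaching [E] last, which is why filtrations must be
    extendable on the right. *)
Lemma fiber_cone_qiso : quasi_iso fiber_cone.
Proof.
apply: quasi_iso_pred => i.
  by move=> m dm [[[m' e] y] /= [mE _ _]]; exists m'; rewrite -mE addr0.
move=> [[m e] y] /= [dm gm _]; move: dm; rewrite addr0 => dm; exists m; split=> //.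
exists (0, e); rewrite /= !linear0 ?oppr0 (add_eq0_opp gm).
congr (_, _); last by rewrite /= subrr.
by congr (_, _); rewrite /= ?addr0 ?add0r ?subrr ?subr0.
Qed.

Hypothesis gi : forall i (m : M i), cdiff M i m = 0 -> g i m = 0 -> boundary m.

(** Injectivity of [g] on homology cuts the long exact sequence, so the homology of the fiber
    consists of cosyzygies of that of [M]. *)
Lemma fiber_homology_ses i : ses (homology M i) (E (i - 1)) (homology fiber (i - 1)).
Proof.
have gb j (x : M j) : boundary x -> g j x = 0 by case=> k y; apply: gd.
have [ga gaE] : exists ga : {linear homology M i -> E (i - 1)},
    forall z, ga (hclass_map M i z) = g i (val z).
  apply: (factor_surj (f := comp_map (g i) (cycle_val_map M i))); first exact: hclass_surj.
  by move=> z /hclass_eq0/gb.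
have [l lE] := @lift_cycle _ _ fiber _ (fiber_incl (i - 1))
  (fun x => etrans (esym (cmapP fiber_incl x)) (linear0 _)).
exists ga, (comp_map (hclass_map _ _) l); split.
- apply: linear_inj0 => x; have [z <-] := hclass_surj x; rewrite gaE => gz.
  by apply/hclass_eq0/gi => //; apply: cycleP.
- move=> x; have [z <-] := hclass_surj x.
  have := cycleP z; case: {-1}(val z) (erefl (val z)) => m e ze /= [dm gm].
  have /boundary_pred[m' mE] := gi dm gm.
  exists (e - g i m'); apply/(hclassP (l (e - g i m')) z); rewrite lE ze.
  apply/boundary_pred; exists (- m', 0); congr (_, _); rewrite /= linearN ?mE ?sub0r //.
  by rewrite [RHS]addrC addKr.
move=> e; rewrite -[comp_map _ _ e]/(hclass_map _ _ (l e)) hclass_eq0 lE boundary_pred.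
split=> [[[m e'] /= [dm gm]]|[x]].
  have mc : m \in cycle_pred M i by rewrite inE dm.
  by exists (hclass_map M i (Cycle mc)); rewrite gaE.
have [z <-] := hclass_surj x; rewrite gaE => ge.
by exists (val z, 0); rewrite /= cycleP ge.
Qed.

End Fiber.

(** The quasi-isomorphism points away from [M], as injective resolutions do, so that it composes
    with the inclusion of [E] into a fiber. *)
Definition has_filt n M :=
  exists (X : complex R) (h : chain_map M X), quasi_iso h /\ filt (as_complexes C) n X.

Lemma filt_step n k M : (forall N, codim_bounded k N -> has_filt n N) ->
  codim_bounded k.+1 M -> has_filt n.+1 M.
Proof.
move=> IH [dM [b bM]].
have hull i : exists (E : lmodType R) (g : {linear M i -> E}),
    [/\ injective_module E, forall x, boundary x -> g x = 0,
        forall m, cdiff M i m = 0 -> g m = 0 -> boundary m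
      & is_zero_module (homology M i) -> is_zero_module E].
  have [H0|nH] := pselect (is_zero_module (homology M i)).
    exists (zero_module R), (zero_map _ _); split=> //.
    - exact: zero_injective.
    - by move=> m dm _; apply: homology0.
    - by move=> _; apply: zero_moduleP.
  have [E [L [Ei [e [_ [ei _ _]]]]]] := inj_hull (homology M i : lmodType R).
  have vi : injective (cycle_val_map M i) by exact: val_inj.
  have [g gE] := Ei _ _ (cycle_val_map M i) (comp_map e (hclass_map M i)) vi.
  have gz (x : M i) (dx : cdiff M i x = 0) : exists z : cycle M i, val z = x /\ g x = e (hclass_map M i z).
    have xc : x \in cycle_pred M i by rewrite inE dx.
    by exists (Cycle xc); rewrite -[e _]gE.
  exists E, g; split=> //.
    move=> x bx; have [|z [zx ->]] := gz x.
      by case: bx => j y; apply: cdiffK.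
    by rewrite (proj2 (hclass_eq0 z)) ?linear0 // zx.
  move=> m dm; have [z [<- ->]] := gz m dm.
  by move=> /(inj0 ei)/hclass_eq0.
(* The reindexing gives [g] the type [M i -> E (i - 1)] expected by [fiber]. *)
have [E' gP'] := choice hull; pose E i := E' (i + 1).
have gP i : exists g : {linear M i -> E (i - 1)},
    [/\ injective_module (E (i - 1)), forall x, boundary x -> g x = 0,
        forall m, cdiff M i m = 0 -> g m = 0 -> boundary m
      & is_zero_module (homology M i) -> is_zero_module (E (i - 1))].
  by rewrite /E subrK.
have {hull gP' gP} [g gP] := dep_choice gP.
have gd i (m : M i) : g (i - 1) (cdiff M i m) = 0.
  by have [_ gb _ _] := gP (i - 1); apply: gb; apply: Boundary.
have gi i (m : M i) : cdiff M i m = 0 -> g i m = 0 -> boundary m.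
  by have [_ _ h _] := gP i; apply: h.
have Eprop i : injective_module (E i) /\ (is_zero_module (homology M (i + 1)) -> is_zero_module (E i)).
  by have [h1 _ _ h2] := gP (i + 1); move: h1 h2; rewrite addrK.
have [|X [h [qh fX]]] := IH (fiber gd).
  split.
    move=> i; rewrite -(addrK 1 i); set j := i + 1.
    apply: (@dimle_syzygy opE C rC k _ (E (j - 1)) (homology M j)); last exact: dM.
      by case: (Eprop (j - 1)).
    exact: fiber_homology_ses.
  exists (b + 1) => i bi; rewrite -(addrK 1 i); set j := i + 1.
  have [a [c [_ cs _]]] := fiber_homology_ses gd gi j.
  have E0 : is_zero_module (E (j - 1)).
    have [_] := Eprop (j - 1); apply; rewrite subrK; apply: bM.
    rewrite -(ltrD2r 1) (lt_le_trans bi) // -{1}[i](addrK 1) -/j.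
    by rewrite (le_trans (ler_normB _ _)) // normr1.
  by move=> x; have [y <-] := cs x; rewrite (E0 y) linear0.
(* In the description of [M] as the cone of [E -> fiber], the fiber is replaced by its filtered
   model [X]. *)
exists (cone (chain_comp h (fiber_incl gd))).
exists (chain_comp (cone_map (fiber_incl gd) h) (fiber_cone gd)); split.
  exact: quasi_iso_comp (fiber_cone_qiso gd) (cone_map_qiso _ qh).
apply: filt_cone fX _; apply: (thick1_zcomplex_range C0 (n := b + 1)) => i.
  by apply: (@res_proj opE C rC); case: (Eprop i).
move=> bi; have [_] := Eprop i; apply; apply: bM.
rewrite -(ltrD2r 1) (lt_le_trans bi) // -{1}[i](addrK 1).
by rewrite (le_trans (ler_normB _ _)) // normr1.
Qed.

Lemma int_down_ind (Q : int -> Prop) i0 : (forall i, i0 <= i -> Q i) ->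
  (forall i, Q i -> Q (i - 1)) -> forall i, Q i.
Proof.
move=> Q0 QS i; rewrite -[i]opprK; move: (- i).
apply: (int_up_ind (i0 := - i0)) => j; first by rewrite lerNr => /Q0.
by move/QS; rewrite opprB addrAC subrr sub0r.
Qed.

Lemma filt_base M : codim_bounded 1 M -> has_filt 1 M.
Proof.
move=> [dM [b0 bM0]]; pose b := `|b0|%N%:Z.
have bM (i : int) : b < `|i| -> is_zero_module (homology M i).
  by move=> bi; apply: bM0; apply: le_lt_trans bi; rewrite /b abszE ler_norm.
pose i0 := b + 1.
have M0 i : i0 <= i -> is_zero_module (homology M i).
  by move=> ii; apply: bM; apply: lt_le_trans (ler_norm i); rewrite -lezD1.
have [J [Y [p [q [d [sP dP]]]]]] := inj_resolution_ex M0.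
have pd i y : p (i - 1) (d i y) = 0 by have [h _ _] := dP i; apply/h; exists y.
have dd i x : comp_map (d (i - 1)) (p (i - 1)) (comp_map (d i) (p i) x) = 0.
  by rewrite /= pd linear0.
pose JC := @Complex R J (fun i => comp_map (d i) (p i)) dd.
have qc i (x : M i) : q (i - 1) (cdiff M i x) = cdiff JC i (q i x).
  by have [_ _ e] := dP i; apply: e.
have MJ : quasi_iso (ChainMap (Y := JC) qc).
  apply: quasi_iso_pred => i x dx.
    move=> [y /= yE]; apply/boundary_pred; have [_ _ _ h _] := sP (i - 1).
    by apply: h => //; rewrite -yE pd.
  have [_ h _] := dP (i - 1); have /h[m [dm pm]] := dx.
  exists m; split=> //; have [ex _ _] := dP i; have [ps _ _ _ _] := sP i.
  have [|u uE] := proj1 (ex (x - q (i - 1) m)); first by rewrite linearB pm subrr.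
  by have [w wu] := ps u; exists w; rewrite /= wu.
have B_ex j : exists (B : lmodType R) (c : {linear B -> J j}),
    injective c /\ exact_at 0 c (p j).
  have [B [c [ci cE]]] := submodule_ex (ker_submod (p j)).
  by exists B, c; split=> // y; apply: cE.
(* [B] is the cokernel of [homology M i -> Y i], a kernel in the opposite category, so [dimle1_ker]
   applies. *)
have B_C i (B : lmodType R) (c : {linear B -> J (i - 1)}) :
    injective c -> exact_at 0 c (p (i - 1)) -> C (Y i) -> C B.
  move=> ci ce CY; apply: (@dimle1_ker opE C rC B (Y i) (homology M i) CY _ (dM i)).
  have [ps _ bz hz _] := sP i.
  have [r rE] : exists r : {linear Y i -> B}, forall y, c (r y) = d i y.
    by apply: factor_inj => // y; apply/ce/pd.
  have [a aE] : exists a : {linear homology M i -> Y i},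
      forall z, a (hclass_map M i z) = comp_map (comp_map (p i) (q i)) (cycle_val_map M i) z.
    by apply: factor_surj => [|z /hclass_eq0/bz //]; apply: hclass_surj.
  exists a, r; split.
  - apply: linear_inj0 => x; have [z <-] := hclass_surj x; rewrite aE => /= pz.
    by apply/hclass_eq0/hz => //; apply: cycleP.
  - move=> z; have [ex _ _] := dP i; have [|y yE] := proj1 (ex (c z)).
      by apply/ce; exists z.
    by exists y; apply: ci; rewrite rE.
  move=> y; have [_ h _] := dP i; have -> : r y = 0 <-> d i y = 0.
    by rewrite -rE; split=> [->|/(inj0 ci)]; first exact: linear0.
  rewrite h; split=> [[m [dm <-]]|[x <-]].
    have mc : m \in cycle_pred M i by rewrite inE dm.
    by exists (hclass_map M i (Cycle mc)); rewrite aE.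
  by have [z <-] := hclass_surj x; exists (val z); rewrite cycleP aE.
have Yzero i : i0 <= i -> is_zero_module (Y i).
  move=> ii y; have [ps _ _ _ J0] := sP i; have [x <-] := ps y.
  by rewrite (J0 ii x) linear0.
have CY : forall i, C (Y i).
  apply: (int_down_ind (i0 := i0)) => i.
    move=> ii; apply: (@res_iso opE C rC (zero_module R)) => //.
    by apply: zero_module_iso; [apply: zero_moduleP | apply: Yzero].
  move=> CYi; have [B [c [ci ce]]] := B_ex (i - 1).
  have [ps Ji _ _ _] := sP (i - 1).
  apply: (@res_ker opE C rC (Y (i - 1)) (J (i - 1)) B).
  - by exists c, (p (i - 1)).
  - exact: (@res_proj opE C rC).
  - exact: B_C ci ce CYi.
(* Boundaries are divided out down to degree [-(b + 1)], one further than the quotients [T] are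
   kept. In that degree the quotient embeds in the next term, as the homology of [M] vanishes there,
   so it adds no homology. *)
have K_ex j : exists (K : lmodType R) (c : {linear K -> J j}),
    [/\ injective c, C K, forall z, p j (c z) = 0,
        - (b + 1) <= j -> forall x, p j x = 0 -> exists z, c z = x
      & (j < - (b + 1) -> is_zero_module K) /\ (i0 <= j -> is_zero_module K)].
  have [jb|bj] := leP (- (b + 1)) j.
    have [B [c [ci ce]]] := B_ex j; exists B, c; split=> //.
    - suff CB l (D : lmodType R) (a : {linear D -> J l}) :
          injective a -> exact_at 0 a (p l) -> C D by apply: CB ci ce.
      move: a; rewrite -(addrK 1 l) => a ai ae; exact: B_C ai ae (CY _).
    - by move=> z; apply/ce; exists z.
    - by move=> _ x /ce.
    split=> // ij z; have [_ _ _ _ J0] := sP j; apply: ci.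
    by rewrite (J0 ij (c z)) linear0.
  exists (zero_module R), (zero_map _ _); split=> //.
  - by move=> x y _; rewrite (zero_moduleP x) (zero_moduleP y).
  - by move=> z; apply: linear0.
  by split=> _; apply: zero_moduleP.
have [K /dep_choice[c cP]] := choice K_ex.
have T_ex j : exists (T : lmodType R) (t : {linear J j -> T}),
    [/\ surj t, C T, forall x, p j x = 0 -> t x = 0,
        - b <= j -> forall x, t x = 0 -> p j x = 0
      & (j < - b -> is_zero_module T) /\ (i0 <= j -> is_zero_module T)].
  have [jb|bj] := leP (- b) j.
    exists (Y j), (p j); split=> //; first by case: (sP j).
    by split=> //; apply: Yzero.
  exists (zero_module R), (zero_map _ _); split=> //.
  - by move=> y; exists 0; rewrite (zero_moduleP y).
  by split=> _; apply: zero_moduleP.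
have [T /dep_choice[t tP]] := choice T_ex.
have gc i (x : zcomplex K i) :
    c (i - 1) (cdiff (zcomplex K) i x) = cdiff JC i (c i x).
  by have [_ _ pz _ _] := cP i; rewrite /= pz !linear0.
pose g := ChainMap (X := zcomplex K) (Y := JC) gc.
have tc i (x : cone g i) :
    comp_map (t (i - 1)) (fst_map (J (i - 1)) (K (i - 1 - 1))) (cdiff (cone g) i x) =
    cdiff (zcomplex T) i (comp_map (t i) (fst_map (J i) (K (i - 1))) x).
  have [_ _ t0 _ _] := tP (i - 1); have [_ _ pz _ _] := cP (i - 1).
  by rewrite /= linearD !t0 ?addr0.
have cone_qiso : quasi_iso (ChainMap (X := cone g) (Y := zcomplex T) tc).
  apply: quasi_iso_pred => i.
    move=> [x e] /= [dx _] [_ /esym tx].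
    have [_ _ _ t1 _] := tP (i - 1); have [c2i _ _ _ [c2z _]] := cP (i - 1 - 1).
    have [_ _ _ c1s _] := cP (i - 1).
    have [ib|bi] := leP (- b) (i - 1).
      have px := t1 ib _ tx; have e0 : e = 0.
        by apply: (inj0 c2i); move: dx; rewrite px linear0 add0r.
      have [|z zx] := c1s _ _ px; first by rewrite (le_trans _ ib) // lerN2 lerDl.
      by exists (0, z); rewrite /= !linear0 add0r zx e0 ?oppr0.
    have e0 : e = 0 by apply: c2z; rewrite ltrBlDr opprD subrK.
    have [ex _ _] := dP i; have [_ h _] := dP (i - 1).
    have [m [dm pm]] : exists m, cdiff M (i - 1) m = 0 /\ p (i - 1) (q (i - 1) m) = p (i - 1) x.
      by apply/h; move: dx; rewrite e0 linear0 addr0.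
    have px : p (i - 1) x = 0.
      rewrite -pm; have [_ _ bz _ _] := sP (i - 1); apply: bz; apply: homology0 dm.
      by apply: bM; rewrite -normrN; apply: lt_le_trans (ler_norm _); rewrite ltrNr.
    have [u uE] := proj1 (ex x) px; have [ps _ _ _ _] := sP i; have [w wu] := ps u.
    by exists (w, 0); rewrite /= !linear0 addr0 wu uE e0 ?oppr0.
  move=> y _; have [t1s _ _ _ [tz _]] := tP (i - 1); have [x tx] := t1s y.
  have [_ _ _ c2s _] := cP (i - 1 - 1).
  have [ib|bi] := leP (- b) (i - 1).
    have [||e eE] := c2s _ (- d (i - 1) (p (i - 1) x)).
    - by rewrite lerBrDr opprD subrK.
    - by rewrite linearN pd oppr0.
    exists (x, e); split; first by rewrite /= eE subrr oppr0.
    by exists 0; rewrite /= tx subrr.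
  exists 0; split; first exact: linear0.
  by exists 0; rewrite (tz bi y) /= linear0 subrr.
exists JC, (ChainMap (Y := JC) qc); split=> //.
apply: (filtS (f := g) _ cone_qiso).
  apply: (thick1_zcomplex_range C0 (n := b + 1)) => i; first by case: (cP i).
  move=> bi; have [_ _ _ _ [K1 K2]] := cP i.
  have [i1|i1] := leP i0 i; first exact: K2.
  apply: K1; rewrite ltNge; apply/negP => ib; move: bi; rewrite ltNge; case/negP.
  by rewrite ler_norml ib ltW.
apply: filt0; apply: (thick1_zcomplex_range C0 (n := b + 1)) => i; first by case: (tP i).
move=> bi; have [_ _ _ _ [T1 T2]] := tP i.
have [i1|i1] := leP i0 i; first exact: T2.
apply: T1; rewrite ltNge; apply/negP => ib; move: bi; rewrite ltNge; case/negP.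
by rewrite ler_norml (le_trans _ ib) ?lerN2 ?lerDl // ltW.
Qed.

Lemma thick_right n M : codim_bounded n.+1 M -> thick (as_complexes C) n.+2 M.
Proof.
move=> cM; suff [X [h [qh fX]]] : has_filt n.+1 M by apply: filt_thick fX (diso_qiso qh).
elim: n M cM => [|n IH] M; first exact: filt_base.
exact: filt_step.
Qed.

End Right.

(** * From total homology to the inequality of levels *)

Section TotalHomology.
Variables (R : comPzRingType) (H : int -> lmodType R) (i : int).

Definition dsum_in_fun (x : H i) (j : int) : H j :=
  if eqP is ReflectT e then ecast k (H k) (e : i = j) x else 0.

Lemma dsum_in_subproof x : finite_support (dsum_in_fun x).
Proof.
apply/asboolP; exists [:: i] => j; rewrite inE => ji; rewrite /dsum_in_fun.
by case: eqP => // e; rewrite e eqxx in ji.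
Qed.

Lemma dsum_in_linear : linear (fun x : H i => DSum (dsum_in_subproof x)).
Proof.
move=> a x y; apply: dsumP => j /=; rewrite /dsum_in_fun; case: eqP => [e|_].
  by case: _ / e.
by rewrite scaler0 addr0.
Qed.

Lemma dsum_out_linear : linear (fun f : dsum H => f i).
Proof. by []. Qed.

Lemma dsum_summand : exists X, iso (dsum H : lmodType R) (dirsum (H i) X).
Proof.
apply: (@retract_sum _ _ _ (mk_linear dsum_in_linear) (mk_linear dsum_out_linear)) => x /=.
by rewrite /dsum_in_fun; case: eqP => // e; rewrite eq_axiomK.
Qed.

End TotalHomology.

Section Levels.
Variable R : comPzRingType.
Implicit Types (C : lmodType R -> Prop) (M : complex R).

Lemma inf_nat_le (P : nat -> Prop) n : P n -> (inf_nat P <= n%:Z%:E)%E.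
Proof.
move=> Pn; rewrite /inf_nat; case: pselect => [h|[]]; last by exists n; apply/asboolP.
by case: ex_minnP => m _ mmin; rewrite lee_fin lez_nat; apply/mmin/asboolP.
Qed.

(** If [Q] never holds, the right-hand side is infinite; otherwise the least witness of [Q] is
    used. *)
Lemma inf_nat_max (P Q : nat -> Prop) : (forall n, Q n -> P (maxn 2 n.+1)) ->
  (inf_nat P <= Order.max 2%:E (inf_nat Q + 1))%E.
Proof.
move=> QP; rewrite {2}/inf_nat; case: pselect => [h|_]; last first.
  by rewrite addye // le_max leey orbT.
case: ex_minnP => n /asboolP/QP/inf_nat_le Pn _; apply: le_trans Pn _.
rewrite -EFinD -EFin_max lee_fin.
by rewrite -PoszD addn1 le_max; case: leqP => _; rewrite lexx ?orbT.
Qed.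

Lemma left_level C M : resolving (E := mod_exact R) C -> bounded_homology M ->
  (level C M <= Order.max 2%:E (left_dim C (total_homology M) + 1))%E.
Proof.
move=> rC bM; apply: inf_nat_max => n /(resolution_dimle (@res_iso (mod_exact R) C rC)) dn.
have dH i : dimle (E := mod_exact R) C n (homology M i).
  have [X iX] := dsum_summand (fun i => homology M i : lmodType R) i.
  exact: (dimle_summand rC (dimle_iso rC iX dn)).
(* Dimension 0 is weakened to dimension at most 1. *)
case: n {dn} dH => [|n] dH; last first.
  by rewrite (maxn_idPr _) //; apply: (thick_left rC).
by apply: (@thick_left _ _ rC 0); split=> // i; apply: (dimle01 rC (dH i)).
Qed.

Lemma right_level C M : resolving (E := mod_op_exact R) C -> bounded_homology M ->
  (level C M <= Order.max 2%:E (right_dim C (total_homology M) + 1))%E.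
Proof.
move=> rC bM; apply: inf_nat_max => n /(coresolution_dimle (@res_iso (mod_op_exact R) C rC)) dn.
have dH i : dimle (E := mod_op_exact R) C n (homology M i).
  have [X iX] := dsum_summand (fun i => homology M i : lmodType R) i.
  exact: (dimle_summand rC (dimle_iso rC iX dn)).
case: n {dn} dH => [|n] dH; last first.
  by rewrite (maxn_idPr _) //; apply: (thick_right rC).
by apply: (@thick_right _ _ rC 0); split=> // i; apply: (dimle01 rC (dH i)).
Qed.

End Levels.

Theorem theoremA (R : comPzRingType) (M : complex R) :
  noetherian R -> bounded_homology M ->
  [/\ (level (@flat_module R) M <=
         Order.max 2%:E (flat_dim (total_homology M) + 1))%E,
      (level (@gorenstein_projective R) M <=
         Order.max 2%:E (gproj_dim (total_homology M) + 1))%E,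
      (level (@gorenstein_injective R) M <=
         Order.max 2%:E (ginj_dim (total_homology M) + 1))%E
    & (level (@gorenstein_flat R) M <=
         Order.max 2%:E (gflat_dim (total_homology M) + 1))%E].
Proof.
move=> Rn bM; split.
- exact: left_level (flat_resolving R) bM.
- exact: left_level (gproj_resolving R) bM.
- exact: right_level (ginj_resolving R) bM.
- exact: left_level (gflat_resolving Rn) bM.
Qed.
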